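(* Let $\Gamma$ be a vertex-transitive graph on $n\le 13$ vertices. Then $\Gamma$ has quantum symmetries if and only if $\Gamma$ or its complement is isomorphic to one of the following graphs: (a) the complete graph $K_n$ with $n\ge 4$; (b) the disjoint union of $m\ge 2$ copies of a connected vertex-transitive graph with at least $2$ vertices; (c) one of the graphs $K_2\square C_4$ (on $8$ vertices), $K_2\square K_5$, $C_{10}(4)$ (on $10$ vertices); (d) one of the following graphs on $12$ vertices: $K_6\times K_2$, $K_3\times K_4$, $C_4\square C_3$, $K_2\square C_6(3)$, $K_2\square C_6(2)$, $C_{12}(5)$, $C_{12}(4,5)$, $C_{12}(5,6)$, $C_{12}(5^+)$, $C_{12}(3^+,6)$, $C_{12}(5^+,6)$.
   Context: All graphs are finite, undirected, without loops and without multiple edges; $i\sim k$ means that $i$ and $k$ are adjacent. A graph is vertex-transitive if its automorphism group acts transitively on its vertices. For a graph $\Gamma$ with vertex set $V$ and adjacency matrix $A$, $C(G_{aut}^+(\Gamma))$ is the universal unital $C^*$-algebra generated by elements $u_{ij}$ ($i,j\in V$) subject to $u_{ij}=u_{ij}^*=u_{ij}^2$, $\sum_{k}u_{ik}=1=\sum_k u_{ki}$ for all $i$, and $Au=uA$ where $u=(u_{ij})$ (equivalently, $u_{ij}u_{kl}=0$ whenever exactly one of $i\sim k$, $j\sim l$ holds). The graph $\Gamma$ has quantum symmetries if $C(G_{aut}^+(\Gamma))$ is non-commutative, and has no quantum symmetries if it is commutative. $C_n$ is the $n$-cycle. Circulant graphs: for $1<k_1<\dots<k_r\le\lfloor n/2\rfloor$,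 $C_n(k_1,\dots,k_r)$ has vertex set $\{1,\dots,n\}$, with $i\sim j$ iff $\min(|i-j|,n-|i-j|)\in\{1,k_1,\dots,k_r\}$. Semi-circulant graphs ($n$ even): $C_n(k_1,\dots,k_r,l_1^+,\dots,l_s^+)$ (the entries may be listed in any order) is obtained from $C_n(k_1,\dots,k_r)$ by adding an edge between $i$ and $j$ whenever $i$ is even and $j\equiv i+l_t \pmod n$ for some $t$. The direct product $\Gamma\times\Gamma'$ has vertex set $V(\Gamma)\times V(\Gamma')$ and $(i,k)\sim(j,l)$ iff $i\sim j$ and $k\sim l$. The Cartesian product $\Gamma\square\Gamma'$ has the same vertex set and $(i,k)\sim(j,l)$ iff ($i=j$ and $k\sim l$) or ($i\sim j$ and $k=l$). *)

(* Defs.v *)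
(* MathComp / MathComp-Analysis. *)
From HB Require Import structures.
From mathcomp Require Import all_boot all_order all_fingroup all_algebra.
From mathcomp Require Import complex.
From mathcomp Require Import classical_sets reals.

Set Implicit Arguments.
Unset Strict Implicit.
Unset Printing Implicit Defensive.

Import Order.TTheory GRing.Theory Num.Theory.

Local Open Scope ring_scope.

(* Unital complex C*-algebras. An algType is by definition nontrivial, i.e.
   satisfies 1 != 0. The norm is a separate field because the library hierarchy
   has no join of nonzero algebras with normed modules. *)
HB.mixin Record isCStarAlgebra (R : realType) A of GRing.Algebra R[i] A := {
  star : A -> A;
  cnorm : A -> R;
  starK : involutive star;
  starD : forall x y : A, star (x + y) = star x + star y;
  starZ : forall (a : R[i]) (x : A), star (a *: x) = Num.conj a *: star x;
  starM : forall x y : A, star (x * y) = star y * star x;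
  cnorm_eq0 : forall x : A, cnorm x = 0 -> x = 0;
  cnormD : forall x y : A, cnorm (x + y) <= cnorm x + cnorm y;
  cnormZ : forall (a : R[i]) (x : A), cnorm (a *: x) = Normc.normc a * cnorm x;
  cnormM : forall x y : A, cnorm (x * y) <= cnorm x * cnorm y;
  cstar_identity : forall x : A, cnorm (star x * x) = cnorm x ^+ 2;
  cnorm_complete : forall s : nat -> A,
    (forall e : R, 0 < e -> exists N : nat, forall m n : nat,
       (N <= m)%N -> (N <= n)%N -> cnorm (s m - s n) < e) ->
    exists l : A, forall e : R, 0 < e -> exists N : nat, forall n : nat,
       (N <= n)%N -> cnorm (s n - l) < e
}.

#[short(type="cstarAlgType")]
HB.structure Definition CStarAlgebra (R : realType) :=
  {A of GRing.Algebra R[i] A & isCStarAlgebra R A}.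

Record sgraph := SGraph {
  vertex :> finType;
  adj : rel vertex;
  adj_sym : symmetric adj;
  adj_irr : irreflexive adj
}.

Definition isomorphic (G H : sgraph) : Prop :=
  exists2 f : G -> H, bijective f & forall x y, adj (f x) (f y) = adj x y.

Definition vertex_transitive (G : sgraph) : Prop :=
  forall x y : G, exists2 s : {perm G},
    forall v w, adj (s v) (s w) = adj v w & s x = y.

Definition connected (G : sgraph) : Prop :=
  forall x y : G, connect (@adj G) x y.

(* The symmetric, loopless closure of a relation. *)
Section SimpleGraph.
Variables (V : finType) (e : rel V).
Definition simple_rel : rel V := fun x y => (x != y) && (e x y || e y x).
Fact simple_rel_sym : symmetric simple_rel.
Proof. by move=> x y; rewrite /simple_rel eq_sym orbC. Qed.
Fact simple_rel_irr : irreflexive simple_rel.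
Proof. by move=> x; rewrite /simple_rel eqxx. Qed.
Definition simple_graph := SGraph simple_rel_sym simple_rel_irr.
End SimpleGraph.

Definition compl_graph (G : sgraph) : sgraph :=
  simple_graph (fun x y : G => ~~ adj x y).

Definition complete_graph (n : nat) : sgraph :=
  simple_graph (fun _ _ : 'I_n => true).

Section Products.
Variables G H : sgraph.

Definition direct_rel : rel (G * H) :=
  fun x y => adj x.1 y.1 && adj x.2 y.2.
Fact direct_rel_sym : symmetric direct_rel.
Proof.
by move=> x y; rewrite /direct_rel (adj_sym x.1) (adj_sym x.2).
Qed.
Fact direct_rel_irr : irreflexive direct_rel.
Proof. by move=> x; rewrite /direct_rel adj_irr. Qed.
Definition direct_product := SGraph direct_rel_sym direct_rel_irr.

Definition cartesian_rel : rel (G * H) :=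
  fun x y => (x.1 == y.1) && adj x.2 y.2 || adj x.1 y.1 && (x.2 == y.2).
Fact cartesian_rel_sym : symmetric cartesian_rel.
Proof.
move=> x y; rewrite /cartesian_rel (adj_sym x.1) (adj_sym x.2).
by rewrite (eq_sym x.1) (eq_sym x.2).
Qed.
Fact cartesian_rel_irr : irreflexive cartesian_rel.
Proof. by move=> x; rewrite /cartesian_rel !adj_irr andbF. Qed.
Definition cartesian_product := SGraph cartesian_rel_sym cartesian_rel_irr.
End Products.

Section Copies.
Variables (m : nat) (G : sgraph).
Definition copies_rel : rel ('I_m * G) :=
  fun x y => (x.1 == y.1) && adj x.2 y.2.
Fact copies_rel_sym : symmetric copies_rel.
Proof. by move=> x y; rewrite /copies_rel eq_sym adj_sym. Qed.
Fact copies_rel_irr : irreflexive copies_rel.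
Proof. by move=> x; rewrite /copies_rel adj_irr andbF. Qed.
Definition disjoint_copies := SGraph copies_rel_sym copies_rel_irr.
End Copies.

(* The element i : 'I_n stands for the vertex i.+1 of {1, ..., n}. *)
Definition circulant_rel (n : nat) (ks : seq nat) : rel 'I_n :=
  fun i j => let d := (maxn i.+1 j.+1 - minn i.+1 j.+1)%N in
             (minn d (n - d) \in 1 :: ks)%N.

(* The graph C_n(k_1, ..., k_r), with ks = [:: k_1; ...; k_r]. *)
Definition circulant (n : nat) (ks : seq nat) : sgraph :=
  simple_graph (@circulant_rel n ks).

Definition semi_circulant_rel (n : nat) (ls : seq nat) : rel 'I_n :=
  fun i j => (~~ odd i.+1 && has (fun l => j.+1 == i.+1 + l %[mod n]) ls)%N.

(* The graph C_n(k_1, ..., k_r, l_1^+, ..., l_s^+), for n even. *)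
Definition semi_circulant (n : nat) (ks ls : seq nat) : sgraph :=
  simple_graph (fun i j : 'I_n =>
    circulant_rel ks i j || semi_circulant_rel ls i j).

Definition cycle_graph (n : nat) : sgraph := circulant n [::].

Section QuantumAutomorphisms.
Variables (R : realType) (G : sgraph).

(* The defining relations of C(G_aut^+(G)); the last one is the (i, j) entry of
   the matrix equation A u = u A, with A the adjacency matrix of G. *)
Definition qaut_relations (A : cstarAlgType R) (u : G -> G -> A) : Prop :=
  [/\ forall i j, star (u i j) = u i j /\ u i j ^+ 2 = u i j,
      forall i, \sum_k u i k = 1,
      forall i, \sum_k u k i = 1
    & forall i j, \sum_k (adj i k)%:R * u k j = \sum_k u i k * (adj k j)%:R].

Definition closed_star_subalgebra (A : cstarAlgType R) (S : set A) : Prop :=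
  [/\ forall x, (forall e : R, 0 < e -> exists2 y, S y & cnorm (x - y) < e) ->
        S x,
      S 1,
      forall (a : R[i]) x y, S x -> S y -> S (a *: x + y),
      forall x y, S x -> S y -> S (x * y)
    & forall x, S x -> S (star x)].

Definition generated_by (A : cstarAlgType R) (u : G -> G -> A) : Prop :=
  forall S : set A, closed_star_subalgebra S -> (forall i j, S (u i j)) ->
    forall x, S x.

(* (A, u) is the universal unital C*-algebra C(G_aut^+(G)) with its generators.
   The unital *-homomorphism f below is unique since the u i j generate A. *)
Definition is_qaut_algebra (A : cstarAlgType R) (u : G -> G -> A) : Prop :=
  [/\ qaut_relations u, generated_by u
    & forall (B : cstarAlgType R) (v : G -> G -> B), qaut_relations v ->
        exists f : {lrmorphism A -> B},
          (forall x, f (star x) = star (f x)) /\ forall i j, f (u i j) = v i j].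

(* C(G_aut^+(G)), which is unique up to isomorphism, is non-commutative. *)
Definition has_quantum_symmetries : Prop :=
  exists (A : cstarAlgType R) (u : G -> G -> A),
    is_qaut_algebra u /\ exists x y : A, x * y <> y * x.

End QuantumAutomorphisms.

Definition listed_a (G : sgraph) : Prop :=
  exists2 n : nat, (4 <= n)%N & isomorphic G (complete_graph n).

Definition listed_b (G : sgraph) : Prop :=
  exists (m : nat) (H : sgraph),
    [/\ (2 <= m)%N, connected H, vertex_transitive H, (2 <= #|H|)%N
      & isomorphic G (disjoint_copies m H)].

Definition listed_c (G : sgraph) : Prop :=
  [\/ isomorphic G (cartesian_product (complete_graph 2) (cycle_graph 4)),
      isomorphic G (cartesian_product (complete_graph 2) (complete_graph 5))
    | isomorphic G (circulant 10 [:: 4])].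

Definition graphs_d : seq sgraph :=
  [:: direct_product (complete_graph 6) (complete_graph 2);
      direct_product (complete_graph 3) (complete_graph 4);
      cartesian_product (cycle_graph 4) (cycle_graph 3);
      cartesian_product (complete_graph 2) (circulant 6 [:: 3]);
      cartesian_product (complete_graph 2) (circulant 6 [:: 2]);
      circulant 12 [:: 5];
      circulant 12 [:: 4; 5];
      circulant 12 [:: 5; 6];
      semi_circulant 12 [::] [:: 5];
      semi_circulant 12 [:: 6] [:: 3];
      semi_circulant 12 [:: 6] [:: 5]]%N.

Definition listed_d (G : sgraph) : Prop :=
  exists2 k : nat, (k < size graphs_d)%N & isomorphic G (nth G graphs_d k).

Definition listed (G : sgraph) : Prop :=
  [\/ listed_a G, listed_b G, listed_c G | listed_d G].

(* Main.v *)
(* If [s] and [t] are nontrivial automorphisms with disjoint supports and [p], [q] are projections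
   that do not commute, then [I + p (P_s - I) + q (P_t - I)] satisfies the relations and has entries
   that do not commute. All the listed graphs have such automorphisms.

   Conversely, [u i j * u k l] vanishes unless [(i, k)] and [(j, l)] have the same colour, for every
   colouring obtained from the adjacency matrix by matrix products and entrywise maps. Suppose that,
   on the quadruples [(a, b, c, d)] whose sides have the colours of [(i, r)], the indicator of
   [a = c] and [b = d] is a rational combination of functions of the colour of [(a, c)], functions of
   the colour of [(b, d)] and numbers of vertices with prescribed colours to [a], [b], [c] and [d].
   Summing [u r b * u i a * u r d * u i c] against this combination yields
   [(u r b * u i c)^2 = u r b * u i c], so the two projections commute. Such combinations exist
   whenever neither the graph nor its complement is listed, except for one class of pairs of the
   Petersen graph, which is settled by the commutation of its other class.

   To enumerate the vertex-transitive graphs, one may assume that the graph and its complement are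
   connected and that the valency is at most [(n - 1) / 2]. Sylow's theorems provide an automorphism
   of prime order with at most 3 fixed points, and an exhaustive search among the graphs invariant
   under it leaves the graphs tabulated below. *)
From HB Require Import structures.
From mathcomp Require Import all_boot all_order all_fingroup all_algebra.
From mathcomp Require Import cyclic pgroup center nilpotent sylow.
From mathcomp Require Import complex ring lra zify boolp reals.
Require Import Defs.

Set Implicit Arguments.
Unset Strict Implicit.
Unset Printing Implicit Defensive.

Import Order.TTheory GRing.Theory Num.Theory.

Local Open Scope ring_scope.

(** * Projections in C*-algebras *)

(** A C*-algebra is given here by its norm axioms alone, without positivity or a Hilbert space. Even
    the orthogonality of projections that sum to 1 has to be drawn from the norm: a projection [p]
    is an extreme point of the unit ball of its corner [p A p].

    [has_quantum_symmetries] asserts that the universal algebra exists, so it must be built. Its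
    elements are classes of sequences of *-polynomials. Representations are quantified over only in
    propositions, which keeps the carrier as small as those of the algebras it has to map to.

    Rational combinations, isomorphisms and automorphisms enter as data that are merely verified by
    computation. To stay within the natural numbers, a combination is multiplied by a common
    denominator [D] and its negative terms are moved to the other side.

    The bound on the valency loses nothing, because the valencies of a graph and of its complement
    add up to [n - 1]. When [n] is a prime power the automorphism has no fixed point at all. Among
    the other orders from 4 on, 6, 10 and 12, only 12 leaves room for three fixed points. *)

Section CStarFacts.
Variables (R : realType) (A : cstarAlgType R).
Implicit Types (x y p q b : A) (a : R[i]) (r s : R).

Lemma normc_real r : 0 <= r -> Normc.normc r%:C%C = r.
Proof. by move=> r0; rewrite /= expr0n addr0 sqrtr_sqr ger0_norm. Qed.

Lemma cnormZr r x : 0 <= r -> cnorm (r%:C%C *: x) = r * cnorm x.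
Proof. by move=> r0; rewrite cnormZ normc_real. Qed.

Lemma cnorm0 : cnorm (0 : A) = 0.
Proof. by rewrite -(scale0r (0 : A)) cnormZ Normc.normc0 mul0r. Qed.

Lemma cnormN x : cnorm (- x) = cnorm x.
Proof. by rewrite -scaleN1r cnormZ normcN Normc.normc1 mul1r. Qed.

Lemma cnorm_ge0 x : 0 <= cnorm x.
Proof.
have := cnormD x (- x); rewrite subrr cnorm0 cnormN -mulr2n.
by rewrite pmulrn_lge0.
Qed.

Lemma cnormB x y : cnorm (x - y) <= cnorm x + cnorm y.
Proof. by rewrite -(cnormN y) cnormD. Qed.

Lemma star0 : star (0 : A) = 0.
Proof. by rewrite -[X in star X](scale0r (0 : A)) starZ conjC0 !scale0r. Qed.

Lemma starN x : star (- x) = - star x.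
Proof. by rewrite -scaleN1r starZ rmorphN1 scaleN1r. Qed.

Lemma starB x y : star (x - y) = star x - star y.
Proof. by rewrite starD starN. Qed.

Lemma star1 : star (1 : A) = 1.
Proof.
have : star (star (1 : A) * 1) = star 1 by rewrite starM starK mulr1.
by rewrite mulr1 starK => <-.
Qed.

Lemma cnorm_sum (I : Type) (l : seq I) (P : pred I) (F : I -> A) :
  cnorm (\sum_(i <- l | P i) F i) <= \sum_(i <- l | P i) cnorm (F i).
Proof.
elim/big_ind2: _ => [|x r y s xr ys|//]; first by rewrite cnorm0.
exact: le_trans (cnormD _ _) (lerD xr ys).
Qed.

Lemma star_mul_eq0 x : star x * x = 0 -> x = 0.
Proof.
move=> xx0; apply: cnorm_eq0.
by have := cstar_identity x; rewrite xx0 cnorm0 => /esym/eqP; rewrite sqrf_eq0 => /eqP.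
Qed.

Lemma mul_star_eq0 x : x * star x = 0 -> x = 0.
Proof.
move=> xx0; rewrite -[x]starK (_ : star x = 0) ?star0 //.
by apply: star_mul_eq0; rewrite starK.
Qed.

Lemma cnorm_le1_star x : cnorm (star x * x) <= 1 -> cnorm x <= 1.
Proof. by rewrite cstar_identity expr_le1 ?cnorm_ge0. Qed.

Definition projection p := star p = p /\ p * p = p.

Lemma projection1 : projection 1.
Proof. by split; rewrite ?star1 ?mulr1. Qed.

Lemma projectionC p : projection p -> projection (1 - p).
Proof.
case=> ps pp; split; first by rewrite starB star1 ps.
by rewrite mulrBr mulr1 mulrBl mul1r pp subrr subr0.
Qed.

Lemma projection_norm p : projection p -> cnorm p <= 1.
Proof.
case=> ps pp; have := cstar_identity p; rewrite ps pp => e.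
have [->|p0] := eqVneq (cnorm p) 0; first exact: ler01.
by rewrite -(mulfK p0 (cnorm p)) -expr2 -e divff.
Qed.

Section Extreme.
Variable p : A.
Hypothesis p_proj : projection p.

Let cube a b : p * b = b -> b * p = b ->
  (p + a *: b) ^+ 3 = p + (3 * a) *: b + (3 * a ^+ 2) *: (b ^+ 2) + a ^+ 3 *: b ^+ 3.
Proof.
move=> pb bp; have [_ pp] := p_proj.
have h c : (p + a *: b) * (p + c) = (p + a *: b) * p + (p + a *: b) * c.
  by rewrite mulrDr.
have e2 : (p + a *: b) ^+ 2 = p + (2 * a) *: b + a ^+ 2 *: b ^+ 2.
  rewrite expr2 mulrDl !mulrDr pp -!scalerAl -!scalerAr pb bp scalerA -!expr2.
  by rewrite addrA -(addrA p) -scalerDl -mulr2n mulr_natl.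
rewrite exprS e2 mulrDl !mulrDr pp -!scalerAl -!scalerAr pb bp !scalerA.
rewrite expr2 (mulrA p) pb -expr2 -exprS.
rewrite -!addrA; congr (p + _); rewrite !addrA.
rewrite -(addrA _ (a ^+ 2 *: _)) (addrC (a ^+ 2 *: _)) !addrA.
rewrite -scalerDl -(addrA _ (a ^+ 2 *: _)) -scalerDl.
by congr (_ *: _ + _ *: _ + _ *: _); ring.
Qed.

(** In the corner with unit [p], these are bounds at the fourth roots of unity only. They are few
    enough to follow from the bounds at [p + b] and [p - b] when [b] is self-adjoint, and their
    convex hull contains all nodes of the averaging that enlarges [b]. *)
Definition tame b := forall a, a \in [:: 1; -1; 'i; - 'i] -> cnorm (p + a *: b) <= 1.

(** A polynomial of degree at most 3 in [b], with [p] in place of 1, stored as its four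
    coefficients: combinations of cubes are compared coefficient by coefficient. *)
Let comb b (c : R[i] * R[i] * R[i] * R[i]) : A :=
  c.1.1.1 *: p + c.1.1.2 *: b + c.1.2 *: b ^+ 2 + c.2 *: b ^+ 3.

Let combD b c d : comb b c + comb b d =
  comb b (c.1.1.1 + d.1.1.1, c.1.1.2 + d.1.1.2, c.1.2 + d.1.2, c.2 + d.2).
Proof.
by rewrite /comb /= !scalerDl; do 3!(rewrite addrACA; congr (_ + _)).
Qed.

Let combZ b a c : a *: comb b c =
  comb b (a * c.1.1.1, a * c.1.1.2, a * c.1.2, a * c.2).
Proof. by rewrite /comb /= !scalerDr !scalerA. Qed.

Lemma cnormZV (n : nat) x : cnorm (n%:R^-1 *: x) = n%:R^-1 * cnorm x.
Proof. by rewrite cnormZ Normc.normcV normcMn Normc.normc1. Qed.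

(* [1 + (3/2) z] is a convex combination of the cubes of [1 + w z], for [w] among
   [1, i, -i, (1 + i)/2, (1 - i)/2]: the weights make the moments of order 2
   and 3 of [w] vanish. *)
Lemma tame_scale b : p * b = b -> b * p = b -> tame b -> tame ((3 / 2) *: b).
Proof.
move=> pb bp tb a aS; set X := fun c : R[i] => (p + (c * a) *: b) ^+ 3.
have XE c : X c = comb b (1, 3 * (c * a), 3 * (c * a) ^+ 2, (c * a) ^+ 3).
  by rewrite /X cube // /comb scale1r.
have i2 : 'i ^+ 2 = -1 :> R[i] by rewrite sqrCi.
have -> : p + a *: ((3 / 2) *: b) =
    6^-1 *: X 1 + 12^-1 *: X 'i + 12^-1 *: X (- 'i)
    + 3^-1 *: X ((1 + 'i) / 2) + 3^-1 *: X ((1 - 'i) / 2).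
  rewrite !XE !combZ !combD /=.
  (* [field] treats ['i] as a variable, so the coefficients of degrees 2 and 3 keep the factor
     ['i ^+ 2 + 1], which vanishes afterwards. *)
  transitivity (comb b (1, (3 / 2) * a, ('i ^+ 2 + 1) * a ^+ 2,
                        ('i ^+ 2 + 1) / 4 * a ^+ 3)).
    by rewrite i2 addNr !mul0r /comb /= !scale0r !addr0 scale1r scalerA mulrC.
  by congr (comb b (_, _, _, _)); field.
have X1 c : cnorm (p + (c * a) *: b) <= 1 -> cnorm (X c) <= 1.
  move=> h; rewrite /X; elim: 3%N => [|n ih]; first by rewrite expr0; apply: projection_norm projection1.
  by rewrite exprS (le_trans (cnormM _ _)) // mulr_ile1 ?cnorm_ge0.
have S1 c : c \in [:: 1; 'i; - 'i] -> cnorm (p + (c * a) *: b) <= 1.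
  move=> cS; apply: tb; move: aS cS.
  rewrite !inE => /or4P[] /eqP -> /or3P[] /eqP ->;
  by rewrite ?mul1r ?mulr1 ?mulrN ?mulNr ?mulrN1 ?opprK ?mulr1 -?expr2 ?i2 ?opprK eqxx ?orbT.
(* The nodes [(1 + 'i) / 2] and [(1 - 'i) / 2] are midpoints of fourth roots of unity, and the unit
   ball is convex. *)
have S2 (c d : R[i]) : cnorm (p + (c * a) *: b) <= 1 -> cnorm (p + (d * a) *: b) <= 1 ->
    cnorm (p + ((c + d) / 2 * a) *: b) <= 1.
  move=> hc hd; have -> : p + ((c + d) / 2 * a) *: b =
      2^-1 *: ((p + (c * a) *: b) + (p + (d * a) *: b)).
    rewrite addrACA -mulr2n -scalerDl -[p *+ 2]scaler_nat scalerDr !scalerA.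
    rewrite mulVf ?pnatr_eq0 // scale1r.
    by congr (_ + _ *: _); field.
  rewrite cnormZV ler_pdivrMl ?ltr0n // mulr1 (le_trans (cnormD _ _)) //.
  by rewrite (_ : 2 = 1 + 1 :> R) ?lerD.
have in1 : cnorm (X 1) <= 1 by apply/X1/S1; rewrite inE eqxx.
have in2 : cnorm (X 'i) <= 1 by apply/X1/S1; rewrite !inE eqxx ?orbT.
have in3 : cnorm (X (- 'i)) <= 1 by apply/X1/S1; rewrite !inE eqxx ?orbT.
have in4 : cnorm (X ((1 + 'i) / 2)) <= 1.
  by apply/X1/S2; apply: S1; rewrite !inE eqxx ?orbT.
have in5 : cnorm (X ((1 - 'i) / 2)) <= 1.
  by apply/X1/S2; apply: S1; rewrite !inE eqxx ?orbT.
do 4!(apply: (le_trans (cnormD _ _)); rewrite -?lerBrDr).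
rewrite !cnormZV; lra.
Qed.

Lemma tame_eq0 b : p * b = b -> b * p = b -> tame b -> b = 0.
Proof.
move=> pb bp tb.
have tn n : cnorm (p + (3 / 2) ^+ n *: b) <= 1.
  have : tame ((3 / 2) ^+ n *: b).
    elim: n => [|n ih]; first by rewrite expr0 scale1r.
    by rewrite exprS -scalerA; apply: tame_scale; rewrite -?scalerAr -?scalerAl ?pb ?bp.
  by move=> /(_ 1); rewrite scale1r inE eqxx; apply.
have bn n : (3 / 2) ^+ n * cnorm b <= 2.
  have -> : (3 / 2) ^+ n * cnorm b = cnorm ((3 / 2) ^+ n *: b).
    rewrite -cnormZr ?exprn_ge0 ?divr_ge0 //; congr (cnorm (_ *: _)).
    by rewrite (rmorphXn (real_complex R)) (fmorph_div (real_complex R)) !(rmorph_nat (real_complex R)).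
  rewrite -[X in cnorm X](addrK p) [X in cnorm (X - _)]addrC (le_trans (cnormB _ _)) //.
  by rewrite (_ : 2 = 1 + 1 :> R) // lerD ?tn // projection_norm.
apply: cnorm_eq0; apply/eqP; rewrite eq_le cnorm_ge0 andbT leNgt; apply/negP => b0.
have bern n : 1 + n%:R / 2 <= (3 / 2 : R) ^+ n.
  elim: n => [|n ih]; first by rewrite mul0r addr0 expr0.
  rewrite exprS (le_trans _ (ler_wpM2l _ ih)) ?divr_ge0 //.
  have : 0 <= n%:R :> R by rewrite ler0n.
  rewrite -natr1; lra.
have [n nb] : exists n : nat, 4 / cnorm b < n%:R.
  exists (Num.bound (4 / cnorm b)); apply: archi_boundP.
  by rewrite divr_ge0 // ltW.
have := bn n; rewrite leNgt => /negP; apply.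
apply: lt_le_trans (ler_wpM2r (ltW b0) (bern n)).
move: nb; rewrite ltr_pdivrMr // => nb; nra.
Qed.

(* [|p + i b|^2 = |p + b^2|] turns the hypotheses into [tame b], and a nonzero [b] could not be
   scaled up indefinitely. *)
Lemma extreme_selfadjoint b : star b = b -> p * b = b -> b * p = b ->
  cnorm (p + b) <= 1 -> cnorm (p - b) <= 1 -> b = 0.
Proof.
move=> bs pb bp hp hm; have [ps pp] := p_proj.
have b2 : cnorm (p + b ^+ 2) <= 1.
  have -> : p + b ^+ 2 = 2^-1 *: ((p + b) ^+ 2 + (p - b) ^+ 2).
    have -> : (p + b) ^+ 2 = (p + b ^+ 2) + (b + b).
      by rewrite !expr2 mulrDl !mulrDr pp pb bp addrAC -!addrA; congr (_ + _); rewrite addrCA !addrA.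
    have -> : (p - b) ^+ 2 = (p + b ^+ 2) - (b + b).
      by rewrite !expr2 mulrBl !mulrBr pp pb bp opprB opprD -!addrA; congr (_ + _); rewrite addrCA.
    by rewrite addrACA subrr addr0 -mulr2n -[(p + _) *+ 2]scaler_nat scalerA mulVf ?scale1r ?pnatr_eq0.
  rewrite cnormZV ler_pdivrMl ?ltr0n // mulr1 (le_trans (cnormD _ _)) //.
  rewrite !expr2 (_ : 2 = 1 + 1 :> R) // lerD //;
  by rewrite (le_trans (cnormM _ _)) // mulr_ile1 ?cnorm_ge0.
have cN : Num.conj (- 'i) = 'i :> R[i] by rewrite raddfN /= conjCi opprK.
apply: tame_eq0 => // a; rewrite !inE => /or4P[] /eqP ->; rewrite ?scaleN1r ?scale1r //.
- apply: cnorm_le1_star; rewrite starD starZ ps bs conjCi.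
  rewrite mulrDl !mulrDr -!scalerAl -!scalerAr pp pb bp scalerA scaleNr addrA addrK.
  by rewrite mulNr -expr2 sqrCi opprK scale1r.
- apply: cnorm_le1_star; rewrite starD starZ ps bs cN.
  rewrite mulrDl !mulrDr -!scalerAl -!scalerAr pp pb bp scalerA scaleNr addrA subrK.
  by rewrite mulrN -expr2 sqrCi opprK scale1r.
Qed.
End Extreme.

End CStarFacts.

Section Projections.
Variables (R : realType) (A : cstarAlgType R).
Implicit Types (x y p q b : A).

(** Put [p = q j]. The compressions [p * q k * p] with [k] different from [j] sum to 0. Positivity
    would make each of them vanish; here extremality of [p] does, since a small multiple of any of
    them can be both added to and subtracted from [p] within the unit ball. *)
Lemma sum_projection_orthogonal (I : finType) (q : I -> A) :
  (forall k, projection (q k)) -> \sum_k q k = 1 ->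
  forall i j, i != j -> q i * q j = 0.
Proof.
move=> qp q1 j0 j1 jn; have [ps pp] := qp j1; set p := q j1.
pose a k := p * q k * p.
have as_ k : star (a k) = a k.
  by rewrite /a !starM ps (qp k).1 mulrA.
have pa k : p * a k = a k by rewrite /a !mulrA pp.
have ap k : a k * p = a k by rewrite /a -!mulrA pp.
have pn : cnorm p <= 1 by apply: projection_norm; apply: qp.
have na k : cnorm (p - a k) <= 1.
  have -> : p - a k = p * (1 - q k) * p by rewrite mulrBr mulr1 mulrBl pp.
  do 2!rewrite (le_trans (cnormM _ _)) // mulr_ile1 ?cnorm_ge0 //.
  exact: projection_norm (projectionC (qp k)).
have suma : \sum_(k | k != j1) a k = 0.
  have : \sum_k a k = p by rewrite /a -mulr_suml -mulr_sumr q1 mulr1 pp.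
  rewrite (bigD1 j1) //= {1}/a pp pp => /eqP.
  by rewrite -subr_eq0 addrAC subrr add0r => /eqP.
set n := #|I|.
have n0 : (0 < n)%N by apply/card_gt0P; exists j0.
have nR : 0 < n%:R :> R by rewrite ltr0n.
have nC : n%:R != 0 :> R[i] by rewrite pnatr_eq0 -lt0n.
(* [p - a j0 / n] and [p + a j0 / n] are averages of elements [p] and [p - a k] of the unit ball,
   since the [a k] with [k != j1] sum to 0. *)
have avg (F : I -> A) : (forall k, cnorm (F k) <= 1) ->
    cnorm (n%:R^-1 *: \sum_k F k) <= 1.
  move=> hF; rewrite cnormZV ler_pdivrMl // mulr1 (le_trans (cnorm_sum _ _ _)) //.
  by rewrite (le_trans (ler_sum _ (fun k _ => hF k))) // sumr_const.
have psum : n%:R^-1 *: \sum_(k : I) p = p.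
  by rewrite sumr_const -/n -[p *+ n]scaler_nat scalerA mulVf // scale1r.
have tm : cnorm (p - n%:R^-1 *: a j0) <= 1.
  have := avg (fun k => if k == j0 then p - a j0 else p).
  have -> : \sum_k (if k == j0 then p - a j0 else p) = \sum_(k : I) p - a j0.
    rewrite (bigD1 j0) //= eqxx [in RHS](bigD1 j0) //= addrAC; congr (_ + _ - _).
    by apply: eq_bigr => k /negPf ->.
  by rewrite scalerBr psum; apply => k; case: ifP => // _; apply: na.
have tp : cnorm (p + n%:R^-1 *: a j0) <= 1.
  have := avg (fun k => if (k != j1) && (k != j0) then p - a k else p).
  have -> : \sum_k (if (k != j1) && (k != j0) then p - a k else p)
      = \sum_(k : I) p + a j0.
    have -> : a j0 = - \sum_(k | (k != j1) && (k != j0)) a k.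
      by move: suma; rewrite (bigD1 j0) //= => /eqP; rewrite addr_eq0 => /eqP.
    rewrite [X in _ - X]big_mkcond -sumrB; apply: eq_bigr => k _.
    by case: ifP => // _; rewrite subr0.
  by rewrite scalerDr psum; apply => k; case: ifP => // _; apply: na.
have ta : n%:R^-1 *: a j0 = 0.
  apply: (@extreme_selfadjoint R A p) => //.
  - by rewrite starZ as_ (_ : Num.conj n%:R^-1 = n%:R^-1) // fmorphV rmorph_nat.
  - by rewrite -scalerAr pa.
  - by rewrite -scalerAl ap.
have a0 : a j0 = 0.
  by apply/eqP; move/eqP: ta; rewrite scaler_eq0 invr_eq0 (negPf nC).
apply: star_mul_eq0; rewrite starM ps (qp j0).1 mulrA -(mulrA p) (qp j0).2.
exact: a0.
Qed.

(** The hypothesis makes the product of [p * q * (1 - p)] and its adjoint vanish, so [p * q] equals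
    [p * q * p], which is self-adjoint. *)
Lemma projection_commute p q : projection p -> projection q ->
  p * q * p * q = p * q -> p * q = q * p.
Proof.
move=> [ps pp] [qs qq] e.
have e1 : p * q = p * q * p.
  apply/eqP; rewrite -subr_eq0; apply/eqP; apply: mul_star_eq0.
  rewrite starB !starM ps qs mulrBl !mulrBr !mulrA.
  rewrite -(mulrA p q q) qq e -!(mulrA (p * q) p p) pp e.
  by rewrite !subrr.
have := congr1 (@star _ _) e1; rewrite !starM ps qs mulrA => e2.
by rewrite e1 -e2.
Qed.
End Projections.

(** * Magic unitaries and the matrices that they respect *)

Section Magic.
Variables (R : realType) (A : cstarAlgType R) (V : finType) (u : V -> V -> A).

(** A magic unitary, that is, a quantum permutation of [V]. *)
Definition magic :=
  [/\ forall i j, projection (u i j), forall i, \sum_k u i k = 1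
    & forall i, \sum_k u k i = 1].

Hypothesis u_magic : magic.

Lemma magic_row i j k : j != k -> u i j * u i k = 0.
Proof.
by have [up u1 _] := u_magic; apply: (sum_projection_orthogonal (q := u i)).
Qed.

Lemma magic_col i j k : i != j -> u i k * u j k = 0.
Proof.
have [up _ u1] := u_magic.
by apply: (sum_projection_orthogonal (q := u^~ k)).
Qed.

Lemma magic_idem i j : u i j * u i j = u i j.
Proof. by case: u_magic => /(_ i j)[]. Qed.

Lemma magic_star i j : star (u i j) = u i j.
Proof. by case: u_magic => /(_ i j)[]. Qed.

Lemma magic_sum_row i : \sum_k u i k = 1. Proof. by case: u_magic. Qed.
Lemma magic_sum_col i : \sum_k u k i = 1. Proof. by case: u_magic. Qed.

Lemma magic_eq0_sym i j k l : u i j * u k l = 0 -> u k l * u i j = 0.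
Proof. by move=> h; rewrite -[LHS]starK starM !magic_star h star0. Qed.

(* [M] intertwines [u]: equivalent to [M *m u = u *m M] for a matrix [M]. *)
Definition respects (T : eqType) (M : V -> V -> T) :=
  forall i j k l, M i k != M j l -> u i j * u k l = 0.

Lemma respects_sum (M : V -> V -> nat) i j :
  respects M -> \sum_k (M i k)%:R * u k j = \sum_k u i k * (M k j)%:R.
Proof.
move=> uM.
transitivity (\sum_k \sum_l (M i k)%:R * (u i l * u k j)).
  by apply: eq_bigr => k _; rewrite -mulr_sumr -mulr_suml magic_sum_row mul1r.
rewrite exchange_big /=; apply: eq_bigr => l _.
rewrite -[u i l in RHS]mulr1 -[X in _ * X * _](magic_sum_col j) mulr_sumr mulr_suml.
apply: eq_bigr => k _; have [e|/uM ->] := eqVneq (M i k) (M l j); last by rewrite mulr0 mul0r.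
by rewrite e mulr_natl mulr_natr.
Qed.

(** Multiply the relation by [u i j] on the left and by [u k l] on the right. Orthogonality in rows
    and columns leaves one term on each side, with coefficients [M i k] and [M j l]; if these
    differ, the product vanishes. *)
Lemma respects_of_sum (M : V -> V -> nat) :
  (forall i j, \sum_k (M i k)%:R * u k j = \sum_k u i k * (M k j)%:R) -> respects M.
Proof.
move=> uM i j k l Mn.
have e : (M i k)%:R * (u i j * u k l) = (M j l)%:R * (u i j * u k l) :> A.
  transitivity (u i j * (\sum_t (M i t)%:R * u t l) * u k l).
    rewrite mulr_sumr mulr_suml (bigD1 k) //= big1 ?addr0 => [|t tk].
      by rewrite !mulr_natl mulrnAr mulrnAl -mulrA magic_idem.
    by rewrite -!mulrA magic_col // !mulr0.
  rewrite uM mulr_sumr mulr_suml (bigD1 j) //= big1 ?addr0 => [|t tj].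
    by rewrite mulr_natr mulr_natl mulrnAr mulrnAl magic_idem.
  by rewrite mulrA magic_row 1?eq_sym // !mul0r.
apply/eqP; move: e; rewrite !mulr_natl -[_ *+ M i k]scaler_nat -[_ *+ M j l]scaler_nat => /eqP.
rewrite -subr_eq0 -scalerBl scaler_eq0 subr_eq0 eqr_nat.
by rewrite (negPf Mn).
Qed.
End Magic.

Section Commutation.
Variables (R : realType) (A : cstarAlgType R) (V : finType) (u : V -> V -> A).
Hypothesis u_magic : magic u.

(* A product inserted between [u i j] and [u r l] only survives on the columns
   in [N]; with at most three columns this leaves no room for a third value. *)
Lemma three_columns (e : A) (N : pred V) (i r j l : V) :
  star e = e -> (forall x, e * u i x = u i x * e) ->
  (forall x, e * u r x = u r x * e) ->
  (forall x, ~~ N x -> e * u i x = 0) -> (forall x, ~~ N x -> e * u r x = 0) ->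
  (#|N| <= 3)%N -> e * (u i j * u r l) = e * (u r l * u i j).
Proof.
move=> es ei er Ni Nr N3.
have [->|ir] := eqVneq i r.
  by have [->//|jl] := eqVneq j l; rewrite !(magic_row u_magic) // eq_sym.
have [->|jl] := eqVneq j l.
  by rewrite !(magic_col u_magic) // eq_sym.
have [Nj|Nj] := boolP (N j); last by rewrite mulrA Ni // mul0r mulrA er -mulrA Ni // mulr0.
have [Nl|Nl] := boolP (N l); last by rewrite mulrA ei -mulrA Nr // mulr0 mulrA Nr // mul0r.
have third p : p != j -> e * u i j * u r l * u i p = 0.
  move=> pj; have [Np|Np] := boolP (N p); last first.
    by rewrite ei -(mulrA (u i j)) er -!mulrA Ni // !mulr0.
  have [->|pl] := eqVneq p l; first by rewrite -!mulrA (magic_col u_magic) ?mulr0 // eq_sym.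
  have NE x : N x -> x != j -> x != p -> x = l.
    move=> Nx xj xp; apply/eqP; apply: contraLR N3 => xl; rewrite -ltnNge.
    have /card_uniqP u4 : uniq [:: x; j; p; l].
      by rewrite /= !inE !negb_or xj xp xl eq_sym pj jl pl.
    apply: (@leq_trans #|[:: x; j; p; l]|); first by rewrite u4.
    apply: subset_leq_card; apply/fintype.subsetP => y.
    by rewrite !inE => /or4P[] /eqP -> .
  have : \sum_x e * u i j * u r x * u i p = 0.
    rewrite -mulr_suml -mulr_sumr (magic_sum_row u_magic) mulr1 -mulrA.
    by rewrite (magic_row u_magic) ?mulr0 // eq_sym.
  rewrite (bigD1 l) //= big1 ?addr0 // => x xl.
  have [->|xj] := eqVneq x j; first by rewrite -(mulrA e) (magic_col u_magic) ?mulr0 ?mul0r.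
  have [->|xp] := eqVneq x p; first by rewrite -!mulrA (magic_col u_magic) ?mulr0 // eq_sym.
  have [Nx|Nx] := boolP (N x); first by rewrite (NE x) ?eqxx in xl.
  by rewrite ei -!mulrA (mulrA e) Nr ?mul0r ?mulr0.
have e1 : e * (u i j * u r l) = e * u i j * u r l * u i j.
  rewrite mulrA -[LHS]mulr1 -(magic_sum_row u_magic i) mulr_sumr (bigD1 j) //=.
  by rewrite big1 ?addr0 // => p pj; apply: third.
have := congr1 (@star _ _) e1; rewrite !starM !(magic_star u_magic) es => e2.
transitivity (u r l * u i j * e); last by rewrite [RHS]mulrA er -!mulrA ei.
by rewrite e2 e1 ei -(mulrA (u i j)) er -!mulrA ei.
Qed.

Lemma natr_inj_eq0 (m n : nat) (x : A) : m%:R * x = n%:R * x -> m != n -> x = 0.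
Proof.
move=> e mn; apply/eqP; move: e; rewrite !mulr_natl -[_ *+ m]scaler_nat -[_ *+ n]scaler_nat => /eqP.
by rewrite -subr_eq0 -scalerBl scaler_eq0 subr_eq0 eqr_nat (negPf mn).
Qed.

(** The matrix of weights times its transpose. Inserting the complete row [u x _] between [u i j]
    and [u k l] lets each summand exchange the colours of [(i, x)] and [(k, x)] for those of
    [(j, y)] and [(l, y)]. Iterated, this refines the colouring. *)
Lemma respects_dot (C : V -> V -> nat) (w : nat -> nat) : respects u C ->
  respects u (fun i j => \sum_x w (C i x) * w (C j x))%N.
Proof.
move=> uC i j k l; apply: natr_inj_eq0.
rewrite !natr_sum !mulr_suml.
transitivity (\sum_x \sum_y (w (C i x) * w (C k x))%:R * (u i j * u x y * u k l)).
  apply: eq_bigr => x _; rewrite -mulr_sumr -mulr_suml -mulr_sumr.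
  by rewrite (magic_sum_row u_magic) mulr1.
rewrite exchange_big /=; apply: eq_bigr => y _.
transitivity (\sum_x (w (C j y) * w (C l y))%:R * (u i j * u x y * u k l)).
  apply: eq_bigr => x _.
  have [->|/uC ->] := eqVneq (C i x) (C j y); last by rewrite !mul0r !mulr0.
  have [->//|/uC h] := eqVneq (C k x) (C l y).
  by rewrite -mulrA (magic_eq0_sym u_magic h) !mulr0.
by rewrite -mulr_sumr -mulr_suml -mulr_sumr (magic_sum_col u_magic) mulr1.
Qed.

(* Functions of four vertices whose sum against [u r b * u i a * u r d * u i c], over [a] and [d],
   collapses to a multiple of [u r b * u i c]. *)
Inductive quad_term := AC of nat | BD of nat | Star of nat & nat.

Definition quad_val (C : V -> V -> nat) t (a b c d : V) : nat :=
  match t with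
  | AC q => C a c == q
  | BD q => C b d == q
  | Star p q => #|[pred x | [&& C a x == p, C b x == q, C c x == p & C d x == q]]|
  end.

(** For [AC] the sum over [d] is a row sum equal to 1, and then [u i a * u i c] forces [a = c]; [BD]
    is symmetric. For [Star], the conditions on a counted vertex [x] are carried through [u]: the
    sums over [a] and [d] turn into combinations of [u y x], column orthogonality identifies the two
    indices [y], the colours of [(b, x)] and [(c, x)] become those of [(r, y)] and [(i, y)], and the
    sum over [x] is a row sum. *)
Lemma quad_val_sum (C : V -> V -> nat) t i r b c : respects u C ->
  \sum_a \sum_d (quad_val C t a b c d)%:R * (u r b * u i a * u r d * u i c) =
  (quad_val C t i r i r)%:R * (u r b * u i c).
Proof.
move=> uC; case: t => [q|q|p q] /=.
- transitivity (\sum_a (C a c == q)%:R * (u r b * u i a * u i c)).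
    apply: eq_bigr => a _; rewrite -mulr_sumr; congr (_ * _).
    by rewrite -mulr_suml -mulr_sumr (magic_sum_row u_magic) mulr1.
  rewrite (bigD1 c) //= big1 ?addr0 => [|a ac]; last first.
    by rewrite -mulrA (magic_row u_magic) ?mulr0.
  rewrite -mulrA (magic_idem u_magic).
  have [->//|/uC h] := eqVneq (C i i) (C c c).
  by move: (h); rewrite (magic_idem u_magic) => ->; rewrite !mulr0.
- rewrite exchange_big /=.
  transitivity (\sum_d (C b d == q)%:R * (u r b * u r d * u i c)).
    apply: eq_bigr => d _; rewrite -mulr_sumr; congr (_ * _).
    by rewrite -!mulr_suml -mulr_sumr (magic_sum_row u_magic) mulr1.
  rewrite (bigD1 b) //= big1 ?addr0 => [|d db]; last first.
    by rewrite (magic_row u_magic) ?mul0r ?mulr0 // eq_sym.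
  rewrite (magic_idem u_magic).
  have [->//|/uC h] := eqVneq (C r r) (C b b).
  by move: (h); rewrite (magic_idem u_magic) => ->; rewrite mul0r !mulr0.
pose E s a x : nat := (C a x == s).
have uE s : respects u (E s) by move=> a b' c' d h; apply: uC; apply: contraNneq h; rewrite /E => ->.
have card_sum a b' c' d : (#|[pred x | [&& C a x == p, C b' x == q, C c' x == p & C d x == q]]|)%:R
    = \sum_x (E p a x * E q d x * (E q b' x * E p c' x))%:R :> A.
  rewrite -sum1_card natr_sum big_mkcond /=; apply: eq_bigr => x _.
  by rewrite inE /E; do 4!case: eqP => _ //=.
have sE s a' x : \sum_a (E s a x)%:R * u a' a = \sum_y (E s a' y)%:R * u y x.
  rewrite (respects_sum u_magic _ _ (uE s)).
  by apply: eq_bigr => y _; rewrite mulr_natl mulr_natr.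
transitivity (\sum_x (E q b x * E p c x)%:R *
    (u r b * (\sum_a (E p a x)%:R * u i a) * (\sum_d (E q d x)%:R * u r d) * u i c)).
  transitivity (\sum_a \sum_d \sum_x (E q b x * E p c x)%:R *
      (u r b * ((E p a x)%:R * u i a) * ((E q d x)%:R * u r d) * u i c)).
    apply: eq_bigr => a _; apply: eq_bigr => d _; rewrite card_sum mulr_suml.
    apply: eq_bigr => x _; rewrite !mulr_natl !(mulrnAr, mulrnAl) -!mulrnA.
    by congr (_ *+ _); ring.
  under eq_bigr do rewrite exchange_big /=.
  rewrite exchange_big /=; apply: eq_bigr => x _.
  rewrite [u r b * _]mulr_sumr !mulr_suml mulr_sumr; apply: eq_bigr => a _.
  by rewrite -mulr_sumr -mulr_suml -mulr_sumr.
transitivity (\sum_x \sum_y (E q b x * E p c x * (E p i y * E q r y))%:R *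
    (u r b * u y x * u i c)).
  apply: eq_bigr => x _; rewrite !sE -(mulrA (u r b)) mulr_suml.
  rewrite (eq_bigr (fun y => (E p i y * E q r y)%:R * u y x)); last first.
    move=> y _; rewrite mulr_sumr (bigD1 y) //= big1 ?addr0 => [|z zy]; last first.
      by rewrite !mulr_natl mulrnAr mulrnAl (magic_col u_magic) ?mul0rn // eq_sym.
    by rewrite !mulr_natl mulrnAr mulrnAl (magic_idem u_magic) -mulrnA mulnC.
  rewrite !mulr_sumr mulr_suml mulr_sumr; apply: eq_bigr => y _.
  by rewrite !mulr_natl mulrnAr mulrnAl -mulrnA mulnC.
rewrite exchange_big /= card_sum mulr_suml; apply: eq_bigr => y _.
transitivity (\sum_x (E p i y * E q r y * (E q r y * E p i y))%:R *
    (u r b * u y x * u i c)).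
  apply: eq_bigr => x _.
  have [<-|/(uE q) ->] := eqVneq (E q r y) (E q b x); last by rewrite !mul0r !mulr0.
  have [<-|/(uE p) h] := eqVneq (E p i y) (E p c x).
    by congr (_%:R * _); ring.
  by rewrite -mulrA (magic_eq0_sym u_magic h) !mulr0.
by rewrite -mulr_sumr -mulr_suml -mulr_sumr (magic_sum_row u_magic) mulr1.
Qed.

Lemma quad_commute (C : V -> V -> nat) (D : nat) (pos neg : seq quad_term) i r :
  respects u C -> (0 < D)%N ->
  (forall a b c d, C b c = C r i -> C b a = C r i -> C d a = C r i -> C d c = C r i ->
    (\sum_(t <- pos) quad_val C t a b c d =
     \sum_(t <- neg) quad_val C t a b c d + D * ((a == c) && (b == d)))%N) ->
  forall b c, u r b * u i c = u i c * u r b.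
Proof.
move=> uC D0 hC b c; have [up _ _] := u_magic.
have [bc|/eqP bc] := eqVneq (C r i) (C b c); last first.
  have h : u r b * u i c = 0 by apply: uC; apply/eqP.
  by rewrite h (magic_eq0_sym u_magic h).
apply: projection_commute => //.
set X := fun a d => u r b * u i a * u r d * u i c.
have sumX (s : seq quad_term) : \sum_a \sum_d (\sum_(t <- s) quad_val C t a b c d)%:R * X a d
    = (\sum_(t <- s) quad_val C t i r i r)%:R * (u r b * u i c).
  rewrite natr_sum mulr_suml.
  under eq_bigr do under eq_bigr do rewrite natr_sum mulr_suml.
  under eq_bigr do rewrite exchange_big /=.
  by rewrite exchange_big /=; apply: eq_bigr => t _; apply: quad_val_sum.
have e : \sum_a \sum_d (\sum_(t <- pos) quad_val C t a b c d)%:R * X a d =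
   \sum_a \sum_d (\sum_(t <- neg) quad_val C t a b c d)%:R * X a d + D%:R * X c b.
  have -> : D%:R * X c b = \sum_a \sum_d (D * ((a == c) && (b == d)))%:R * X a d.
    rewrite (bigD1 c) //= (bigD1 b) //= !eqxx muln1 !big1 ?addr0 //.
      by move=> a /negPf ac; rewrite big1 // => d _; rewrite ac muln0 mul0r.
    by move=> d /negPf db; rewrite eq_sym db andbF muln0 mul0r.
  rewrite -big_split; apply: eq_bigr => a _; rewrite -big_split; apply: eq_bigr => d _ /=.
  rewrite -mulrDl -natrD /X.
  have [ba|/uC ->] := eqVneq (C r i) (C b a); last by rewrite !mul0r !mulr0.
  have [da|/uC h] := eqVneq (C r i) (C d a); last first.
    by rewrite -(mulrA (u r b)) (magic_eq0_sym u_magic h) mulr0 mul0r !mulr0.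
  have [dc|/uC h] := eqVneq (C r i) (C d c); last by rewrite -!mulrA h !mulr0.
  by rewrite hC.
(* Summation replaced every term by its value at the quadruple [(i, r, i, r)]. It satisfies the same
   identity, with indicator 1, so that [D] times [u r b * u i c] remains. *)
have e0 := hC i r i r erefl erefl erefl erefl; rewrite !eqxx muln1 in e0.
move: e; rewrite !sumX e0 natrD mulrDl => /addrI e.
apply/eqP; rewrite -subr_eq0; apply/eqP.
apply: (@natr_inj_eq0 D 0) (lt0n_neq0 D0).
by rewrite mul0r mulrBr -/(X c b) -e subrr.
Qed.

End Commutation.

(** * Certificates of commutativity *)

Definition commutes (G : sgraph) : Prop :=
  forall (R : realType) (A : cstarAlgType R) (u : G -> G -> A),
    qaut_relations u -> forall i j k l, u i j * u k l = u k l * u i j.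

Definition adjb (M : seq (seq bool)) i j := nth false (nth [::] M i) j.

Definition presented (G : sgraph) (n : nat) (M : seq (seq bool)) : Prop :=
  exists2 f : 'I_n -> G, bijective f & forall i j, adj (f i) (f j) = adjb M i j.

Section ColourMatrices.
Local Open Scope nat_scope.

Definition ent (C : seq (seq nat)) i j := nth 0 (nth [::] C i) j.

Fixpoint dot (r s : seq nat) :=
  if r is a :: r' then if s is b :: s' then a * b + dot r' s' else 0 else 0.

Definition colour0 n (M : seq (seq bool)) : seq (seq nat) :=
  [seq [seq (if eqn i j then 0 else if adjb M i j then 1 else 2) | j <- iota 0 n]
     | i <- iota 0 n].

(* A step [(weights, values)] multiplies the matrix of the weights of the colours by its transpose;
   the position of an entry in [values] is its new colour. *)
Definition recolour (C : seq (seq nat)) (step : seq nat * seq nat) : seq (seq nat) :=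
  let W := [seq [seq nth 0 step.1 c | c <- r] | r <- C] in
  [seq [seq index (dot r s) step.2 | s <- W] | r <- W].

Fixpoint star_count p q (ra rb rc rd : seq nat) : nat :=
  match ra, rb, rc, rd with
  | a :: ra', b :: rb', c :: rc', d :: rd' =>
      if [&& eqn a p, eqn b q, eqn c p & eqn d q]
      then (star_count p q ra' rb' rc' rd').+1 else star_count p q ra' rb' rc' rd'
  | _, _, _, _ => 0
  end.

Definition quad_eval t (ra rb rc rd : seq nat) c d : nat :=
  match t with
  | AC q => eqn (nth 0 ra c) q
  | BD q => eqn (nth 0 rb d) q
  | Star p q => star_count p q ra rb rc rd
  end.

Definition quad_total ts ra rb rc rd c d :=
  foldr (fun t => addn (quad_eval t ra rb rc rd c d)) 0 ts.

(* [Quad D pos neg] certifies a class whose closed quadruples satisfy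
   [sum of pos = sum of neg + D * (a == c && b == d)]. [Local q] certifies a class of pairs with a
   common neighbour for the class [q], which must have its own [Quad] certificate and valency at
   most 3; the class of non-adjacent vertices of the Petersen graph needs it. *)
Inductive class_cert :=
  | Quad of nat & seq quad_term & seq quad_term
  | Local of nat.

Definition quad_ok n C k D pos neg :=
  all (fun b => let rb := nth [::] C b in
  all (fun c => ~~ eqn (nth 0 rb c) k || (let rc := nth [::] C c in
  all (fun a => ~~ eqn (nth 0 rb a) k || (let ra := nth [::] C a in
  all (fun d => let rd := nth [::] C d in
    ~~ eqn (nth 0 rd a) k || ~~ eqn (nth 0 rd c) k ||
    eqn (quad_total pos ra rb rc rd c d)
        (quad_total neg ra rb rc rd c d + D * (eqn a c && eqn b d)))
  (iota 0 n))) (iota 0 n))) (iota 0 n)) (iota 0 n).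

Definition is_quad (kc : nat * class_cert) := if kc.2 is Quad _ _ _ then true else false.

Definition class_ok n C certs (kc : nat * class_cert) :=
  match kc.2 with
  | Quad D pos neg => (0 < D) && quad_ok n C kc.1 D pos neg
  | Local q =>
      [&& has (fun kc' => is_quad kc' && eqn kc'.1 q) certs,
          all (fun r => count (eqn q) r <= 3) C
        & all (fun r => all (fun s => ~~ eqn (ent C r s) kc.1 ||
              has (fun m => eqn (ent C m r) q && eqn (ent C m s) q) (iota 0 n))
            (iota 0 n)) (iota 0 n)]
  end.

Definition commuting_cert n M steps certs :=
  let C := foldl recolour (colour0 n M) steps in
  all (class_ok n C certs) certs &&
  all (fun r => all (fun s => eqn r s || has (fun kc => eqn kc.1 (ent C r s)) certs)
    (iota 0 n)) (iota 0 n).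
End ColourMatrices.

Section Soundness.
Local Open Scope nat_scope.

Definition square n (C : seq (seq nat)) := size C == n /\ all (fun r => size r == n) C.

Lemma square_row n C i : square n C -> i < n -> size (nth [::] C i) = n.
Proof. by case=> /eqP sC /allP aC ni; apply/eqP/aC/mem_nth; rewrite sC. Qed.

Lemma square_colour0 n M : square n (colour0 n M).
Proof.
split; first by rewrite size_map size_iota.
by apply/allP => r /mapP[i _ ->]; rewrite size_map size_iota.
Qed.

Lemma square_recolour n C st : square n C -> square n (recolour C st).
Proof.
case=> sC _; split; first by rewrite !size_map.
by apply/allP => r /mapP[i _ ->]; rewrite !size_map.
Qed.

Lemma ent_colour0 n M i j : i < n -> j < n ->
  ent (colour0 n M) i j = if i == j then 0 else if adjb M i j then 1 else 2.
Proof.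
move=> ni nj; rewrite /ent /colour0 (nth_map 0) ?size_iota // nth_iota //.
by rewrite (nth_map 0) ?size_iota // nth_iota // !add0n eqnE.
Qed.

Lemma dot_sum n (r s : seq nat) : size r = n -> size s = n ->
  dot r s = \sum_(x < n) nth 0 r x * nth 0 s x.
Proof.
elim: n r s => [|n ih] [|a r] [|b s] //=; first by rewrite big_ord0.
by move=> [sr] [ss]; rewrite big_ord_recl /= (ih r s).
Qed.

Lemma ent_recolour n C st i j : square n C -> i < n -> j < n ->
  ent (recolour C st) i j =
  index (\sum_(x < n) nth 0 st.1 (ent C i x) * nth 0 st.1 (ent C j x)) st.2.
Proof.
move=> sqC ni nj; have sC := eqP sqC.1.
rewrite /ent /recolour (nth_map [::]) ?size_map ?sC // (nth_map [::]) ?size_map ?sC //.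
rewrite !(nth_map [::]) ?sC // (@dot_sum n) ?size_map ?(square_row sqC) //.
congr index; apply: eq_bigr => x _.
by rewrite !(nth_map 0) ?(square_row sqC).
Qed.

Lemma star_count_card n p q ra rb rc rd :
  size ra = n -> size rb = n -> size rc = n -> size rd = n ->
  star_count p q ra rb rc rd =
  #|[pred x : 'I_n | [&& nth 0 ra x == p, nth 0 rb x == q, nth 0 rc x == p & nth 0 rd x == q]]|.
Proof.
rewrite -sum1_card; under eq_bigl do rewrite inE; rewrite big_mkcond.
elim: n ra rb rc rd => [|n ih] [|a ra] [|b rb] [|c rc] [|d rd] //=.
  by rewrite big_ord0.
move=> [sa] [sb] [sc] [sd]; rewrite big_ord_recl /= !eqnE (ih ra rb rc rd) //.
by case: ifP; rewrite ?add1n ?add0n.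
Qed.
End Soundness.

Section Certificates.
Variables (R : realType) (A : cstarAlgType R) (n : nat) (u : 'I_n -> 'I_n -> A).
Hypothesis u_magic : magic u.

Definition cmat (C : seq (seq nat)) (i j : 'I_n) := ent C i j.

Lemma respects_recolour C st : square n C -> respects u (cmat C) ->
  respects u (cmat (recolour C st)).
Proof.
move=> sqC uC i j k l; rewrite /cmat !(@ent_recolour n) ?ltn_ord // => h.
have h2 := respects_dot u_magic (w := nth 0%N st.1) uC; apply: h2; apply: contraNneq h => e.
by apply/eqP; congr index.
Qed.

Lemma quad_total_sum C ts (a b c d : 'I_n) : square n C ->
  quad_total ts (nth [::] C a) (nth [::] C b) (nth [::] C c) (nth [::] C d) c d =
  (\sum_(t <- ts) quad_val (cmat C) t a b c d)%N.
Proof.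
move=> sqC; elim: ts => [|t ts ih]; rewrite ?big_nil // big_cons /= -ih; congr (_ + _)%N.
case: t => [q|q|p q] /=; rewrite ?eqnE //.
by rewrite (@star_count_card n) ?(square_row sqC).
Qed.

Lemma all_iotaP (P : pred nat) : reflect (forall i : 'I_n, P i) (all P (iota 0 n)).
Proof.
apply: (iffP allP) => [h i|h x]; first by apply: h; rewrite mem_iota /=.
by rewrite mem_iota add0n => /= xn; apply: (h (Ordinal xn)).
Qed.

Lemma quad_okP C k D pos neg : square n C -> quad_ok n C k D pos neg ->
  forall a b c d : 'I_n, cmat C b c = k -> cmat C b a = k -> cmat C d a = k -> cmat C d c = k ->
    (\sum_(t <- pos) quad_val (cmat C) t a b c d =
     \sum_(t <- neg) quad_val (cmat C) t a b c d + D * ((a == c) && (b == d)))%N.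
Proof.
move=> sqC ok a b c d bc ba da dc; rewrite -!quad_total_sum //.
move: ok => /all_iotaP /(_ b) /all_iotaP /(_ c); rewrite eqnE => /orP[].
  by rewrite -/(ent C b c) -/(cmat C b c) bc eqxx.
move=> /all_iotaP /(_ a) /orP[].
  by rewrite -/(ent C b a) -/(cmat C b a) ba eqxx.
move=> /all_iotaP /(_ d).
have da' : nth 0%N (nth [::] C d) a = k by [].
have dc' : nth 0%N (nth [::] C d) c = k by [].
by rewrite /= da' dc' eqxx /= => /eqP.
Qed.

Definition class_commutes (C : seq (seq nat)) k := forall r i, cmat C r i = k ->
  forall b c, u r b * u i c = u i c * u r b.

(** In the [Local] case, let [m] have colour [q] to both [r] and [i], and write 1 as the sum of the
    [u m s]. Each [u m s] commutes with the entries of the rows [r] and [i] by the certificate of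
    [q], and annihilates their entries outside the at most three columns of colour [q] from [s], so
    [three_columns] applies. Only [Quad] certificates may serve here, which excludes circular
    arguments. *)
Lemma class_okP C certs kc : square n C -> respects u (cmat C) ->
  (forall k, has (fun kc' => is_quad kc' && eqn kc'.1 k) certs -> class_commutes C k) ->
  class_ok n C certs kc -> class_commutes C kc.1.
Proof.
move=> sqC uC hquad; case: kc => k [D pos neg|q]; rewrite /class_ok /=.
  case/andP=> D0 ok r i ri; apply: (quad_commute u_magic uC D0 (pos := pos) (neg := neg)).
  by rewrite ri; apply: quad_okP.
case/and3P => /hquad hq cnt /all_iotaP loc r i ri b c.
have := loc r => /all_iotaP /(_ i); rewrite eqnE -/(cmat C r i) ri eqxx /=.
case/hasP => m; rewrite mem_iota add0n => /= mn; rewrite ?eqnE.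
set m' := Ordinal mn; rewrite -[ent C m r]/(cmat C m' r) -[ent C m i]/(cmat C m' i).
case/andP => /eqP mr /eqP mi.
rewrite -[LHS]mul1r -[RHS]mul1r -!(magic_sum_row u_magic m') !mulr_suml.
apply: eq_bigr => s _.
apply: (three_columns u_magic (N := [pred x | cmat C s x == q])).
- exact: magic_star.
- exact: hq.
- exact: hq.
- by move=> x /= nx; apply: uC; rewrite mr eq_sym.
- by move=> x /= nx; apply: uC; rewrite mi eq_sym.
have /(allP cnt) : nth [::] C s \in C by apply/mem_nth; rewrite (eqP sqC.1).
apply: leq_trans; rewrite -sum1_count -sum1_card (big_nth 0%N) (square_row sqC) //.
rewrite big_mkord; apply/eq_leq/eq_bigl => x.
by rewrite inE eqnE eq_sym.
Qed.

Lemma commuting_certP M steps certs : respects u (cmat (colour0 n M)) ->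
  commuting_cert n M steps certs -> forall i j k l, u i j * u k l = u k l * u i j.
Proof.
move=> u0; rewrite /commuting_cert.
have [sqC uC] : square n (foldl recolour (colour0 n M) steps)
    /\ respects u (cmat (foldl recolour (colour0 n M) steps)).
  move: (square_colour0 n M) u0; elim: steps (colour0 n M) => //= st steps ih C sC uC.
  by apply: ih; [apply: square_recolour | apply: respects_recolour].
set C := foldl _ _ _ in sqC uC *.
move=> /andP[/(all_nthP (0%N, Local 0)) okC /all_iotaP cov] i j k l.
have [->|ik] := eqVneq i k.
  by have [->//|jl] := eqVneq j l; rewrite !(magic_row u_magic) // eq_sym.
have /all_iotaP /(_ k) := cov i; rewrite eqnE (negPf (ik : _ != _ :> nat)) /=.
case/(has_nthP (0%N, Local 0)) => m mc; rewrite ?eqnE => /eqP e.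
apply: (class_okP (C := C) (certs := certs) _ _ _ (okC m mc)) => //.
move=> k' /(has_nthP (0%N, Local 0))[m' m'c /andP[isq /eqP <-]].
(* A [Quad] certificate does not refer to the other certificates; with the empty list the hypothesis
   on them is vacuous. *)
apply: (class_okP (C := C) (certs := [::])) => //.
by have := okC _ m'c; case: (nth _ _ _) isq => k'' [].
Qed.
End Certificates.

Lemma qaut_magic (R : realType) (G : sgraph) (A : cstarAlgType R) (u : G -> G -> A) :
  qaut_relations u -> magic u.
Proof.
by case=> pu ru cu _; split => // i j; have [] := pu i j; rewrite expr2.
Qed.

Lemma qaut_respects (R : realType) (G : sgraph) (A : cstarAlgType R) (u : G -> G -> A) :
  qaut_relations u -> respects u (fun i j => adj i j : nat).
Proof.
move=> qu; apply: respects_of_sum (qaut_magic qu) _ _ => i j.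
by case: qu => _ _ _ ->.
Qed.

Section Transport.
Variables (R : realType) (A : cstarAlgType R) (V W : finType) (f : V -> W).
Hypothesis f_bij : bijective f.

Lemma magic_bij (u : W -> W -> A) : magic u -> magic (fun i j => u (f i) (f j)).
Proof.
case=> pu ru cu; split=> [i j|i|i]; first exact: pu.
  by rewrite -(ru (f i)) [RHS](reindex f) //; apply: onW_bij.
by rewrite -(cu (f i)) [RHS](reindex f) //; apply: onW_bij.
Qed.

End Transport.

Lemma presented_commutes (G : sgraph) n M steps certs :
  presented G n M -> commuting_cert n M steps certs -> commutes G.
Proof.
move=> [f f_bij fM] cert R A u qu.
pose w (i j : 'I_n) := u (f i) (f j).
have wm : magic w by apply: magic_bij => //; apply: qaut_magic.
have w0 : respects w (cmat (colour0 n M)).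
  move=> i j k l; rewrite /cmat !ent_colour0 //.
  rewrite -!fM; have [ik|ik] := eqVneq (i : nat) k; have [jl|jl] := eqVneq (j : nat) l => //.
  - by move=> _; rewrite (val_inj ik) (magic_row wm) // -val_eqE.
  - by move=> _; rewrite (val_inj jl) (magic_col wm) // -val_eqE.
  have := @qaut_respects _ _ _ _ qu (f i) (f j) (f k) (f l).
  by case: (adj (f i) (f k)); case: (adj (f j) (f l)) => // h _; apply: h.
have comm := commuting_certP wm w0 cert.
have [g gK fK] := f_bij.
by move=> i j k l; rewrite -(fK i) -(fK j) -(fK k) -(fK l); apply: comm.
Qed.

(** With at most three vertices there are at most three columns in all, so [three_columns] applies
    with [e = 1]. *)
Lemma small_commutes (G : sgraph) : (#|G| <= 3)%N -> commutes G.
Proof.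
move=> G3 R A u qu i j k l; have um := qaut_magic qu.
rewrite -[LHS]mul1r -[RHS]mul1r.
by apply: (three_columns um (N := predT)) => //; rewrite ?star1 // => x; rewrite mul1r mulr1.
Qed.

Local Open Scope nat_scope.

(** * Exhaustive search among the graphs with a given symmetry *)

(* Conditionals replace [&&] and [||] in this search: call-by-value evaluation would compute both
   operands. *)
Fixpoint allbits k (P : seq bool -> bool) : bool :=
  if k is k'.+1 then
    if allbits k' (fun l => P (false :: l)) then allbits k' (fun l => P (true :: l)) else false
  else P [::].

(* A family of graphs on [0, ..., n-1] invariant under the permutation [fperm]
   of order [ford]. The edge orbits are given by representatives, grouped in rows
   [(v, reps, chunks)]: the rows up to this one contain all orbits at [v], and the
   pattern of bits on each of the chunks may be assumed maximal among its
   rotations. *)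
Record family := Family {
  fsize : nat;
  ford : nat;
  fperm : seq nat;
  frows : seq (nat * seq (nat * nat) * seq (seq nat))
}.

Definition power (s : seq nat) e i := iter e (nth 0 s) i.

Definition same_orbit F (xy : nat * nat) i j :=
  has (fun e => let x := power (fperm F) e xy.1 in let y := power (fperm F) e xy.2 in
    (eqn x i && eqn y j) || (eqn x j && eqn y i)) (iota 0 (ford F)).

Definition freps F := flatten [seq r.1.2 | r <- frows F].

(** The diagonal receives the index [size (freps F)]. It lies beyond every list of bits, so that
    [nth false] reads it as a non-edge. *)
Definition orbit_table F : seq (seq nat) :=
  [seq [seq if eqn i j then size (freps F) else find (fun xy => same_orbit F xy i j) (freps F)
    | j <- iota 0 (fsize F)] | i <- iota 0 (fsize F)].

Definition matrix_of (tab : seq (seq nat)) (bits : seq bool) : seq (seq bool) :=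
  [seq [seq nth false bits o | o <- r] | r <- tab].

Fixpoint lexle (l m : seq bool) :=
  match l, m with
  | false :: _, true :: _ => true
  | true :: _, false :: _ => false
  | _ :: l', _ :: m' => lexle l' m'
  | _, _ => true
  end.

Definition rot_max (l : seq bool) := all (fun k => lexle (rot k l) l) (iota 0 (size l)).

Definition degree_of (tabrow : seq nat) (bits : seq bool) :=
  count (fun o => nth false bits o) tabrow.

(** The first row sets the valency, at most [dmax], and the later rows have to reproduce it. A
    rejected branch counts as [true]: nothing is left to check in it. *)
Fixpoint search (leaf : seq bool -> bool) dmax d0 (tab : seq (seq nat))
    (rows : seq (nat * seq (nat * nat) * seq (seq nat))) (bits : seq bool) : bool :=
  if rows is (v, reps, chunks) :: rows' then
    allbits (size reps) (fun new =>
      let bits' := bits ++ new in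
      let d := degree_of (nth [::] tab v) bits' in
      if (if d0 is Some d' then eqn d d' else d <= dmax) then
        if all (fun c => rot_max [seq nth false bits' o | o <- c]) chunks
        then search leaf dmax (Some d) tab rows' bits' else true
      else true)
  else leaf bits.

Fixpoint row_dot (r : seq bool) (w : seq nat) : nat :=
  if r is b :: r' then if w is x :: w' then
    if b then x + row_dot r' w' else row_dot r' w' else 0 else 0.

Definition walk_step (M : seq (seq bool)) (w : seq nat) : seq nat :=
  [seq row_dot r w | r <- M].

Definition closed_walks (M : seq (seq bool)) t v :=
  nth 0 (iter t (walk_step M) [seq (eqn j v : nat) | j <- iota 0 (size M)]) v.

(** In a vertex-transitive graph the number of closed walks of length [t] is the same at all
    vertices, so an irregular matrix can be discarded. *)
Definition walk_irregular (M : seq (seq bool)) (vs : seq nat) t :=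
  let c := closed_walks M t 0 in has (fun v => ~~ eqn (closed_walks M t v) c) vs.

Fixpoint meets (r S : seq bool) : bool :=
  if r is b :: r' then if S is c :: S' then
    if b then if c then true else meets r' S' else meets r' S' else false else false.

Definition spread (M : seq (seq bool)) (S : seq bool) : seq bool :=
  [seq (if bx.2 then true else meets bx.1 S) | bx <- zip M S].

(* [S] is a vertex set containing [0] that is closed under adjacency and not full. *)
Definition split_by (M : seq (seq bool)) (S : seq bool) :=
  if all id S then false
  else head false S && all (fun bx => if bx.2 then true else ~~ meets bx.1 S) (zip M S).

(** [split_by] checks whatever set the iteration has reached, so soundness does not depend on [k].
    Components of a disconnected vertex-transitive graph have at most half of the vertices, hence
    the choice of [k] in [leaf_ok]. *)
Definition disconnected_mat (M : seq (seq bool)) k :=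
  split_by M (iter k (spread M) (true :: nseq (size M).-1 false)).

Fixpoint agrees (rx : seq bool) x (r : seq bool) (im : seq nat) : bool :=
  if im is y :: im' then if r is b :: r' then
    if eqn y x then false else
    if eqb (nth false rx y) b then agrees rx x r' im' else false else true else true.

(* Backtracking for an isomorphism from [N] onto [M]; [im] lists the images of
   the vertices already treated. *)
Fixpoint extend (M N : seq (seq bool)) (im : seq nat) : option (seq nat) :=
  if N is r :: N' then
    (fix try (x : nat) (Ml : seq (seq bool)) :=
      if Ml is rx :: Ml' then
        if agrees rx x r im then
          if extend M N' (rcons im x) is Some im' then Some im' else try x.+1 Ml'
        else try x.+1 Ml'
      else None) 0 M
  else Some im.

Definition iso_by (M N : seq (seq bool)) (im : seq nat) :=
  [&& eqn (size im) (size N), uniq im, all (fun x => x < size N) im &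
   all (fun i => let rN := nth [::] N i in let rM := nth [::] M (nth 0 im i) in
     all (fun j => eqb (nth false rM (nth 0 im j)) (nth false rN j)) (iota 0 (size N)))
   (iota 0 (size N))].

(** The outcome of the backtracking is verified by [iso_by], so [extend] needs no specification. *)
Definition iso_search M N :=
  if extend M N [::] is Some im then iso_by M N im else false.

(** An isomorphism invariant of vertex-transitive graphs, compared first to avoid hopeless
    backtracking. *)
Definition walk_key M := [seq closed_walks M t 0 | t <- [:: 2; 3; 4; 5]].

Fixpoint matches (key : seq nat) M (reps : seq (seq nat * seq (seq bool))) : bool :=
  if reps is kN :: reps' then
    if (if all2 eqn kN.1 key then iso_search M kN.2 else false) then true
    else matches key M reps'
  else false.

(** Each test either excludes a connected vertex-transitive graph or matches it with a
    representative. The longer walks come last, as they matter only for a matrix that matches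
    nothing. *)
Definition leaf_ok (reps : seq (seq nat * seq (seq bool))) (vs : seq nat) (M : seq (seq bool)) :=
  if walk_irregular M vs 3 then true else
  if disconnected_mat M (size M)./2 then true else
  if matches (walk_key M) M reps then true else
  if walk_irregular M vs 4 then true else walk_irregular M vs 5.

Definition family_ok (reps : seq (seq (seq bool))) F :=
  let tab := orbit_table F in
  let kreps := [seq (walk_key N, N) | N <- reps] in
  search (fun bits => leaf_ok kreps [seq r.1.1 | r <- frows F] (matrix_of tab bits))
    (fsize F).-1./2 None tab (frows F) [::].

Lemma allbitsP k (P : seq bool -> bool) : allbits k P -> forall l, size l = k -> P l.
Proof.
elim: k P => [|k ih] P /=; first by move=> ? [].
case: ifP => // h0 h1 [//|[] l] [sl].
  exact: (ih (fun l => P (true :: l)) h1).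
exact: (ih (fun l => P (false :: l)) h0).
Qed.

(** Once the row of [v] is treated, every orbit at [v] is decided or is the diagonal, so the valency
    read from the prefix is already final. In the end all [total] bits are assigned. *)
Fixpoint rows_ok (total : nat) (tab : seq (seq nat))
    (rows : seq (nat * seq (nat * nat) * seq (seq nat))) k :=
  if rows is (v, reps, chunks) :: rows' then
    let k' := k + size reps in
    [&& all (fun o => (o < k') || (total <= o)) (nth [::] tab v),
        all (all (fun o => o < k')) chunks & rows_ok total tab rows' k']
  else k == total.

Lemma searchP leaf dmax d d0 tab rows bits rest :
  rows_ok (size (bits ++ rest)) tab rows (size bits) ->
  (forall r, r \in rows -> degree_of (nth [::] tab r.1.1) (bits ++ rest) = d) ->
  (forall r, r \in rows -> forall c, c \in r.2 ->
     rot_max [seq nth false (bits ++ rest) o | o <- c]) ->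
  d <= dmax -> (if d0 is Some d' then d' = d else True) ->
  search leaf dmax d0 tab rows bits -> leaf (bits ++ rest).
Proof.
move=> rok hdeg hch dm.
elim: rows bits rest d0 rok hdeg hch => [|[[v reps] chunks] rows ih] bits rest d0 /=.
  rewrite size_cat -[X in X == _]addn0 eqn_add2l eq_sym size_eq0 => /eqP -> *.
  by rewrite cats0.
case/and3P=> hv hc rok hdeg hch hd0 /allbitsP /(_ (take (size reps) rest)).
have sz : size reps <= size rest.
  suff le rs k : size bits + size reps <= k ->
    rows_ok (size (bits ++ rest)) tab rs k -> size reps <= size rest by exact: le _ _ (leqnn _) rok.
  elim: rs k => [|[[? ?] ?] rs ihr] k hk /=.
    by move/eqP => e; rewrite e size_cat leq_add2l in hk.
  by case/and3P => _ _; apply: ihr; apply: leq_trans hk (leq_addr _ _).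
have st : size (take (size reps) rest) = size reps by rewrite size_takel.
move=> /(_ st).
have e : bits ++ rest = (bits ++ take (size reps) rest) ++ drop (size reps) rest.
  by rewrite -catA cat_take_drop.
have sb : size (bits ++ take (size reps) rest) = size bits + size reps.
  by rewrite size_cat st.
have nthE o : o < size bits + size reps ->
    nth false (bits ++ take (size reps) rest) o = nth false (bits ++ rest) o.
  by move=> ho; rewrite e [RHS]nth_cat sb ho.
have -> : degree_of (nth [::] tab v) (bits ++ take (size reps) rest) = d.
  rewrite -(hdeg _ (mem_head _ _)) /=; apply: eq_in_count => o /(allP hv) /orP[/nthE //|ho].
  rewrite !nth_default // sb; apply: leq_trans ho.
  by rewrite size_cat leq_add2l.
have -> : (if d0 is Some d' then eqn d d' else d <= dmax) = true.
  by case: d0 hd0 => [d' ->|_]; rewrite ?eqnE ?eqxx ?dm.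
have -> : all (fun c => rot_max [seq nth false (bits ++ take (size reps) rest) o | o <- c]) chunks.
  apply/allP => c cin; rewrite (_ : map _ c = [seq nth false (bits ++ rest) o | o <- c]).
    exact: (hch _ (mem_head _ _) c cin).
  by apply/eq_in_map => o oc; apply: nthE; apply: (allP (allP hc c cin)).
rewrite e => hs; apply: (ih _ _ (Some d)) hs => //; rewrite -?e ?sb //.
  by move=> r rin; apply: hdeg; rewrite inE rin orbT.
by move=> r rin; apply: hch; rewrite inE rin orbT.
Qed.

Section Matrix.
Variables (G : sgraph) (n : nat) (g : nat -> G) (M : seq (seq bool)).
Hypotheses (g_inj : {in gtn n &, injective g}) (g_surj : forall x, exists2 i, i < n & g i = x).
Hypotheses (M_size : size M = n) (M_rows : forall i, i < n -> size (nth [::] M i) = n).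
Hypothesis M_adj : forall i j, i < n -> j < n -> adjb M i j = adj (g i) (g j).

Let g_ord (i : 'I_n) := g i.

Lemma g_ord_bij : bijective g_ord.
Proof.
apply: inj_card_bij => [i j e|].
  by apply/val_inj/g_inj; rewrite ?inE ?ltn_ord.
rewrite card_ord -(size_iota 0 n) -(size_map g) cardE.
apply: uniq_leq_size (enum_uniq _) _ => x _.
by have [i ni <-] := g_surj x; apply/map_f; rewrite mem_iota.
Qed.

Lemma sum_g (F : G -> nat) : \sum_x F x = \sum_(i < n) F (g i).
Proof. by rewrite (reindex g_ord) //; apply: onW_bij g_ord_bij. Qed.

Definition walks (G' : sgraph) t (v x : G') : nat :=
  iter t (fun (phi : G' -> nat) y => \sum_(z | adj y z) phi z) (fun y => y == v : nat) x.

Lemma row_dotE (r : seq bool) (w : seq nat) m : size r = m -> size w = m ->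
  row_dot r w = \sum_(k < m | nth false r k) nth 0 w k.
Proof.
rewrite big_mkcond; elim: m r w => [|m ih] [|b r] [|x w] //=; first by rewrite big_ord0.
move=> [sr] [sw]; rewrite big_ord_recl /= (ih r w) //.
by case: b.
Qed.

Lemma closed_walksE t v : v < n -> closed_walks M t v = walks t (g v) (g v).
Proof.
move=> nv; rewrite /closed_walks M_size.
set w0 := map _ _.
suff [sw wE] : size (iter t (walk_step M) w0) = n /\
    forall j, j < n -> nth 0 (iter t (walk_step M) w0) j = walks t (g v) (g j) by apply: wE.
elim: t => [|t [sw ih]].
  split=> [|j nj]; first by rewrite size_map size_iota.
  rewrite (nth_map 0) ?size_iota // nth_iota // add0n eqnE /walks /=; congr (nat_of_bool _).
  by apply/eqP/eqP => [->//|]; apply: g_inj.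
split=> [|j nj]; first by rewrite /= size_map.
rewrite /= (nth_map [::]) ?M_size // (@row_dotE _ _ n) ?M_rows // /walks /=.
rewrite big_mkcond [RHS]big_mkcond sum_g; apply: eq_bigr => i _.
by rewrite -/(adjb M j i) M_adj // ih.
Qed.

Lemma walks_aut (s : {perm G}) t v x : (forall y z, adj (s y) (s z) = adj y z) ->
  walks t (s v) (s x) = walks t v x.
Proof.
move=> sA; rewrite /walks; elim: t x => [|t ih] x /=.
  by rewrite (inj_eq perm_inj).
rewrite (reindex_inj (@perm_inj _ s)) /=.
by apply: eq_big => [z|z _]; rewrite ?sA // ih.
Qed.

Hypothesis G_vt : vertex_transitive G.

Lemma vt_walk_regular t v : v < n -> 0 < n -> closed_walks M t v = closed_walks M t 0.
Proof.
move=> nv n0; rewrite !closed_walksE //.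
by have [s sA <-] := G_vt (g 0) (g v); rewrite walks_aut.
Qed.

Lemma vt_walk_irregular vs t : all (gtn n) vs -> 0 < n -> walk_irregular M vs t = false.
Proof.
move=> /allP vsn n0; apply/negbTE/hasPn => v /vsn /= nv.
by rewrite vt_walk_regular // eqnE eqxx.
Qed.

Lemma meetsE (r S : seq bool) m : size r = m -> size S = m ->
  meets r S = [exists k : 'I_m, nth false r k && nth false S k].
Proof.
move=> sr sS; apply/idP/existsP => [|[k]].
  elim: m r S sr sS => [|m ih] [|b r] [|c S] //= [sr] [sS].
  case: b; case: c => //=; try by move=> /(ih _ _ sr sS)[k kP]; exists (lift ord0 k).
  by move=> _; exists ord0.
elim: m r S sr sS k => [r S _ _ [] //|m ih [|b r] [|c S] //= [sr] [sS] [[|k] kP] /=].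
  by case/andP=> -> ->.
move=> h; have -> : meets r S by apply: (ih r S sr sS (Ordinal (kP : k < m))).
by case: b; case: c.
Qed.

Lemma split_by_disconnected S : size S = n -> split_by M S -> ~ connected G.
Proof.
move=> sS; rewrite /split_by; case: ifP => // /negbT /allPn[b bS nb].
case/andP=> S0 /allP cl conn.
have nS k : k < n -> nth false S k.
  move=> nk; have n0 : 0 < n by apply: leq_ltn_trans nk.
  have : exists2 j, j < n & g j = g k /\ nth false S j.
    have /connectP[p] := conn (g 0) (g k).
    elim/last_ind: p (g k) => [|p x ih] y /=.
      by move=> _ ->; exists 0 => //; rewrite nth0.
    rewrite rcons_path last_rcons => /andP[/ih /(_ erefl)[j nj [gj Sj]] jx] ->.
    have [i' ni' gi'] := g_surj x; exists i' => //; split => //.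
    have /cl /= : (nth [::] M i', nth false S i') \in zip M S.
      by rewrite -nth_zip ?M_size // mem_nth // size_zip M_size sS minnn.
    case: (nth false S i') => //; rewrite (@meetsE _ _ n) ?M_rows //.
    move/existsPn => /(_ (Ordinal nj)) /=.
    by rewrite Sj andbT -/(adjb M i' j) M_adj // gi' gj adj_sym jx.
  by case=> j nj [gj Sj]; move: (g_inj nj nk gj) Sj => ->.
by move: nb; rewrite -(nth_index false bS) nS // -sS index_mem.
Qed.

Lemma disconnected_matP k : disconnected_mat M k -> ~ connected G.
Proof.
apply: split_by_disconnected.
suff : forall S, size S = n -> size (iter k (spread M) S) = n.
  apply; rewrite /= size_nseq M_size; have [i ni _] := g_surj (g 0).
  by rewrite prednK // (leq_ltn_trans _ ni).
by move=> S sS; elim: k => //= k ih; rewrite size_map size_zip M_size ih minnn.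
Qed.

Lemma iso_byP N im : size N = n -> iso_by M N im -> presented G n N.
Proof.
move=> sN; rewrite /iso_by eqnE sN => /and4P[/eqP sim uim /allP imn /allP adjN].
have imlt i : i < n -> nth 0 im i < n by move=> ni; apply: imn; rewrite mem_nth ?sim.
exists (fun i : 'I_n => g (nth 0 im i)).
  apply: inj_card_bij => [i j e|].
    apply/val_inj/eqP; have si (k : 'I_n) : k < size im by rewrite sim.
    rewrite -(nth_uniq 0 (si i) (si j) uim); apply/eqP.
    by apply: g_inj e; rewrite inE /= imlt.
  by have [h _ hK] := g_ord_bij; apply: leq_card (can_inj hK).
move=> i j; rewrite -M_adj ?imlt //.
have /adjN /allP /(_ j) : (i : nat) \in iota 0 n by rewrite mem_iota /=.
by rewrite mem_iota /= ltn_ord => /(_ isT) /eqP.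
Qed.

Lemma matchesP key kreps : all (fun kN => size kN.2 == n) kreps -> matches key M kreps ->
  exists2 N, N \in [seq kN.2 | kN <- kreps] & presented G n N.
Proof.
elim: kreps => //= [[k N] kreps] ih /andP[/= /eqP sN /ih{}ih].
case: ifP => [|_ /ih[N' N'in pN']]; last by exists N' => //; rewrite inE N'in orbT.
case: ifP => // _; rewrite /iso_search; case: extend => // im /(iso_byP sN) pN _.
by exists N => //; rewrite inE eqxx.
Qed.

Lemma leaf_okP reps vs : connected G -> 0 < n -> all (gtn n) vs ->
  all (fun N => size N == n) reps ->
  leaf_ok [seq (walk_key N, N) | N <- reps] vs M -> exists2 N, N \in reps & presented G n N.
Proof.
move=> conn n0 vsn sreps; rewrite /leaf_ok !vt_walk_irregular //.
case: ifP => [/disconnected_matP //|_].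
case: ifP => // mt _; have := matchesP _ mt; rewrite -map_comp map_id_in //.
by apply; apply/allP => kN /mapP[N Nin ->] /=; apply: (allP sreps).
Qed.
End Matrix.

Definition closed_under_perm F :=
  all (fun i => nth 0 (fperm F) i < fsize F) (iota 0 (fsize F)).

(* Decidable side conditions making a family a complete list of representatives
   of its edge orbits. *)
Definition family_wf F :=
  let tab := orbit_table F in let total := size (freps F) in
  [&& 0 < fsize F, closed_under_perm F,
      all (fun xy => (xy.1 < fsize F) && (xy.2 < fsize F)) (freps F),
      all (fun i => all (fun j => eqn i j || (nth 0 (nth [::] tab i) j < total))
        (iota 0 (fsize F))) (iota 0 (fsize F)),
      all (fun r => r.1.1 < fsize F) (frows F) & rows_ok total tab (frows F) 0].

Lemma size_orbit_table F : size (orbit_table F) = fsize F.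
Proof. by rewrite size_map size_iota. Qed.

Lemma size_orbit_row F i : i < fsize F -> size (nth [::] (orbit_table F) i) = fsize F.
Proof. by move=> ni; rewrite (nth_map 0) ?size_iota // size_map size_iota. Qed.

Section FamilySound.
Variables (G : sgraph) (F : family) (g : nat -> G) (s : G -> G).
Let n := fsize F.
Hypotheses (g_inj : {in gtn n &, injective g}) (g_surj : forall x, exists2 i, i < n & g i = x).
Hypothesis s_aut : forall x y, adj (s x) (s y) = adj x y.
Hypothesis g_perm : forall i, i < n -> g (nth 0 (fperm F) i) = s (g i).
Hypothesis F_wf : family_wf F.

Definition edge_bits := [seq adj (g xy.1) (g xy.2) | xy <- freps F].

Hypothesis chunks_max : forall r, r \in frows F -> forall c, c \in r.2 ->
  rot_max [seq nth false edge_bits o | o <- c].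

Lemma power_lt e i : i < n -> power (fperm F) e i < n.
Proof.
case/and5P: F_wf => _ /allP cl _ _ _ ni; elim: e => //= e ih.
by apply: cl; rewrite mem_iota.
Qed.

Lemma adj_power e i j : i < n -> j < n ->
  adj (g (power (fperm F) e i)) (g (power (fperm F) e j)) = adj (g i) (g j).
Proof.
move=> ni nj; elim: e => //= e ih.
by rewrite !g_perm ?power_lt // s_aut.
Qed.

Lemma edge_bitsE i j : i < n -> j < n ->
  adjb (matrix_of (orbit_table F) edge_bits) i j = adj (g i) (g j).
Proof.
move=> ni nj; rewrite /adjb /matrix_of.
have st := size_orbit_table F; have sr := size_orbit_row ni.
rewrite (nth_map [::]) ?st // (nth_map 0) ?sr //.
case/and5P: F_wf => _ _ /allP inr /allP cov _.
have /cov /allP : i \in iota 0 n by rewrite mem_iota.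
move=> /(_ j); rewrite mem_iota => /(_ nj).
rewrite /orbit_table !(nth_map 0, nth_iota) ?size_iota ?size_map ?size_iota // !add0n.
rewrite !eqnE; have [-> _|ij /=] := eqVneq i j.
  by rewrite nth_default ?adj_irr // size_map.
set k := find _ _ => kr; have hk : has (fun xy => same_orbit F xy i j) (freps F) by rewrite has_find.
rewrite (nth_map (0, 0)) //; have := nth_find (0, 0) hk; rewrite -/k.
have := inr _ (mem_nth (0, 0) kr); case: (nth _ _ k) => x y /= /andP[nx ny].
case/hasP => e _ /=; rewrite !eqnE.
by case/orP => /andP[/eqP <- /eqP <-]; rewrite -?(adj_sym (g (power _ _ x))) adj_power // adj_sym.
Qed.

Lemma family_okP reps d : vertex_transitive G -> connected G ->
  (forall x : G, \sum_(y | adj x y) 1 = d) -> d <= n.-1./2 ->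
  all (fun N => size N == n) reps -> family_ok reps F ->
  exists2 N, N \in reps & presented G n N.
Proof.
move=> vt conn reg dn sreps; rewrite /family_ok.
have [n0 _ _ _ /andP[/allP rlt rok]] := and5P F_wf.
set M := matrix_of (orbit_table F) edge_bits.
have sM : size M = n by rewrite !size_map size_iota.
have rM i : i < n -> size (nth [::] M i) = n.
  move=> ni; rewrite (nth_map [::]) ?size_orbit_table // size_map.
  exact: size_orbit_row.
move=> hs; apply: (leaf_okP g_inj g_surj sM rM edge_bitsE vt (vs := [seq r.1.1 | r <- frows F])) => //.
  by apply/allP => v /mapP[r rin ->]; apply: rlt.
apply: (@searchP (fun bits => leaf_ok _ _ (matrix_of (orbit_table F) bits)) n.-1./2 d None
  (orbit_table F) (frows F) [::] edge_bits) => //=.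
- by rewrite size_map.
move=> r rin; have nr := rlt r rin.
rewrite -(reg (g r.1.1)) big_mkcond (sum_g g_inj g_surj) /degree_of.
have st := size_orbit_table F; have sr := size_orbit_row nr.
rewrite -sum1_count (big_nth 0) sr big_mkord big_mkcond; apply: eq_bigr => j _.
rewrite -edge_bitsE // /adjb /matrix_of (nth_map [::]) ?st // (nth_map 0) ?sr //.
Qed.
End FamilySound.

Local Open Scope group_scope.
Local Open Scope nat_scope.

(** * Automorphisms of prime order *)

Section Automorphisms.
Variable G : sgraph.

Definition aut_set : {set {perm G}} :=
  [set s : {perm G} | [forall x, forall y, adj (s x) (s y) == adj x y]].

Lemma autP (s : {perm G}) : reflect (forall x y, adj (s x) (s y) = adj x y) (s \in aut_set).
Proof.
rewrite inE; apply: (iffP forallP) => h x; first by move=> y; have /forallP/(_ y)/eqP := h x.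
by apply/forallP => y; rewrite h.
Qed.

Lemma aut_group_set : group_set aut_set.
Proof.
apply/group_setP; split; first by apply/autP => x y; rewrite !perm1.
by move=> s t /autP hs /autP ht; apply/autP => x y; rewrite !permM ht hs.
Qed.
Canonical aut_group := Group aut_group_set.

Hypothesis G_vt : vertex_transitive G.

Lemma aut_trans : 0 < #|G| -> [transitive aut_group, on [set: G] | 'P].
Proof.
move=> /card_gt0P[x _]; apply/imsetP; exists x; first by rewrite inE.
apply/esym/setP => y; rewrite !inE; apply/orbitP.
have [s /autP sA <-] := G_vt x y.
by exists s.
Qed.

Variable p : nat.

Variable P : {group {perm G}}.
Hypothesis sylP : p.-Sylow(aut_group) P.

Let pP : p.-group P := pHall_pgroup sylP.
Let sPA : P \subset aut_group := pHall_sub sylP.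

(** The automorphism group has order [#|G|] times that of the stabilizer of [x]. Compare the
    [p]-parts with the same factorization for [P]: the order of the stabilizer in [P] divides the
    [p]-part of that of the full stabilizer. *)
Lemma sylow_orbit_dvd x : #|G|`_p %| #|orbit 'P P x|.
Proof.
have G0 : 0 < #|G| by apply/card_gt0P; exists x.
have e1 : #|aut_group| = (#|G| * #|'C_aut_group[x | 'P]|)%N.
  rewrite -(card_orbit_stab 'P aut_group x) -cardsT.
  by rewrite (atransP (aut_trans G0)).
have e2 := card_orbit_stab 'P P x.
have h1 : #|'C_P[x | 'P]| %| #|'C_aut_group[x | 'P]|`_p.
  have s1 : 'C_P[x | 'P] \subset 'C_aut_group[x | 'P] by rewrite setSI.
  have /part_pnat_id <- : p.-nat #|'C_P[x | 'P]| by apply: pgroupS pP; apply: subsetIl.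
  by apply: partn_dvd; rewrite ?cardG_gt0 ?cardSg.
have := card_Hall sylP; rewrite e1 partnM ?cardG_gt0 // -e2 => e3.
move: h1 => /dvdnP[k hk]; move: e3; rewrite hk mulnA => /eqP.
by rewrite eqn_pmul2r ?cardG_gt0 // => /eqP ->; apply: dvdn_mulr.
Qed.
End Automorphisms.

Section OrderP.
Variables (G : sgraph) (p : nat).
Hypotheses (G_vt : vertex_transitive G) (p_pr : prime p).

Definition fixed (s : {perm G}) := [set x | s x == x].

(* The Sylow subgroup is transitive, so a central element of order [p] has no fixed point. *)
Lemma vt_semiregular a : 0 < a -> #|G| = p ^ a ->
  exists s : {perm G}, [/\ forall x y, adj (s x) (s y) = adj x y, #[s] = p & fixed s = set0].
Proof.
move=> a0 cG; have p1 := prime_gt1 p_pr.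
have G0 : 0 < #|G| by rewrite cG expn_gt0 prime_gt0.
have [P sylP] := Sylow_exists p (aut_group G).
have pP := pHall_pgroup sylP.
have orbT x : orbit 'P P x = [set: G].
  apply/eqP; rewrite eqEcard subsetT cardsT.
  apply: dvdn_leq; first by apply/card_gt0P; exists x; apply: orbit_refl.
  by have := sylow_orbit_dvd G_vt sylP x; rewrite cG part_pnat_id ?pnatX ?pnat_id ?orbT.
have Pn1 : P :!=: 1%g.
  apply/negP => /eqP P1; have [x _] := card_gt0P G0.
  have := dvdn_orbit 'P P x; rewrite orbT cardsT cG P1 cards1 dvdn1 => /eqP e.
  by have := ltn_expl a p1; rewrite e ltnS leqn0 => /eqP a00; rewrite a00 in a0.
have Zn1 : 'Z(P) != 1%g by rewrite center_nil_eq1 ?(pgroup_nil pP).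
have pZ : p.-group 'Z(P) by apply: pgroupS (center_sub P) pP.
have [_ pdvd _] := pgroup_pdiv pZ Zn1.
have [s sZ os] := Cauchy p_pr pdvd.
have [sP sC] := setIP sZ.
exists s; split => //.
  by apply/autP; apply: subsetP (pHall_sub sylP) _ sP.
apply/eqP; rewrite -subset0; apply/subsetP => x; rewrite inE => /eqP sx.
have s1 : s = 1%g.
  apply/permP => y; rewrite perm1.
  have /orbitP[t tP <-] : y \in orbit 'P P x by rewrite orbT inE.
  rewrite /= /aperm; have /centP/(_ t tP) := sC; rewrite /commute => e.
  by rewrite -permM -e permM sx.
by rewrite s1 order1 in os; rewrite -os in p1.
Qed.

(* By the orbit counting formula some element of the Sylow subgroup has fewer fixed points than
   there are orbits; if its order is not [p], it has a cycle of length at least [p ^ 2], which its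
   power of order [p] moves entirely. *)
Lemma vt_few_fixed : p %| #|G| -> 0 < #|G| ->
  exists s : {perm G}, [/\ forall x y, adj (s x) (s y) = adj x y, #[s] = p
    & #|fixed s| <= maxn (#|G| %/ #|G|`_p).-1 (#|G| - p ^ 2)].
Proof.
move=> pG G0; have p1 := prime_gt1 p_pr.
have [P sylP] := Sylow_exists p (aut_group G).
have pP := pHall_pgroup sylP.
set t := #|orbit 'P P @: [set: G]|.
have Gp1 : 1 < #|G|`_p by rewrite p_part_gt1 mem_primes p_pr G0.
have aP : [acts P, on [set: G] | 'P] by apply/actsP => ? _ ?; rewrite !inE.
(* Each of the [t] orbits has at least as many points as the [p]-part of [#|G|]. *)
have tle : t * #|G|`_p <= #|G|.
  rewrite -[leqRHS]cardsT (card_partition (orbit_partition aP)) -sum_nat_const.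
  apply: leq_sum => X /imsetP[x _ ->].
  apply: dvdn_leq; first by apply/card_gt0P; exists x; apply: orbit_refl.
  exact: (sylow_orbit_dvd G_vt sylP x).
have [a inP /andP[an1 fa]] : exists2 a, a \in P & (a != 1%g) && (#|fixed a| < t).
  apply/exists_inP/contraT; rewrite negb_exists_in => /forall_inP h.
  have fixE (b : {perm G}) : #|'Fix_([set: G] | 'P)[b]| = #|fixed b|.
    by apply: eq_card => x; rewrite in_setI in_setT /= [RHS]inE; apply/afix1P/eqP.
  have := Frobenius_Cauchy aP; rewrite -/t (bigD1 1%g) ?group1 //=.
  have -> : #|'Fix_([set: G] | 'P)[1%g]| = #|G|.
    by rewrite fixE -cardsT; apply: eq_card => x; rewrite !inE perm1 eqxx.
  have : \sum_(i in P | i != 1%g) t <= \sum_(b in P | b != 1%g) #|'Fix_([set: G] | 'P)[b]|.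
    apply: leq_sum => i /andP[iP i1]; have := h i iP; rewrite i1 /= -leqNgt fixE //.
  have -> : \sum_(i in P | i != 1%g) t = (#|P| - 1) * t.
    rewrite sum_nat_const; congr (_ * _).
    rewrite (cardsD1 1%g P) group1 addKn; apply: eq_card => i; by rewrite !inE andbC.
  have tG : t < #|G| by nia.
  rewrite mulnBl mul1n leq_subLR => hS e.
  by move: hS; rewrite mulnC -e leq_add2r leqNgt tG.
have [k ok] : exists k, #[a] = p ^ k.
  by have /p_natP[k ->] := mem_p_elt pP inP; exists k.
have [|k1] := posnP k; first by move=> k0; move: ok; rewrite k0 expn0 => /eqP; rewrite order_eq1 (negPf an1).
set h := (a ^+ (p ^ k.-1))%g.
have oh : #[h] = p.
  rewrite orderXdiv ok ?dvdn_exp2l ?leq_pred // -expnB ?leq_pred ?prime_gt0 //.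
  by rewrite -[in k - _](prednK k1) subSnn expn1.
have aA : a \in aut_group G by apply: subsetP (pHall_sub sylP) _ inP.
exists h; split => //.
  by apply/autP; apply: groupX aA.
rewrite leq_max; have [k1'|k2] := leqP k 1.
  have -> : h = a by rewrite /h (_ : k.-1 = 0) ?expn0 ?expg1 //; lia.
  rewrite -ltnS prednK; first by apply/orP; left; apply: leq_trans fa _; rewrite leq_divRL // ltnW.
  by rewrite divn_gt0 ?(ltnW Gp1) // dvdn_leq // dvdn_part.
apply/orP; right.
have [x hx] : exists x, h x != x.
  apply/existsP; apply: contraT; rewrite negb_exists => /forallP all1.
  have h1 : h = 1%g by apply/permP => y; rewrite perm1; have := all1 y; rewrite negbK => /eqP.
  by move: oh p1; rewrite h1 order1 => <-.
have hE m y : (a ^+ m)%g y = iter m a y by rewrite permX.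
have cx : #|porbit a x| = p ^ k.
  have : #|porbit a x| %| p ^ k by rewrite -ok porbitE dvdn_orbit.
  case/(dvdn_pfactor _ _ p_pr) => e ek ce; rewrite ce; congr (p ^ _).
  (* If the cycle of [x] had length [p ^ e] with [e < k], then [p ^ e] would divide [p ^ k.-1] and
     [h] would fix [x]. *)
  apply/eqP; rewrite eqn_leq ek leqNgt; apply: contra hx => elt.
  have /dvdnP[c hc] : p ^ e %| p ^ k.-1 by rewrite dvdn_exp2l // -ltnS prednK.
  apply/eqP; rewrite /h hc mulnC expgM permX iter_fix // hE -ce; exact: iter_porbit.
have sub : porbit a x \subset ~: fixed h.
  apply/subsetP => y /porbitP[i ->]; rewrite !inE; apply: contra hx => /eqP e.
  apply/eqP/(@perm_inj _ (a ^+ i)%g); rewrite -[in RHS]e -!permM.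
  by congr (fun_of_perm _ x); rewrite /h -!expgD addnC.
have := subset_leq_card sub; rewrite cx cardsCs setCK => ple.
have p2 : p ^ 2 <= p ^ k by rewrite leq_exp2l.
by rewrite -[leqLHS](subKn (max_card (mem (fixed h)))) leq_sub2l // (leq_trans p2 ple).
Qed.
End OrderP.

Section Blocks.
Variables (V : finType) (s : {perm V}) (p : nat).
Hypotheses (p_pr : prime p) (os : #[s] = p).

Lemma iter_order x : iter p s x = x.
Proof. by rewrite -permX -os expg_order perm1. Qed.

Lemma card_porbit_moved x : s x != x -> #|porbit s x| = p.
Proof.
move=> sx; have : #|porbit s x| %| p by rewrite -os porbitE dvdn_orbit.
case/primeP: p_pr => _ h /h /orP[] /eqP // c1.
by have := iter_porbit s x; rewrite c1 /= => e; rewrite e eqxx in sx.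
Qed.

Lemma traject_porbit x : s x != x -> porbit s x =i traject s x p.
Proof. by move=> sx y; rewrite porbit_traject card_porbit_moved. Qed.

Lemma traject_uniq x : s x != x -> uniq (traject s x p).
Proof. by move=> sx; rewrite -(card_porbit_moved sx) uniq_traject_porbit. Qed.

Lemma mem_porbit_perm x y : (s y \in porbit s x) = (y \in porbit s x).
Proof.
have e : porbit s (s y) = porbit s y by rewrite -[RHS](porbit_perm s 1) expg1.
by rewrite porbit_sym e porbit_sym.
Qed.

Lemma traject_rot x k : k <= p -> traject s (iter k s x) p = rot k (traject s x p).
Proof.
move=> kp; rewrite -{2}(subnKC kp) trajectD -{2}(size_traject s x k) rot_size_cat.
rewrite -{1}(subnK kp) trajectD -iterD subnK ?iter_order //.
Qed.

(** [S] is exhausted by removing one cycle of [s] at a time. [Q] selects the point at which the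
    listing of a cycle starts; it will express that a pattern of adjacencies is maximal among its
    rotations. *)
Lemma blocks_exist (Q : pred V) (S : {set V}) :
  (forall x, x \in S -> s x \in S /\ s x != x) ->
  (forall x, x \in S -> exists2 y, y \in porbit s x & Q y) ->
  exists2 r : seq V, all Q r & uniq (flatten [seq traject s x p | x <- r]) /\
    flatten [seq traject s x p | x <- r] =i S.
Proof.
move: {2}#|S| (leqnn #|S|) => m; elim: m S => [|m ih] S.
  rewrite leqn0 cards_eq0 => /eqP -> _ _; exists [::] => //; split => // x.
  by rewrite inE.
move=> Sm hS hQ; have [->|[x0 x0S]] := set_0Vmem S.
  by exists [::] => //; split => // x; rewrite inE.
have orbS y z : z \in porbit s y -> y \in S -> z \in S.
  move=> /porbitP[i ->]; rewrite permX => yS; elim: i => //= i; by case/hS.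
have [x xo Qx] := hQ _ x0S; have xS := orbS _ _ xo x0S.
have sx : s x != x by case: (hS x xS).
pose S' := S :\: porbit s x.
have S'm : #|S'| <= m.
  rewrite -ltnS (leq_trans _ Sm) //; apply: proper_card; apply/properP; split.
    exact: subsetDl.
  by exists x => //; rewrite !inE porbit_id.
have [y||r Qr [ur er]] := ih S' S'm.
- rewrite !inE => /andP[yo yS]; have [syS sy] := hS y yS; split => //.
  by rewrite syS andbT mem_porbit_perm.
- by move=> y; rewrite inE => /andP[_ /hQ].
exists (x :: r); first by rewrite /= Qx.
split => /=.
  rewrite cat_uniq traject_uniq //= ur andbT; apply/hasPn => y.
  by rewrite er inE -traject_porbit // => /andP[].
move=> y; rewrite mem_cat er -traject_porbit // inE.
by case: (boolP (y \in porbit s x)) => //= yo; rewrite (orbS _ _ yo xS).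
Qed.

Lemma nth_blocks x0 (r : seq V) t b k : b < size r -> k < p ->
  nth x0 (flatten [seq traject s x p | x <- r] ++ t) (b * p + k) = iter k s (nth x0 r b).
Proof.
elim: r b => //= x r ih [|b] bs kp.
  by rewrite mul0n add0n -catA nth_cat size_traject kp (set_nth_default x) ?size_traject // nth_traject.
rewrite -catA nth_cat size_traject mulSn -addnA ltnNge leq_addr /=.
by rewrite addKn ih.
Qed.

Lemma size_blocks (r : seq V) : size (flatten [seq traject s x p | x <- r]) = size r * p.
Proof. by elim: r => //= x r ih; rewrite size_cat size_traject ih mulSn. Qed.
End Blocks.

(** Consecutive labels form [m] cycles of length [p]; the last [f] labels are fixed. *)
Definition block_perm m p f :=
  [seq if i < m * p then (i %/ p) * p + (i %% p).+1 %% p else i | i <- iota 0 (m * p + f)].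

(* Every chunk of [F] lists the pairs of the vertex [0] with a later block. *)
Definition block_family F m p f :=
  [&& fsize F == m * p + f, fperm F == block_perm m p f &
    all (fun r => all (fun c => has (fun b =>
       [seq nth (0, 0) (freps F) o | o <- c] == [seq (0, b * p + k) | k <- iota 0 p])
      (iota 1 m.-1) && all (gtn (size (freps F))) c) r.2) (frows F)].

(** Every word of length [p] has a maximal rotation; for the small [p] at hand this is checked by
    enumeration. *)
Definition rotations_ok p := allbits p (fun l => has (fun k => rot_max (rot k l)) (iota 0 p)).

(** The vertices are numbered cycle by cycle, the fixed points last. The starting points of the
    cycles are free: the first cycle starts at any moved vertex [x0], and each later one where its
    pattern of adjacencies to [x0] is maximal among the rotations. This is what the chunks
    require. *)
Lemma block_family_okP (G : sgraph) (s : {perm G}) F m p f reps d :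
  (forall x y, adj (s x) (s y) = adj x y) -> prime p -> #[s] = p -> #|fixed s| = f ->
  #|G| = m * p + f -> 0 < m -> family_wf F -> block_family F m p f -> rotations_ok p ->
  vertex_transitive G -> connected G -> (forall x : G, \sum_(y | adj x y) 1 = d) ->
  d <= #|G|.-1./2 -> all (fun N => size N == #|G|) reps -> family_ok reps F ->
  exists2 N, N \in reps & presented G #|G| N.
Proof.
move=> sA p_pr os fs cG m0 wf /and3P[/eqP sF /eqP pF /allP cF] /allbitsP rots vt conn reg dG sreps fam.
have p0 := prime_gt0 p_pr.
have [x0 sx0] : exists x0, s x0 != x0.
  have : #|~: fixed s| > 0 by rewrite cardsCs setCK fs cG addnK muln_gt0 m0.
  by case/card_gt0P => x0; rewrite !inE; exists x0.
pose Q y := rot_max [seq adj x0 z | z <- traject s y p].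
pose S := ~: fixed s :\: porbit s x0.
have hS x : x \in S -> s x \in S /\ s x != x.
  rewrite !inE => /andP[xo sx]; rewrite (inj_eq perm_inj) sx andbT; split => //.
  by rewrite mem_porbit_perm.
have hQ x : x \in S -> exists2 y, y \in porbit s x & Q y.
  move=> /hS[_ sx].
  have /rots/hasP[k] : size [seq adj x0 z | z <- traject s x p] = p.
    by rewrite size_map size_traject.
  rewrite mem_iota add0n => /andP[_ kp]; rewrite -map_rot -(traject_rot os) ?(ltnW kp) // => Qk.
  by exists (iter k s x) => //; rewrite -permX mem_porbit.
have [r Qr [ur er]] := blocks_exist p_pr os hS hQ.
pose bl := x0 :: r; pose vs := flatten [seq traject s x p | x <- bl] ++ enum (fixed s).
have fnth : enum (fixed s) =i fixed s by move=> x; rewrite mem_enum.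
have uvs : uniq vs.
  rewrite cat_uniq enum_uniq andbT /= cat_uniq (traject_uniq p_pr os sx0) ur andbT /=.
  apply/andP; split; apply/hasPn => y.
    by rewrite er inE -(traject_porbit p_pr os sx0) => /andP[].
  rewrite fnth mem_cat negb_or er -(traject_porbit p_pr os sx0) !inE => sy.
  rewrite sy andbF andbT; apply: contraL sy => /porbitP[i ->].
  rewrite -permM -expgSr expgS permM (inj_eq perm_inj).
  by [].
have mvs y : y \in vs.
  rewrite !mem_cat fnth er -(traject_porbit p_pr os sx0) !inE.
  by case: (y \in porbit s x0) => //=; case: (s y == y).
have svs : size vs = #|G|.
  rewrite cardT; apply/perm_size/uniq_perm => //; first exact: enum_uniq.
  by move=> y; rewrite mvs mem_enum.
have sbl : size bl = m.
  have := svs; rewrite size_cat size_blocks -cardE fs cG => /eqP.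
  by rewrite eqn_add2r eqn_pmul2r // => /eqP.
pose g i := nth x0 vs i.
have nF : fsize F = #|G| by rewrite sF cG.
have gE b k : b < m -> k < p -> g (b * p + k) = iter k s (nth x0 bl b).
  by move=> bm kp; rewrite /g nth_blocks ?sbl.
rewrite -nF; apply: (@family_okP G F g s _ _ sA _ wf _ reps d) => //; rewrite ?nF //.
- move=> i j; rewrite !inE -svs => il jl e.
  by apply/eqP; rewrite -(nth_uniq x0 il jl uvs); apply/eqP.
- by move=> x; exists (index x vs); [rewrite -svs index_mem | apply: nth_index].
- move=> i; rewrite cG pF => il; rewrite (nth_map 0) ?size_iota // nth_iota // add0n.
  case: ifP => im; last first.
    have : g i \in fixed s.
      rewrite -fnth /g nth_cat size_blocks sbl im mem_nth // -cardE fs.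
      by rewrite ltn_subLR // leqNgt im.
    by rewrite inE => /eqP.
  have bm : i %/ p < m by rewrite ltn_divLR.
  rewrite [in RHS](divn_eq i p) !gE ?ltn_mod // -iterS.
  have := ltn_pmod i p0; rewrite leq_eqVlt => /orP[/eqP e|lt]; last by rewrite modn_small.
  by rewrite e modnn (iter_order os).
move=> r' r'in c cin.
have /allP/(_ c cin)/andP[/hasP[b] ] := cF _ r'in.
rewrite mem_iota add1n prednK // => /andP[b1 bm] /eqP ec /allP clt.
have -> : [seq nth false (edge_bits F g) o | o <- c] = [seq adj x0 z | z <- traject s (nth x0 bl b) p].
  transitivity [seq adj (g xy.1) (g xy.2) | xy <- [seq nth (0, 0) (freps F) o | o <- c]].
    by rewrite -map_comp; apply/eq_in_map => o oc /=; rewrite (nth_map (0, 0)) //; apply: clt.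
  rewrite ec -map_comp -[traject _ _ _](mkseq_nth x0) size_traject /mkseq -map_comp.
  apply/eq_in_map => k; rewrite mem_iota add0n => /= kp.
  have -> : nth x0 (traject s (nth x0 bl b) p) k = iter k s (nth x0 bl b).
    by rewrite (set_nth_default (nth x0 bl b)) ?size_traject // nth_traject.
  rewrite gE //.
  by have := @gE 0 0 m0 p0; rewrite mul0n => ->.
apply: (allP Qr); case: b b1 bm {ec} => // b _ bm; rewrite /= mem_nth //.
by rewrite -ltnS -[(size r).+1]/(size bl) sbl.
Qed.

(** * Isomorphisms, complements and components *)

Definition disjoint_automorphisms (G : sgraph) : Prop :=
  exists s t : {perm G},
    [/\ forall x y, adj (s x) (s y) = adj x y, forall x y, adj (t x) (t y) = adj x y,
        s != 1%g, t != 1%g & forall x, s x = x \/ t x = x].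

Section Isomorphisms.
Implicit Types G H K : sgraph.

Lemma bij_of_surj (T U : Type) (f : T -> U) : injective f -> (forall y, exists x, f x = y) ->
  bijective f.
Proof. by move=> fI /choice[g gK]; exists g => // x; apply: fI; rewrite gK. Qed.

Lemma iso_sym G H : isomorphic G H -> isomorphic H G.
Proof. by case=> f [g fK gK] fA; exists g; [exists f | move=> x y; rewrite -fA !gK]. Qed.

Lemma iso_trans G H K : isomorphic G H -> isomorphic H K -> isomorphic G K.
Proof.
case=> f fB fA [g gB gA]; exists (g \o f); first exact: bij_comp.
by move=> x y /=; rewrite gA fA.
Qed.

Lemma adj_compl G (x y : G) : @adj (compl_graph G) x y = (x != y) && ~~ adj x y.
Proof. by rewrite /= /simple_rel (adj_sym y) orbb. Qed.

Lemma compl_iso G H : isomorphic G H -> isomorphic (compl_graph G) (compl_graph H).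
Proof.
case=> f fB fA; exists f => // x y.
by rewrite !adj_compl fA (inj_eq (bij_inj fB)).
Qed.

Lemma iso_complK G : isomorphic G (compl_graph (compl_graph G)).
Proof.
exists id => [|x y]; first by exists id.
by rewrite !adj_compl negb_and !negbK; case: eqVneq => [->|] //=; rewrite adj_irr.
Qed.

Lemma compl_aut G (s : {perm G}) :
  (forall x y, @adj (compl_graph G) (s x) (s y) = @adj (compl_graph G) x y) <->
  (forall x y, adj (s x) (s y) = adj x y).
Proof.
split=> h x y; last by rewrite !adj_compl h (inj_eq perm_inj).
have := h x y; rewrite !adj_compl (inj_eq perm_inj).
by case: eqVneq => [-> _|_ /= /negb_inj //]; rewrite !adj_irr.
Qed.

Lemma compl_vt G : vertex_transitive G -> vertex_transitive (compl_graph G).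
Proof. by move=> vt x y; have [s /compl_aut sA <-] := vt x y; exists s. Qed.

Lemma listed_iso G H : isomorphic G H -> listed H -> listed G.
Proof.
move=> GH; case=> [[n n4 h]|[m [K [m2 Kc Kv K2 h]]]|[h|h|h]|[k kd h]].
- by apply: Or41; exists n => //; apply: iso_trans h.
- by apply: Or42; exists m, K; split=> //; apply: iso_trans h.
- by apply/Or43/Or31/(iso_trans GH).
- by apply/Or43/Or32/(iso_trans GH).
- by apply/Or43/Or33/(iso_trans GH).
- by apply: Or44; exists k => //; rewrite (set_nth_default H) //; apply: iso_trans h.
Qed.

Lemma disjoint_automorphisms_iso G H :
  isomorphic G H -> disjoint_automorphisms H -> disjoint_automorphisms G.
Proof.
case=> f [g fK gK] fA [s [t [sA tA s1 t1 st]]].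
have gfI (r : {perm H}) : injective (fun x => g (r (f x))).
  by move=> x y /(can_inj gK)/perm_inj/(can_inj fK).
have aut (r : {perm H}) : (forall x y, adj (r x) (r y) = adj x y) ->
    forall x y, adj (perm (gfI r) x) (perm (gfI r) y) = adj x y.
  by move=> rA x y; rewrite !permE -fA !gK rA fA.
have nt (r : {perm H}) : r != 1%g -> perm (gfI r) != 1%g.
  apply: contraNneq => r1; apply/eqP/permP => y; have := congr1 (fun u : {perm G} => f (u (g y))) r1.
  by rewrite permE !perm1 !gK.
exists (perm (gfI s)), (perm (gfI t)); split; [exact: aut|exact: aut|exact: nt|exact: nt|].
by move=> x; rewrite !permE; case: (st (f x)) => ->; [left|right].
Qed.

Lemma disjoint_automorphisms_compl G :
  disjoint_automorphisms (compl_graph G) -> disjoint_automorphisms G.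
Proof. by case=> s [t [/(@compl_aut G) sA /(@compl_aut G) tA s1 t1 st]]; exists s, t. Qed.

Local Open Scope ring_scope.

(** The adjacency matrix of the complement is the all-ones matrix minus the identity minus that of
    [G]. The row and column sums make [u] commute with the all-ones matrix, so the same [u]
    satisfies the relations of both graphs. *)
Lemma commutes_compl G : commutes (compl_graph G) -> commutes G.
Proof.
move=> comm R A u [u1 u2 u3 u4]; apply: comm; split=> // i j.
have e (x y : G) : (@adj (compl_graph G) x y)%:R = 1 - (x == y)%:R - (adj x y)%:R :> A.
  rewrite adj_compl; case: eqVneq => [->|_] /=; first by rewrite adj_irr subrr subr0.
  by case: adj; rewrite subr0 ?subrr ?subr0.
under eq_bigr do rewrite e !mulrBl mul1r.
under [RHS]eq_bigr do rewrite e !mulrBr mulr1.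
rewrite !sumrB u2 u3 u4; congr (_ - _ - _).
rewrite (bigD1 i) //= eqxx mul1r big1 ?addr0; last first.
  by move=> k; rewrite eq_sym => /negbTE ->; rewrite mul0r.
rewrite (bigD1 j) //= eqxx mulr1 big1 ?addr0 // => k /negbTE ->.
by rewrite mulr0.
Qed.
End Isomorphisms.

(** * Components and valencies of vertex-transitive graphs *)

Section Components.
Variable G : sgraph.
Hypothesis G_vt : vertex_transitive G.

Lemma connect_aut (s : {perm G}) x y : (forall x y, adj (s x) (s y) = adj x y) ->
  connect (@adj G) x y -> connect (@adj G) (s x) (s y).
Proof.
move=> sA /connectP[p]; elim: p x => [x _ ->|z p IH x /= /andP[xz zp] yE]; first exact: connect0.
by apply: connect_trans (IH _ zp yE); apply: connect1; rewrite sA.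
Qed.

Let symG : connect_sym (@adj G) := sym_connect_sym (@adj_sym G).

Section Component.
Variable x0 : G.

Definition component_type := {x : G | connect (@adj G) x0 x}.

Definition component : sgraph := @SGraph component_type
  (fun x y => adj (val x) (val y)) (fun x y => adj_sym (val x) (val y)) (fun x => adj_irr (val x)).

Lemma component_connected : connected component.
Proof.
move=> [x x0x] [y x0y]; have : connect (@adj G) x y.
  by apply: connect_trans x0y; rewrite symG.
case/connectP => p; elim: p x x0x => [x x0x _ /= yE|z p IH x x0x /= /andP[xz zp] yE].
  have -> : exist _ y x0y = exist _ x x0x :> component_type by apply: val_inj.
  exact: connect0.
have x0z : connect (@adj G) x0 z by apply: connect_trans x0x (connect1 xz).
by apply: connect_trans (IH z x0z zp yE); apply: connect1.
Qed.

Lemma component_vt : vertex_transitive component.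
Proof.
move=> h k; have [s sA sh] := G_vt (val h) (val k).
have sC (z : component) : connect (@adj G) x0 (s (val z)).
  apply: connect_trans (valP k) _; rewrite -sh; apply: connect_aut => //.
  by apply: connect_trans (valP z); rewrite symG; apply: (valP h).
pose f (z : component) : component := Sub (s (val z)) (sC z).
have fI : injective f by move=> x y [] /perm_inj/val_inj.
by exists (perm fI) => [x y|]; [rewrite !permE /= sA | apply: val_inj; rewrite permE /= sh].
Qed.
End Component.

(** For each root [y] of a component choose an automorphism [a y] that carries [x0] to [y]. These
    automorphisms map the component of [x0] onto all the others; an edge guarantees that it has two
    vertices. *)
Lemma listed_disconnected : ~ connected G -> (exists x y : G, adj x y) -> listed G.
Proof.
move=> nconn [x0 [x1 x01]]; apply: Or42.
pose r := [pred x : G | roots (@adj G) x].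
have /choice[a /all_and2[aA ax]] y : exists s : {perm G},
    (forall x z, adj (s x) (s z) = adj x z) /\ s x0 = y.
  by have [s sA sx] := G_vt x0 y; exists s.
pose g (ih : disjoint_copies #|r| (component x0)) : G := a (enum_val ih.1) (val ih.2).
have ga ih : connect (@adj G) (enum_val ih.1) (g ih).
  by rewrite -{1}(ax (enum_val ih.1)); apply: connect_aut (valP ih.2); apply: aA.
have groot ih : fingraph.root (@adj G) (g ih) = enum_val ih.1.
  rewrite -(fingraph.rootP symG (ga ih)); apply/eqP; exact: (enum_valP ih.1).
exists #|r|, (component x0); split.
- apply/card_gt1P; apply: contrapT => h; apply: nconn => x y.
  have rr z : fingraph.root (@adj G) z \in r by apply: roots_root.
  apply: contrapT => nxy; apply: h; exists (fingraph.root (@adj G) x), (fingraph.root (@adj G) y).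
  split=> //; apply/eqP => /(fingraph.rootP symG); apply: nxy.
- exact: component_connected.
- exact: component_vt.
- apply/card_gt1P; exists (Sub x0 (connect0 _ x0)), (Sub x1 (connect1 x01)); split=> //.
  by rewrite -val_eqE /=; apply: contraTneq x01 => ->; rewrite adj_irr.
apply: iso_sym; exists g; last first.
  move=> ih jk; rewrite [RHS]/= /copies_rel; have [e|ne] /= := eqVneq ih.1 jk.1.
    by rewrite /g e aA.
  apply: contraNF ne => adj_g; apply/eqP/enum_val_inj; rewrite -!groot.
  by apply/(fingraph.rootP symG)/connect1.
apply: bij_of_surj => [ih jk e|y].
  have e1 : ih.1 = jk.1 by apply: enum_val_inj; rewrite -!groot e.
  move: e; rewrite /g e1 => /perm_inj/val_inj e2.
  by rewrite (surjective_pairing ih) (surjective_pairing jk) e1 e2.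
have ry : fingraph.root (@adj G) y \in r by apply: roots_root.
have cy : connect (@adj G) x0 ((a (fingraph.root (@adj G) y))^-1%g y).
  have := connect_root (@adj G) y; rewrite symG; set z := fingraph.root _ y => zy.
  have <- : (a z)^-1%g z = x0 by apply: (@perm_inj _ (a z)); rewrite permKV ax.
  by apply: connect_aut => // u v; rewrite -(aA z) !permKV.
exists (enum_rank_in ry (fingraph.root (@adj G) y), Sub _ cy).
by rewrite /g /= enum_rankK_in // permKV.
Qed.

Lemma compl_edgeless : ~ (exists x y : G, adj x y) ->
  isomorphic (compl_graph G) (complete_graph #|G|).
Proof.
move=> h; exists enum_rank; first exact: enum_rank_bij.
move=> x y; have -> : @adj (complete_graph #|G|) (enum_rank x) (enum_rank y) = (x != y).
  by rewrite /= /simple_rel (inj_eq enum_rank_inj) andbT.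
rewrite adj_compl; have -> : @adj G x y = false by apply/negbTE/negP => xy; case: h; exists x, y.
by rewrite andbT.
Qed.

Lemma vt_degree : exists d, forall x : G, \sum_(y | adj x y) 1 = d.
Proof.
have [[x0 _]|h] := pselect (exists x : G, true); last first.
  by exists 0 => x; case: h; exists x.
exists (\sum_(y | adj x0 y) 1) => x; have [s sA <-] := G_vt x0 x.
by rewrite (reindex_inj (@perm_inj _ s)); apply: eq_bigl => y; rewrite sA.
Qed.

Lemma compl_degree (x : G) :
  \sum_(y | @adj (compl_graph G) x y) 1 = #|G|.-1 - \sum_(y | adj x y) 1.
Proof.
under eq_bigl do rewrite adj_compl eq_sym.
have -> : #|G|.-1 = \sum_(y | y != x) 1 by rewrite -sum1_card (bigD1 x).
have -> : \sum_(y | adj x y) 1 = \sum_(y | (y != x) && adj x y) 1.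
  by apply: eq_bigl => y; case: eqVneq => [->|] //=; rewrite adj_irr.
by rewrite [X in _ = X - _](bigID (adj x)) /= addKn.
Qed.
End Components.

(** * The graphs of the classification *)

Definition tabulate n (r : nat -> nat -> bool) : seq (seq bool) :=
  [seq [seq r i j | j <- iota 0 n] | i <- iota 0 n].

Lemma adjb_tabulate n r i j : i < n -> j < n -> adjb (tabulate n r) i j = r i j.
Proof.
move=> ni nj; rewrite /adjb (nth_map 0) ?size_iota // nth_iota // (nth_map 0) ?size_iota //.
by rewrite nth_iota.
Qed.

(** Adjacency as a boolean function of numbers, so that the matrices of products and circulants can
    be evaluated without ordinals. *)
Definition coded (G : sgraph) n (r : nat -> nat -> bool) : Prop :=
  exists2 f : 'I_n -> G, bijective f & forall i j, adj (f i) (f j) = r i j.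

Lemma coded_presented G n r : coded G n r -> presented G n (tabulate n r).
Proof. by case=> f fB fA; exists f => // i j; rewrite fA adjb_tabulate. Qed.

Lemma coded_id n (e : rel 'I_n) (r : nat -> nat -> bool) :
  (forall i j : 'I_n, simple_rel e i j = r i j) -> coded (simple_graph e) n r.
Proof. by move=> er; exists id => //; exists id. Qed.

Definition complete_code (i j : nat) := i != j.

Definition cyclic_distance n i j :=
  let d := maxn i.+1 j.+1 - minn i.+1 j.+1 in minn d (n - d).

Definition circulant_code n ks (i j : nat) :=
  (i != j) && (cyclic_distance n i j \in 1 :: ks).

Definition semi_circulant_code n ks ls (i j : nat) :=
  let half k l := ~~ odd k.+1 && has (fun d => l.+1 == k.+1 + d %[mod n]) ls in
  (i != j) && ((cyclic_distance n i j \in 1 :: ks) || (half i j || half j i)).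

Lemma coded_complete n : coded (complete_graph n) n complete_code.
Proof. by apply: coded_id => i j; rewrite /simple_rel /= andbT. Qed.

Lemma circulant_rel_sym n ks : symmetric (@circulant_rel n ks).
Proof. by move=> i j; rewrite /circulant_rel /= (maxnC i.+1) (minnC i.+1). Qed.

Lemma coded_circulant n ks : coded (circulant n ks) n (circulant_code n ks).
Proof. by apply: coded_id => i j; rewrite /simple_rel (circulant_rel_sym ks j) orbb. Qed.

Lemma coded_semi_circulant n ks ls :
  coded (semi_circulant n ks ls) n (semi_circulant_code n ks ls).
Proof.
by apply: coded_id => i j; rewrite /simple_rel (circulant_rel_sym ks j) orbACA orbb.
Qed.

Section Products.
Variables (G H : sgraph) (a b : nat) (r t : nat -> nat -> bool).
Hypotheses (Gr : coded G a r) (Ht : coded H b t).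

Lemma product_code : exists2 f : 'I_(a * b) -> G * H, bijective f &
  forall i j, [/\ adj (f i).1 (f j).1 = r (i %/ b) (j %/ b),
    adj (f i).2 (f j).2 = t (i %% b) (j %% b),
    ((f i).1 == (f j).1) = (i %/ b == j %/ b) & ((f i).2 == (f j).2) = (i %% b == j %% b)].
Proof.
have [g gB gA] := Gr; have [h hB hA] := Ht.
have b0 (i : 'I_(a * b)) : 0 < b by rewrite lt0n; case: b i => // -[k]; rewrite muln0.
have q (i : 'I_(a * b)) : i %/ b < a by rewrite ltn_divLR ?(b0 i).
have m (i : 'I_(a * b)) : i %% b < b by rewrite ltn_mod (b0 i).
exists (fun i => (g (Ordinal (q i)), h (Ordinal (m i)))) => [|i j]; last first.
  by split; rewrite /= ?gA ?hA // ?(inj_eq (bij_inj gB)) ?(inj_eq (bij_inj hB)) -val_eqE.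
apply: inj_card_bij => [i j [/(bij_inj gB)[e1] /(bij_inj hB)[e2]]|].
  by apply: val_inj; rewrite /= (divn_eq i b) e1 e2 -divn_eq.
by rewrite card_prod card_ord -(bij_eq_card gB) -(bij_eq_card hB) !card_ord.
Qed.

Lemma coded_direct : coded (direct_product G H) (a * b)
  (fun i j => r (i %/ b) (j %/ b) && t (i %% b) (j %% b)).
Proof.
have [f fB fA] := product_code; exists f => // i j.
by have [e1 e2 _ _] := fA i j; rewrite [LHS]/= /direct_rel e1 e2.
Qed.

Lemma coded_cartesian : coded (cartesian_product G H) (a * b)
  (fun i j => (i %/ b == j %/ b) && t (i %% b) (j %% b) ||
              r (i %/ b) (j %/ b) && (i %% b == j %% b)).
Proof.
have [f fB fA] := product_code; exists f => // i j.
by have [e1 e2 e3 e4] := fA i j; rewrite [LHS]/= /cartesian_rel e1 e2 e3 e4.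
Qed.
End Products.

Lemma presented_iso G H n M : presented G n M -> presented H n M -> isomorphic G H.
Proof.
case=> f [f' fK f'K] fA [h hB hA]; exists (h \o f').
  by apply: bij_comp hB _; exists f.
by move=> x y /=; rewrite hA -fA !f'K.
Qed.

Definition complb n (M : seq (seq bool)) := tabulate n (fun i j => (i != j) && ~~ adjb M i j).

Lemma presented_compl G n M : presented G n M -> presented (compl_graph G) n (complb n M).
Proof.
case=> f fB fA; exists f => // i j.
by rewrite adj_compl fA adjb_tabulate // (inj_eq (bij_inj fB)) -val_eqE.
Qed.

Lemma presented_iso_by G n M N im : presented G n M -> size N = n -> iso_by M N im ->
  presented G n N.
Proof.
case=> f fB fA sN; case: n => [|n] in f fB fA sN *; last first.
  apply: (@iso_byP G n.+1 (fun i => f (inord i)) M) => //.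
  - by move=> i j ni nj /(bij_inj fB)/(congr1 val); rewrite /= !inordK.
  - move=> x; have [g _ gK] := fB; exists (val (g x)); first exact: ltn_ord.
    by rewrite inord_val gK.
  by move=> i j ni nj; rewrite fA !inordK.
by move=> _; exists f => // -[].
Qed.

Section Permutations.
Variables (G : sgraph) (n : nat) (M : seq (seq bool)).
Hypothesis G_M : presented G n M.

Definition perm_ok (s : seq nat) :=
  [&& size s == n, uniq s, all (gtn n) s &
    all (fun i => all (fun j => adjb M (nth 0 s i) (nth 0 s j) == adjb M i j) (iota 0 n))
      (iota 0 n)].

Definition disjoint_ok (s t : seq nat) :=
  [&& perm_ok s, perm_ok t, has (fun i => nth 0 s i != i) (iota 0 n),
      has (fun i => nth 0 t i != i) (iota 0 n) &
      all (fun i => (nth 0 s i == i) || (nth 0 t i == i)) (iota 0 n)].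

Lemma disjoint_okP s t : disjoint_ok s t -> disjoint_automorphisms G.
Proof.
case/and5P=> sP tP /hasP[k]; rewrite mem_iota => nk sk /hasP[l]; rewrite mem_iota => nl tl.
move=> /allP st; have [f [g fK gK] fA] := G_M.
have real (r : seq nat) : perm_ok r -> exists u : {perm G},
    (forall x y, adj (u x) (u y) = adj x y) /\ forall x, g (u x) = nth 0 r (g x) :> nat.
  case/and4P=> /eqP sr ur /allP rn /allP rA.
  have rlt (i : 'I_n) : nth 0 r i < n by apply: rn; rewrite mem_nth ?sr.
  pose v x := f (Ordinal (rlt (g x))).
  have vI : injective v.
    move=> x y /(can_inj fK)[] /eqP; rewrite nth_uniq ?sr // => /eqP/val_inj.
    exact: (can_inj gK).
  exists (perm vI); split=> x; last by rewrite permE /v fK.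
  move=> y; rewrite !permE /v fA /=; have /rA/allP/(_ (g y)) : (g x : nat) \in iota 0 n.
    by rewrite mem_iota ltn_ord.
  by rewrite mem_iota ltn_ord => /(_ isT)/eqP ->; rewrite -fA !gK.
have [u [uA us]] := real s sP; have [v [vA vt]] := real t tP.
exists u, v; split=> //.
- apply: contraNneq sk => u1; have := us (f (Ordinal nk)).
  by rewrite u1 perm1 fK => <-.
- apply: contraNneq tl => v1; have := vt (f (Ordinal nl)).
  by rewrite v1 perm1 fK => <-.
move=> x; have := st (g x); rewrite mem_iota ltn_ord => /(_ isT)/orP[/eqP e|/eqP e].
  by left; apply/(can_inj gK)/val_inj; rewrite /= us.
by right; apply/(can_inj gK)/val_inj; rewrite /= vt.
Qed.
End Permutations.

Lemma disjoint_complete n : 4 <= n -> disjoint_automorphisms (complete_graph n).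
Proof.
case: n => [|[|[|[|n]]]] // _.
have aut (s : {perm complete_graph n.+4}) x y : adj (s x) (s y) = adj x y.
  by rewrite /= /simple_rel (inj_eq perm_inj).
pose i k : complete_graph n.+4 := @inord n.+3 k.
have iE k l : k < 4 -> l < 4 -> (i k == i l) = (k == l).
  by move=> k4 l4; rewrite -val_eqE /= !inordK //; lia.
exists (tperm (i 0) (i 1)), (tperm (i 2) (i 3)); split=> //.
- by apply/eqP => /permP/(_ (i 0))/eqP; rewrite tpermL perm1 iE.
- by apply/eqP => /permP/(_ (i 2))/eqP; rewrite tpermL perm1 iE.
move=> x; case: (tpermP (i 0) (i 1) x) => [->|->|_ _]; last by left.
  by right; rewrite tpermD // iE.
by right; rewrite tpermD // iE.
Qed.

Lemma disjoint_disjoint_copies m H : 2 <= m -> vertex_transitive H -> 2 <= #|H| ->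
  disjoint_automorphisms (disjoint_copies m H).
Proof.
case: m => [|[|m]] // _ vt /card_gt1P[x [y [_ _ xy]]]; have [s sA sx] := vt x y.
pose on (k : 'I_m.+2) (ih : disjoint_copies m.+2 H) : disjoint_copies m.+2 H :=
  (ih.1, if ih.1 == k then s ih.2 else ih.2).
have onI k : injective (on k).
  move=> [i h] [j l] [] <-; case: ifP => _ => [/perm_inj ->|->] //.
have nt k : perm (onI k) != 1%g.
  apply/eqP => /permP/(_ (k, x)); rewrite permE perm1 /on /= eqxx => -[] yx.
  by rewrite -sx yx eqxx in xy.
have aut k u v : adj (perm (onI k) u) (perm (onI k) v) = adj u v.
  rewrite !permE /= /copies_rel /on /=; case: eqVneq => //= ->.
  by case: ifP.
exists (perm (onI ord0)), (perm (onI ord_max)); split=> //.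
move=> [i h]; rewrite !permE /on /=; case: (i =P ord0) => [->|_]; last by left.
by right; case: eqP.
Qed.

(* The graphs of the cases (c) and (d), in this order. *)
Definition graphs_cd : seq sgraph :=
  [:: cartesian_product (complete_graph 2) (cycle_graph 4),
      cartesian_product (complete_graph 2) (complete_graph 5),
      circulant 10 [:: 4] & graphs_d].

Definition cartesian_code b (r t : nat -> nat -> bool) (i j : nat) :=
  (i %/ b == j %/ b) && t (i %% b) (j %% b) || r (i %/ b) (j %/ b) && (i %% b == j %% b).

Definition direct_code b (r t : nat -> nat -> bool) (i j : nat) :=
  r (i %/ b) (j %/ b) && t (i %% b) (j %% b).

Definition codes_cd : seq (nat * (nat -> nat -> bool)) :=
  [:: (2 * 4, cartesian_code 4 complete_code (circulant_code 4 [::]));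
      (2 * 5, cartesian_code 5 complete_code complete_code);
      (10, circulant_code 10 [:: 4]);
      (6 * 2, direct_code 2 complete_code complete_code);
      (3 * 4, direct_code 4 complete_code complete_code);
      (4 * 3, cartesian_code 3 (circulant_code 4 [::]) (circulant_code 3 [::]));
      (2 * 6, cartesian_code 6 complete_code (circulant_code 6 [:: 3]));
      (2 * 6, cartesian_code 6 complete_code (circulant_code 6 [:: 2]));
      (12, circulant_code 12 [:: 5]);
      (12, circulant_code 12 [:: 4; 5]);
      (12, circulant_code 12 [:: 5; 6]);
      (12, semi_circulant_code 12 [::] [:: 5]);
      (12, semi_circulant_code 12 [:: 6] [:: 3]);
      (12, semi_circulant_code 12 [:: 6] [:: 5])].

Definition size_cd k := (nth (0, complete_code) codes_cd k).1.
Definition matrix_cd k := tabulate (size_cd k) (nth (0, complete_code) codes_cd k).2.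

Lemma presented_cd G k : k < 14 -> presented (nth G graphs_cd k) (size_cd k) (matrix_cd k).
Proof.
move=> k14; apply: coded_presented; move: k k14.
do 14! [case; first by move=> _; rewrite /=;
  first [exact: coded_circulant | exact: coded_semi_circulant | apply: coded_cartesian | apply: coded_direct];
  first [exact: coded_complete | exact: coded_circulant]].
by [].
Qed.

Lemma listed_cd G H k : k < 14 -> isomorphic G (nth H graphs_cd k) -> listed G.
Proof.
move=> k14 h; case: k => [|[|[|k]]] in k14 h.
- by apply/Or43/Or31.
- by apply/Or43/Or32.
- by apply/Or43/Or33.
by apply: Or44; exists k => //; rewrite (set_nth_default H).
Qed.

(** * Tables of graphs with their certificates *)

Inductive rep_cert :=
  | Commuting of seq (seq nat * seq nat) & seq (nat * class_cert)
  | Listed of nat & bool & seq nat.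

(** In [Listed k compl im], the list [im] is an isomorphism from the graph [k] of [graphs_cd], or
    from its complement if [compl] holds, to the tabulated graph. *)
Definition rep_ok n (Nc : seq (seq bool) * rep_cert) :=
  match Nc.2 with
  | Commuting steps certs => commuting_cert n Nc.1 steps certs
  | Listed k compl im => [&& k < 14, eqn (size_cd k) n &
      iso_by Nc.1 (if compl then complb n (matrix_cd k) else matrix_cd k) im]
  end.

Lemma rep_okP (G : sgraph) n Nc : presented G n Nc.1 -> rep_ok n Nc ->
  [\/ commutes G, listed G | listed (compl_graph G)].
Proof.
case: Nc => N [steps certs|k co im] /= pG.
  by move=> /(presented_commutes pG); apply: Or31.
case/and3P=> k14; rewrite eqnE => /eqP kn.
have pL := presented_cd G k14; rewrite kn in pL.
case: co => /(presented_iso_by pG) /= pG'.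
  apply: Or33; apply: (listed_cd (H := G) k14).
  apply: iso_trans (compl_iso _) (iso_sym (iso_complK _)).
  apply: presented_iso (presented_compl pL); apply: pG'.
  by rewrite size_map size_iota.
apply: Or32; apply: (listed_cd (H := G) k14); apply: presented_iso pL; apply: pG'.
by rewrite size_map size_iota.
Qed.

(* Vertex [i] of a graph is coded by the list of its neighbours larger than [i]. *)
Definition decode n (reps : seq (seq (seq nat) * rep_cert)) : seq (seq (seq bool) * rep_cert) :=
  [seq (tabulate n (fun i j => has (eqn j) (nth [::] Nc.1 i) || has (eqn i) (nth [::] Nc.1 j)), Nc.2)
    | Nc <- reps].

(** In the order of [graphs_cd]. For [K_2 [] K_5], [K_6 x K_2] and [K_3 x K_4] they are induced by
    disjoint transpositions of a complete factor. For [C_10(4)], [C_12(5)] and [C_12(5,6)] they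
    exchange antipodal vertices, which have the same other neighbours. *)
Definition automorphisms_cd : seq (seq nat * seq nat) :=
  [:: ([:: 0; 1; 5; 4; 3; 2; 6; 7], [:: 7; 6; 2; 3; 4; 5; 1; 0]);
    ([:: 0; 1; 2; 4; 3; 5; 6; 7; 9; 8], [:: 0; 2; 1; 3; 4; 5; 7; 6; 8; 9]);
    ([:: 0; 1; 2; 3; 9; 5; 6; 7; 8; 4], [:: 0; 1; 2; 8; 4; 5; 6; 7; 3; 9]);
    ([:: 0; 1; 2; 3; 4; 5; 6; 7; 10; 11; 8; 9], [:: 0; 1; 2; 3; 6; 7; 4; 5; 8; 9; 10; 11]);
    ([:: 0; 1; 3; 2; 4; 5; 7; 6; 8; 9; 11; 10], [:: 1; 0; 2; 3; 5; 4; 6; 7; 9; 8; 10; 11]);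
    ([:: 0; 1; 2; 9; 10; 11; 6; 7; 8; 3; 4; 5], [:: 6; 7; 8; 3; 4; 5; 0; 1; 2; 9; 10; 11]);
    ([:: 0; 1; 2; 5; 4; 3; 6; 7; 8; 11; 10; 9], [:: 0; 1; 4; 3; 2; 5; 6; 7; 10; 9; 8; 11]);
    ([:: 0; 1; 5; 3; 4; 2; 6; 7; 11; 9; 10; 8], [:: 0; 4; 2; 3; 1; 5; 6; 10; 8; 9; 7; 11]);
    ([:: 0; 1; 2; 3; 4; 11; 6; 7; 8; 9; 10; 5], [:: 0; 1; 2; 3; 10; 5; 6; 7; 8; 9; 4; 11]);
    ([:: 0; 7; 2; 9; 4; 11; 6; 1; 8; 3; 10; 5], [:: 6; 1; 8; 3; 10; 5; 0; 7; 2; 9; 4; 11]);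
    ([:: 0; 1; 2; 3; 4; 11; 6; 7; 8; 9; 10; 5], [:: 0; 1; 2; 3; 10; 5; 6; 7; 8; 9; 4; 11]);
    ([:: 0; 1; 2; 9; 10; 5; 6; 7; 8; 3; 4; 11], [:: 0; 7; 8; 3; 4; 5; 6; 1; 2; 9; 10; 11]);
    ([:: 0; 1; 7; 10; 4; 5; 11; 2; 8; 9; 3; 6], [:: 5; 8; 2; 3; 9; 0; 6; 7; 1; 4; 10; 11]);
    ([:: 0; 1; 2; 9; 10; 5; 6; 7; 8; 3; 4; 11], [:: 0; 7; 8; 3; 4; 5; 6; 1; 2; 9; 10; 11])].

(** The pentagon shows how a certificate reads. If [b] and [d] are common neighbours of [a] and [c],
    then either [a = c], or [a] and [c] are not adjacent and [b = d]. Hence [BD 0] is [AC 2] plus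
    the indicator of [a = c] and [b = d]. The other class is alike, the complement being a pentagon
    again. *)
Definition reps5 := decode 5
  [:: ([:: [:: 1; 2]; [:: 3]; [:: 4]; [:: 4]], Commuting [::] [:: (1, Quad 1 [:: BD 0] [:: AC 2]);
     (2, Quad 1 [:: BD 0] [:: AC 1])])].

Definition reps6 := decode 6
  [:: ([:: [:: 1; 2]; [:: 3]; [:: 4]; [:: 5]; [:: 5]], Commuting [:: ([:: 0; 0; 1],
     [:: 0; 1; 2; 3])] [:: (0, Quad 1 [:: AC 3] [::]); (1, Quad 1 [:: AC 3] [:: BD 1]);
     (2, Quad 1 [:: AC 3] [:: BD 1])])].

Definition reps7 := decode 7
  [:: ([:: [:: 1; 2]; [:: 3]; [:: 4]; [:: 5]; [:: 6]; [:: 6]], Commuting [:: ([:: 1; 1; 0],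
     [:: 0; 1; 2; 3])] [:: (0, Quad 1 [:: AC 3] [:: BD 2]); (1, Quad 1 [:: AC 3] [:: BD 0]);
     (2, Quad 1 [:: AC 3] [:: BD 1])])].

Definition reps8 := decode 8
  [:: ([:: [:: 1; 2]; [:: 3]; [:: 4]; [:: 5]; [:: 6]; [:: 7]; [:: 7]], Commuting [:: ([:: 1; 1; 0],
     [:: 0; 1; 2; 3]); ([:: 1; 2; 0; 0], [:: 4; 5; 6; 8; 11])] [:: (0, Quad 1 [:: AC 4]
     [:: BD 1]); (1, Quad 1 [:: Star 0 0] [::]); (2, Quad 1 [:: AC 4] [:: BD 1]); (3, Quad 1
     [:: AC 4] [::])]);
   ([:: [:: 1; 2; 3]; [:: 4; 5]; [:: 5; 6]; [:: 4; 6]; [:: 7]; [:: 7]; [:: 7]], Listed 0 false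
     [:: 0; 1; 4; 3; 2; 5; 7; 6]);
   ([:: [:: 1; 2; 3]; [:: 4; 5]; [:: 6; 7]; [:: 4; 6]; [:: 7]; [:: 6; 7]; [::]], Commuting [::
     ([:: 0; 1; 0], [:: 0; 1; 2; 3]); ([:: 1; 0; 2; 0], [:: 2; 4; 8; 9; 11])] [:: (0, Quad 1
     [:: AC 4] [:: BD 3]); (1, Quad 1 [:: AC 4] [:: BD 3]); (2, Quad 1 [:: AC 4] [::]);
     (3, Quad 1 [:: Star 0 0] [::])])].

Definition reps9 := decode 9
  [:: ([:: [:: 1; 2]; [:: 3]; [:: 4]; [:: 5]; [:: 6]; [:: 7]; [:: 8]; [:: 8]], Commuting [::
     ([:: 1; 1; 0], [:: 0; 1; 2; 3]); ([:: 1; 0; 0; 0], [:: 0; 1; 2; 3; 4])] [:: (0, Quad 1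
     [:: AC 4] [:: BD 3]); (1, Quad 1 [:: AC 4] [:: BD 1]); (2, Quad 1 [:: AC 4] [:: BD 0]);
     (3, Quad 1 [:: AC 4] [:: BD 2])]);
   ([:: [:: 1; 2; 3; 4]; [:: 4; 5; 6]; [:: 3; 6; 7]; [:: 5; 8]; [:: 7; 8]; [:: 6; 8]; [:: 7];
     [:: 8]], Commuting [::] [:: (1, Quad 1 [:: BD 1; Star 2 2] [:: AC 0; AC 2]); (2, Quad 1
     [:: Star 2 2] [::])]);
   ([:: [:: 1; 2; 3; 4]; [:: 3; 5; 6]; [:: 3; 4; 7]; [:: 5]; [:: 7; 8]; [:: 6; 8]; [:: 7; 8];
     [:: 8]], Commuting [:: ([:: 0; 0; 1], [:: 0; 1; 2; 3; 4])] [:: (0, Quad 1 [:: AC 4]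
     [:: BD 3]); (1, Quad 1 [:: AC 4] [:: BD 1]); (2, Quad 1 [:: AC 4] [:: BD 0]); (3, Quad 1
     [:: AC 4] [:: BD 2])]);
   ([:: [:: 1; 2; 3; 4]; [:: 2; 5; 6]; [:: 7; 8]; [:: 5; 7; 8]; [:: 5; 6; 8]; [:: 7]; [:: 7; 8];
     [::]], Commuting [:: ([:: 0; 1; 0], [:: 0; 1; 2; 3; 4])] [:: (0, Quad 1 [:: AC 4]
     [:: BD 3]); (1, Quad 1 [:: AC 4] [:: BD 1]); (2, Quad 1 [:: AC 4] [:: BD 0]); (3, Quad 1
     [:: AC 4] [:: BD 2])])].

(** The fourth graph is the Petersen graph. It has no cycles of length 3 or 4, so its edges have the
    certificate of the pentagon; non-adjacent vertices have a common neighbour, which gives the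
    [Local] certificate. *)
Definition reps10 := decode 10
  [:: ([:: [:: 1; 2]; [:: 3]; [:: 4]; [:: 5]; [:: 6]; [:: 7]; [:: 8]; [:: 9]; [:: 9]], Commuting
     [:: ([:: 1; 1; 0], [:: 0; 1; 2; 3]); ([:: 1; 0; 0; 0], [:: 0; 1; 2; 3; 4; 5])] [::
     (0, Quad 1 [:: AC 5] [::]); (1, Quad 1 [:: AC 5] [:: BD 3]); (2, Quad 1 [:: AC 5]
     [:: BD 1]); (3, Quad 1 [:: AC 5] [:: BD 1]); (4, Quad 1 [:: AC 5] [:: BD 3])]);
   ([:: [:: 1; 2; 3]; [:: 4; 5]; [:: 5; 6]; [:: 6; 7]; [:: 8; 9]; [:: 9]; [:: 8]; [:: 8; 9];
     [::]], Commuting [:: ([:: 2; 1; 0], [:: 0; 1; 2; 4; 7]); ([:: 0; 1; 0; 1; 0],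
     [:: 0; 1; 2; 3; 4; 5])] [:: (0, Quad 1 [:: AC 5] [::]); (1, Quad 1 [:: AC 5] [:: BD 3]);
     (2, Quad 1 [:: AC 5] [:: BD 1]); (3, Quad 1 [:: AC 5] [:: BD 1]); (4, Quad 1 [:: AC 5]
     [:: BD 3])]);
   ([:: [:: 1; 2; 3]; [:: 4; 5]; [:: 6; 7]; [:: 5; 7]; [:: 6; 8]; [:: 8]; [:: 9]; [:: 9];
     [:: 9]], Commuting [:: ([:: 2; 1; 0], [:: 0; 1; 2; 4; 7]); ([:: 0; 1; 1; 0; 2],
     [:: 0; 1; 2; 5; 6; 8])] [:: (0, Quad 1 [:: AC 5] [::]); (1, Quad 1 [:: AC 5] [:: BD 3]);
     (2, Quad 1 [:: AC 5] [:: BD 1]); (3, Quad 1 [:: AC 5] [:: BD 1]); (4, Quad 1 [:: AC 5]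
     [:: BD 3])]);
   ([:: [:: 1; 2; 3]; [:: 4; 5]; [:: 6; 7]; [:: 8; 9]; [:: 6; 9]; [:: 7; 8]; [:: 8]; [:: 9];
     [::]], Commuting [::] [:: (1, Quad 1 [:: BD 0] [:: AC 2]); (2, Local 1)]);
   ([:: [:: 1; 2; 3; 4]; [:: 5; 6; 7]; [:: 6; 7; 8]; [:: 5; 7; 8]; [:: 5; 6; 8]; [:: 9]; [:: 9];
     [:: 9]; [:: 9]], Listed 1 true [:: 0; 5; 6; 7; 8; 9; 2; 3; 4; 1]);
   ([:: [:: 1; 2; 3; 4]; [:: 5; 6; 7]; [:: 7; 8; 9]; [:: 5; 6; 7]; [:: 7; 8; 9]; [:: 8; 9];
     [:: 8; 9]; [::]; [::]], Listed 2 false [:: 0; 1; 5; 8; 2; 7; 3; 6; 9; 4]);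
   ([:: [:: 1; 2; 3; 4]; [:: 4; 5; 6]; [:: 3; 7; 8]; [:: 4; 8]; [:: 6]; [:: 6; 7; 9]; [:: 9];
     [:: 8; 9]; [:: 9]], Commuting [:: ([:: 0; 0; 1], [:: 0; 1; 2; 3; 4; 5])] [:: (0, Quad 1
     [:: AC 5] [::]); (1, Quad 1 [:: AC 5] [:: BD 3]); (2, Quad 1 [:: AC 5] [:: BD 1]);
     (3, Quad 1 [:: AC 5] [:: BD 1]); (4, Quad 1 [:: AC 5] [:: BD 3])])].

Definition reps11 := decode 11
  [:: ([:: [:: 1; 2]; [:: 3]; [:: 4]; [:: 5]; [:: 6]; [:: 7]; [:: 8]; [:: 9]; [:: 10]; [:: 10]],
     Commuting [:: ([:: 1; 1; 0], [:: 0; 1; 2; 3]); ([:: 0; 1; 1; 1], [:: 0; 1; 2; 3; 4; 5])]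
     [:: (0, Quad 1 [:: AC 5] [:: BD 4]); (1, Quad 1 [:: AC 5] [:: BD 2]); (2, Quad 1 [:: AC 5]
     [:: BD 0]); (3, Quad 1 [:: AC 5] [:: BD 1]); (4, Quad 1 [:: AC 5] [:: BD 3])]);
   ([:: [:: 1; 2; 3; 4]; [:: 5; 6; 7]; [:: 6; 7; 8]; [:: 7; 8; 9]; [:: 8; 9; 10]; [:: 8; 9; 10];
     [:: 9; 10]; [:: 10]; [::]; [::]], Commuting [:: ([:: 0; 1; 0], [:: 0; 1; 2; 3; 4]);
     ([:: 0; 0; 1; 1; 1], [:: 0; 1; 2; 3; 4; 5])] [:: (0, Quad 1 [:: AC 5] [:: BD 4]);
     (1, Quad 1 [:: AC 5] [:: BD 2]); (2, Quad 1 [:: AC 5] [:: BD 0]); (3, Quad 1 [:: AC 5]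
     [:: BD 1]); (4, Quad 1 [:: AC 5] [:: BD 3])]);
   ([:: [:: 1; 2; 3; 4]; [:: 3; 4; 5]; [:: 4; 6; 7]; [:: 5; 8]; [:: 6]; [:: 8; 9]; [:: 7; 10];
     [:: 9; 10]; [:: 9; 10]; [:: 10]], Commuting [:: ([:: 1; 1; 0], [:: 0; 1; 2; 3; 4; 5])] [::
     (0, Quad 1 [:: AC 5] [:: BD 4]); (1, Quad 1 [:: AC 5] [:: BD 2]); (2, Quad 1 [:: AC 5]
     [:: BD 0]); (3, Quad 1 [:: AC 5] [:: BD 1]); (4, Quad 1 [:: AC 5] [:: BD 3])])].

Definition reps12 := decode 12
  [:: ([:: [:: 1; 2]; [:: 3]; [:: 4]; [:: 5]; [:: 6]; [:: 7]; [:: 8]; [:: 9]; [:: 10]; [:: 11];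
     [:: 11]], Commuting [:: ([:: 1; 1; 0], [:: 0; 1; 2; 3]); ([:: 0; 1; 1; 1],
     [:: 0; 1; 2; 3; 4; 5]); ([:: 2; 0; 0; 0; 1; 1], [:: 0; 4; 5; 8; 10; 12; 15])] [::
     (0, Quad 1 [:: Star 4 1] [::]); (1, Quad 1 [:: AC 6] [:: BD 1]); (2, Quad 1 [:: AC 6]
     [:: BD 1]); (3, Quad 1 [:: AC 6] [:: BD 2]); (4, Quad 1 [:: AC 6] [:: BD 2]); (5, Quad 1
     [:: AC 6] [::])]);
   ([:: [:: 1; 2; 3]; [:: 4; 5]; [:: 6; 7]; [:: 4; 8]; [:: 9]; [:: 10; 11]; [:: 9; 11];
     [:: 9; 10]; [:: 10; 11]; [::]; [::]], Listed 11 false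
     [:: 0; 1; 5; 10; 7; 9; 4; 3; 8; 11; 6; 2]);
   ([:: [:: 1; 2; 3]; [:: 4; 5]; [:: 4; 6]; [:: 5; 7]; [:: 8]; [:: 9]; [:: 8; 10]; [:: 9; 10];
     [:: 11]; [:: 11]; [:: 11]], Commuting [:: ([:: 2; 1; 0], [:: 0; 1; 2; 4; 7]);
     ([:: 1; 0; 2; 0; 2], [:: 2; 4; 6; 8; 9; 10; 12; 16])] [:: (0, Quad 1 [:: AC 7] [::]);
     (1, Quad 1 [:: AC 7] [::]); (2, Quad 1 [:: AC 7] [:: BD 4]); (3, Quad 1 [:: AC 7]
     [:: BD 4]); (4, Quad 1 [:: AC 7] [:: BD 4]); (5, Quad 1 [:: AC 7] [:: BD 4]); (6, Quad 1
     [:: AC 7] [::])]);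
   ([:: [:: 1; 2; 3]; [:: 2; 4]; [:: 5]; [:: 6; 7]; [:: 8; 9]; [:: 10; 11]; [:: 7; 11]; [:: 8];
     [:: 9]; [:: 10]; [:: 11]], Commuting [:: ([:: 1; 1; 0], [:: 0; 1; 2; 3; 4]);
     ([:: 1; 0; 2; 0; 2], [:: 2; 3; 5; 8; 10; 12])] [:: (0, Quad 1 [:: AC 5] [:: BD 0]);
     (1, Quad 1 [:: Star 1 1] [::]); (2, Quad 1 [:: AC 5] [:: BD 2]); (3, Quad 1 [:: Star 2 1]
     [::]); (4, Quad 1 [:: AC 5] [::])]);
   ([:: [:: 1; 2; 3]; [:: 4; 5]; [:: 5; 6]; [:: 6; 7]; [:: 8; 9]; [:: 8]; [:: 10]; [:: 10; 11];
     [:: 11]; [:: 10; 11]; [::]], Commuting [:: ([:: 2; 1; 0], [:: 0; 1; 2; 4; 7]);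
     ([:: 0; 0; 2; 1; 2], [:: 0; 4; 5; 8; 10; 12; 15])] [:: (0, Quad 1 [:: Star 4 1] [::]);
     (1, Quad 1 [:: AC 6] [:: BD 1]); (2, Quad 1 [:: AC 6] [:: BD 1]); (3, Quad 1 [:: AC 6]
     [:: BD 2]); (4, Quad 1 [:: AC 6] [:: BD 2]); (5, Quad 1 [:: AC 6] [::])]);
   ([:: [:: 1; 2; 3; 4]; [:: 5; 6; 7]; [:: 6; 8; 9]; [:: 7; 8; 9]; [:: 5; 8; 9]; [:: 10; 11];
     [:: 10; 11]; [:: 10; 11]; [:: 10]; [:: 11]; [::]], Listed 6 false
     [:: 0; 2; 8; 3; 9; 4; 1; 6; 10; 7; 11; 5]);
   ([:: [:: 1; 2; 3; 4]; [:: 5; 6; 7]; [:: 6; 8; 9]; [:: 5; 6; 7]; [:: 6; 8; 9]; [:: 10; 11];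
     [::]; [:: 10; 11]; [:: 10; 11]; [:: 10; 11]; [::]], Listed 8 false
     [:: 0; 1; 5; 10; 8; 2; 6; 3; 7; 11; 9; 4]);
   ([:: [:: 1; 2; 3; 4]; [:: 5; 6; 7]; [:: 6; 8; 9]; [:: 5; 7; 9]; [:: 6; 7; 8]; [:: 10; 11];
     [:: 11]; [:: 10]; [:: 10; 11]; [:: 10; 11]; [::]], Commuting [:: ([:: 2; 1; 0],
     [:: 0; 2; 3; 4; 8]); ([:: 0; 0; 2; 1; 2], [:: 2; 4; 6; 8; 11; 12; 16])] [:: (0, Quad 1
     [:: AC 6] [::]); (1, Quad 1 [:: AC 6] [:: BD 4]); (2, Quad 1 [:: AC 6] [:: BD 2]);
     (3, Quad 1 [:: Star 5 2] [::]); (4, Quad 1 [:: AC 6] [:: BD 2]); (5, Quad 1 [:: AC 6]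
     [:: BD 4])]);
   ([:: [:: 1; 2; 3; 4]; [:: 4; 5; 6]; [:: 7; 8; 9]; [:: 5; 8; 10]; [:: 7; 11]; [:: 9; 10];
     [:: 8; 9; 11]; [:: 9; 10]; [:: 11]; [::]; [:: 11]], Commuting [:: ([:: 2; 1; 0],
     [:: 1; 2; 4; 5; 8]); ([:: 0; 0; 2; 1; 0], [:: 0; 1; 2; 4; 8; 10])] [:: (0, Quad 1
     [:: Star 1 3] [::]); (1, Quad 1 [:: AC 5] [:: BD 1]); (2, Quad 1 [:: Star 2 2] [::]);
     (3, Quad 1 [:: AC 5] [:: BD 3]); (4, Quad 1 [:: AC 5] [::])]);
   ([:: [:: 1; 2; 3; 4]; [:: 5; 6; 7]; [:: 7; 8; 9]; [:: 5; 8; 10]; [:: 6; 9; 11]; [:: 9; 11];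
     [:: 8; 10]; [:: 10; 11]; [:: 11]; [:: 10]; [::]], Listed 12 false
     [:: 0; 3; 5; 9; 10; 7; 2; 8; 11; 4; 6; 1]);
   ([:: [:: 1; 2; 3; 4]; [:: 2; 3; 5]; [:: 3; 6]; [:: 7]; [:: 6; 8; 9]; [:: 7; 10; 11];
     [:: 8; 9]; [:: 10; 11]; [:: 9; 11]; [:: 10]; [:: 11]], Listed 13 false
     [:: 0; 1; 5; 10; 9; 6; 2; 3; 7; 11; 8; 4]);
   ([:: [:: 1; 2; 3; 4]; [:: 2; 3; 5]; [:: 4; 6]; [:: 5; 7]; [:: 6; 8]; [:: 7; 9]; [:: 8; 10];
     [:: 9; 11]; [:: 10; 11]; [:: 10; 11]; [:: 11]], Commuting [:: ([:: 1; 1; 0],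
     [:: 0; 1; 2; 3; 4; 5]); ([:: 1; 0; 0; 1; 2; 2], [:: 6; 7; 9; 10; 12; 14; 17])] [::
     (0, Quad 1 [:: Star 5 1] [::]); (1, Quad 1 [:: AC 6] [:: BD 1]); (2, Quad 1 [:: AC 6]
     [:: BD 1]); (3, Quad 1 [:: AC 6] [:: BD 2]); (4, Quad 1 [:: AC 6] [::]); (5, Quad 1
     [:: AC 6] [:: BD 2])]);
   ([:: [:: 1; 2; 3; 4]; [:: 3; 5; 6]; [:: 4; 7; 8]; [:: 8; 9]; [:: 5; 10]; [:: 6; 10];
     [:: 9; 11]; [:: 8; 10; 11]; [:: 9]; [:: 11]; [:: 11]], Commuting [:: ([:: 1; 1; 0],
     [:: 0; 1; 2; 3; 5])] [:: (0, Quad 1 [:: AC 4] [::]); (1, Quad 1 [:: Star 1 1] [::]);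
     (2, Quad 2 [:: Star 3 1] [::]); (3, Quad 1 [:: Star 1 1] [::])]);
   ([:: [:: 1; 2; 3; 4]; [:: 2; 5; 6]; [:: 7; 8]; [:: 5; 7; 9]; [:: 6; 8; 9]; [:: 7; 10];
     [:: 8; 10]; [:: 11]; [:: 11]; [:: 10; 11]; [:: 11]], Listed 5 false
     [:: 0; 1; 2; 3; 5; 7; 9; 10; 11; 4; 6; 8]);
   ([:: [:: 1; 2; 3; 4]; [:: 2; 5; 6]; [:: 7; 8]; [:: 5; 7; 9]; [:: 6; 8; 10]; [:: 7; 10];
     [:: 8; 11]; [:: 11]; [:: 9]; [:: 10; 11]; [:: 11]], Commuting [:: ([:: 2; 1; 0],
     [:: 0; 1; 2; 4; 5; 8]); ([:: 2; 0; 1; 0; 2; 0], [:: 2; 4; 6; 8; 11; 12; 16])] [::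
     (0, Quad 1 [:: AC 6] [::]); (1, Quad 1 [:: AC 6] [:: BD 4]); (2, Quad 1 [:: AC 6]
     [:: BD 2]); (3, Quad 1 [:: Star 5 2] [::]); (4, Quad 1 [:: AC 6] [:: BD 2]); (5, Quad 1
     [:: AC 6] [:: BD 4])]);
   ([:: [:: 1; 2; 3; 4; 5]; [:: 6; 7; 8; 9]; [:: 7; 8; 9; 10]; [:: 6; 8; 9; 10];
     [:: 6; 7; 9; 10]; [:: 6; 7; 8; 10]; [:: 11]; [:: 11]; [:: 11]; [:: 11]; [:: 11]], Listed 3
     false [:: 0; 11; 6; 2; 7; 3; 8; 4; 9; 5; 10; 1]);
   ([:: [:: 1; 2; 3; 4; 5]; [:: 2; 4; 6; 7]; [:: 4; 8; 9]; [:: 7; 9; 10; 11]; [:: 10; 11];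
     [:: 6; 8; 10; 11]; [:: 8; 9; 10]; [:: 8; 9; 11]; [:: 10]; [:: 11]; [::]], Listed 9 true
     [:: 0; 6; 3; 1; 10; 7; 4; 8; 11; 2; 5; 9]);
   ([:: [:: 1; 2; 3; 4; 5]; [:: 2; 4; 6; 7]; [:: 3; 8; 9]; [:: 9; 10; 11]; [:: 6; 10; 11];
     [:: 7; 8; 10; 11]; [:: 8; 9; 10]; [:: 8; 9; 11]; [:: 10]; [:: 11]; [::]], Commuting [::
     ([:: 2; 1; 0], [:: 2; 3; 4; 5; 6; 9]); ([:: 0; 2; 0; 2; 1; 1],
     [:: 4; 6; 8; 12; 13; 16; 19])] [:: (0, Quad 1 [:: AC 6] [:: BD 4]); (1, Quad 1 [:: AC 6]
     [:: BD 4]); (2, Quad 1 [:: Star 0 3] [::]); (3, Quad 1 [:: AC 6] [:: BD 3]); (4, Quad 1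
     [:: AC 6] [:: BD 3]); (5, Quad 1 [:: AC 6] [::])]);
   ([:: [:: 1; 2; 3; 4; 5]; [:: 4; 6; 7; 8]; [:: 3; 6; 8; 9]; [:: 7; 10; 11]; [:: 9; 10; 11];
     [:: 6; 8; 10; 11]; [:: 7; 10]; [:: 9; 11]; [:: 9; 11]; [:: 10]; [::]], Commuting [::
     ([:: 0; 1; 0], [:: 0; 1; 2; 3; 5])] [:: (0, Quad 1 [:: AC 4] [::]); (1, Quad 1
     [:: Star 3 3] [::]); (2, Quad 2 [:: Star 3 3] [::]); (3, Quad 1 [:: Star 3 3] [::])]);
   ([:: [:: 1; 2; 3; 4; 5]; [:: 2; 4; 6; 7]; [:: 7; 8; 9]; [:: 4; 9; 10; 11]; [:: 8; 9];
     [:: 6; 9; 10; 11]; [:: 8; 10; 11]; [:: 8; 10; 11]; [:: 11]; [:: 10]; [::]], Commuting [::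
     ([:: 2; 0; 1], [:: 2; 3; 4; 6; 8; 10]); ([:: 3; 2; 1; 0; 2; 2],
     [:: 4; 6; 8; 9; 12; 16; 17; 20; 24; 27])] [:: (0, Quad 1 [:: AC 9] [::]); (1, Quad 1
     [:: AC 9] [::]); (2, Quad 1 [:: AC 9] [::]); (3, Quad 1 [:: AC 9] [:: BD 3]); (4, Quad 1
     [:: AC 9] [::]); (5, Quad 1 [:: AC 9] [::]); (6, Quad 1 [:: AC 9] [:: BD 3]); (7, Quad 1
     [:: AC 9] [::]); (8, Quad 1 [:: AC 9] [::])]);
   ([:: [:: 1; 2; 3; 4; 5]; [:: 2; 5; 6; 7]; [:: 5; 8; 9]; [:: 7; 9; 10; 11]; [:: 6; 8; 9; 11];
     [:: 10; 11]; [:: 8; 10; 11]; [:: 8; 9; 10]; [:: 11]; [:: 10]; [::]], Commuting [::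
     ([:: 2; 1; 0], [:: 2; 3; 4; 6; 9]); ([:: 1; 0; 0; 2; 1], [:: 6; 7; 9; 10; 12; 14; 17])] [::
     (0, Quad 1 [:: AC 6] [:: BD 2]); (1, Quad 1 [:: AC 6] [:: BD 1]); (2, Quad 1 [:: AC 6]
     [:: BD 1]); (3, Quad 1 [:: AC 6] [:: BD 2]); (4, Quad 1 [:: AC 6] [::]); (5, Quad 1
     [:: Star 0 1] [::])]);
   ([:: [:: 1; 2; 3; 4; 5]; [:: 2; 3; 4; 5]; [:: 4; 6; 7]; [:: 5; 8; 9]; [:: 6; 7]; [:: 8; 9];
     [:: 7; 10; 11]; [:: 10; 11]; [:: 9; 10; 11]; [:: 10; 11]; [:: 11]], Listed 10 false
     [:: 0; 2; 6; 10; 8; 3; 1; 4; 7; 11; 9; 5]);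
   ([:: [:: 1; 2; 3; 4; 5]; [:: 4; 5; 6; 7]; [:: 3; 4; 8; 9]; [:: 5; 9; 10]; [:: 7; 8];
     [:: 6; 10]; [:: 7; 10; 11]; [:: 8; 11]; [:: 9; 11]; [:: 10; 11]; [:: 11]], Commuting [::
     ([:: 0; 0; 1], [:: 0; 2; 4; 6])] [:: (0, Quad 1 [:: AC 3] [::]); (1, Quad 1
     [:: BD 1; Star 1 1] [:: AC 2; AC 3]); (2, Quad 1 [:: BD 2; Star 1 1] [:: AC 1; AC 3])]);
   ([:: [:: 1; 2; 3; 4; 5]; [:: 2; 5; 6; 7]; [:: 5; 8; 9]; [:: 4; 6; 9; 10]; [:: 7; 8; 11];
     [:: 10; 11]; [:: 7; 9; 10]; [:: 8; 11]; [:: 9; 11]; [:: 10]; [:: 11]], Listed 4 true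
     [:: 0; 1; 2; 5; 3; 6; 9; 10; 4; 7; 8; 11]);
   ([:: [:: 1; 2; 3; 4; 5]; [:: 2; 5; 6; 7]; [:: 4; 7; 8]; [:: 6; 8; 9; 10]; [:: 5; 7; 11];
     [:: 7; 9]; [:: 8; 10; 11]; [:: 10]; [:: 9; 11]; [:: 10; 11]; [:: 11]], Commuting [::
     ([:: 2; 0; 1], [:: 2; 4; 5; 6; 8; 10]); ([:: 0; 2; 0; 1; 1; 1],
     [:: 8; 10; 11; 12; 16; 17; 18; 20; 21]); ([:: 3; 1; 0; 0; 2; 2; 1; 2; 0],
     [:: 12; 14; 15; 16; 18; 22; 25; 28; 30; 36])] [:: (0, Quad 1 [:: AC 9] [::]); (1, Quad 1
     [:: AC 9] [::]); (2, Quad 1 [:: AC 9] [:: BD 2]); (3, Quad 1 [:: AC 9] [::]); (4, Quad 1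
     [:: AC 9] [::]); (5, Quad 1 [:: AC 9] [::]); (6, Quad 1 [:: AC 9] [:: BD 2]); (7, Quad 1
     [:: AC 9] [::]); (8, Quad 1 [:: AC 9] [::])]);
   ([:: [:: 1; 2; 3; 4; 5]; [:: 2; 5; 6; 7]; [:: 4; 7; 8]; [:: 6; 8; 9; 10]; [:: 5; 7; 9];
     [:: 7; 10]; [:: 8; 10; 11]; [:: 11]; [:: 9; 11]; [:: 10; 11]; [:: 11]], Listed 7 false
     [:: 0; 1; 2; 7; 4; 5; 3; 6; 8; 11; 9; 10]);
   ([:: [:: 1; 2; 3; 4; 5]; [:: 2; 6; 7; 8]; [:: 9; 10; 11]; [:: 6; 9; 10; 11];
     [:: 6; 7; 10; 11]; [:: 6; 7; 8; 11]; [:: 9]; [:: 9; 10]; [:: 9; 10; 11]; [::]; [::]],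
     Commuting [:: ([:: 0; 1; 0], [:: 0; 1; 2; 3; 4; 5]); ([:: 0; 0; 1; 2; 1; 2],
     [:: 2; 4; 6; 8; 11; 12; 16])] [:: (0, Quad 1 [:: AC 6] [::]); (1, Quad 1 [:: AC 6]
     [:: BD 4]); (2, Quad 1 [:: AC 6] [:: BD 2]); (3, Quad 1 [:: Star 5 2] [::]); (4, Quad 1
     [:: AC 6] [:: BD 2]); (5, Quad 1 [:: AC 6] [:: BD 4])])].

(** The last graph is the Paley graph, where the factor 2 clears the denominators of the
    combination. *)
Definition reps13 := decode 13
  [:: ([:: [:: 1; 2]; [:: 3]; [:: 4]; [:: 5]; [:: 6]; [:: 7]; [:: 8]; [:: 9]; [:: 10]; [:: 11];
     [:: 12]; [:: 12]], Commuting [:: ([:: 1; 1; 0], [:: 0; 1; 2; 3]); ([:: 0; 1; 1; 1],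
     [:: 0; 1; 2; 3; 4; 5]); ([:: 0; 1; 1; 1; 0; 0], [:: 0; 1; 2; 3; 4; 5; 6])] [:: (0, Quad 1
     [:: AC 6] [:: BD 5]); (1, Quad 1 [:: AC 6] [:: BD 3]); (2, Quad 1 [:: AC 6] [:: BD 1]);
     (3, Quad 1 [:: AC 6] [:: BD 0]); (4, Quad 1 [:: AC 6] [:: BD 2]); (5, Quad 1 [:: AC 6]
     [:: BD 4])]);
   ([:: [:: 1; 2; 3; 4]; [:: 5; 6; 7]; [:: 6; 7; 8]; [:: 7; 8; 9]; [:: 8; 9; 10];
     [:: 9; 10; 11]; [:: 10; 11]; [:: 11]; [:: 12]; [:: 12]; [:: 12]; [:: 12]], Commuting [::
     ([:: 2; 1; 0], [:: 0; 1; 2; 3; 4; 8]); ([:: 0; 1; 1; 1; 0; 1], [:: 1; 2; 3; 4; 5; 6; 7])]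
     [:: (0, Quad 1 [:: AC 6] [:: BD 5]); (1, Quad 1 [:: AC 6] [:: BD 3]); (2, Quad 1 [:: AC 6]
     [:: BD 1]); (3, Quad 1 [:: AC 6] [:: BD 0]); (4, Quad 1 [:: AC 6] [:: BD 2]); (5, Quad 1
     [:: AC 6] [:: BD 4])]);
   ([:: [:: 1; 2; 3; 4]; [:: 5; 6; 7]; [:: 6; 8; 9]; [:: 7; 10; 11]; [:: 8; 11; 12];
     [:: 8; 9; 10]; [:: 10; 11]; [:: 8; 12]; [::]; [:: 11; 12]; [:: 12]; [::]], Commuting [::
     ([:: 0; 1; 0], [:: 0; 1; 2; 4])] [:: (0, Quad 1 [:: Star 2 1] [::]); (1, Quad 1
     [:: Star 1 2] [::]); (2, Quad 1 [:: Star 1 1] [::])]);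
   ([:: [:: 1; 2; 3; 4]; [:: 3; 4; 5]; [:: 4; 6; 7]; [:: 5; 8]; [:: 6]; [:: 8; 9]; [:: 7; 10];
     [:: 10; 11]; [:: 9; 12]; [:: 11; 12]; [:: 11; 12]; [:: 12]], Commuting [:: ([:: 1; 1; 0],
     [:: 0; 1; 2; 3; 4; 5]); ([:: 0; 0; 1; 1; 2; 0], [:: 1; 2; 4; 5; 6; 8; 12])] [:: (0, Quad 1
     [:: AC 6] [:: BD 4]); (1, Quad 1 [:: AC 6] [:: BD 2]); (2, Quad 1 [:: AC 6] [:: BD 0]);
     (3, Quad 1 [:: AC 6] [:: BD 1]); (4, Quad 1 [:: AC 6] [:: BD 5]); (5, Quad 1 [:: AC 6]
     [:: BD 3])]);
   ([:: [:: 1; 2; 3; 4; 5; 6]; [:: 5; 6; 7; 8; 9]; [:: 6; 7; 8; 9; 10]; [:: 7; 8; 9; 10; 11];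
     [:: 8; 9; 10; 11; 12]; [:: 9; 10; 11; 12]; [:: 10; 11; 12]; [:: 10; 11; 12]; [:: 11; 12];
     [:: 12]; [::]; [::]], Commuting [:: ([:: 0; 1; 0], [:: 0; 1; 2; 3; 4; 5; 6])] [::
     (0, Quad 1 [:: AC 6] [:: BD 5]); (1, Quad 1 [:: AC 6] [:: BD 3]); (2, Quad 1 [:: AC 6]
     [:: BD 1]); (3, Quad 1 [:: AC 6] [:: BD 0]); (4, Quad 1 [:: AC 6] [:: BD 2]); (5, Quad 1
     [:: AC 6] [:: BD 4])]);
   ([:: [:: 1; 2; 3; 4; 5; 6]; [:: 3; 5; 6; 7; 8]; [:: 5; 6; 8; 9; 10]; [:: 7; 8; 10; 11];
     [:: 6; 9; 10; 11; 12]; [:: 8; 9; 11]; [:: 9; 12]; [:: 9; 10; 11; 12]; [:: 11; 12]; [:: 10];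
     [:: 12]; [:: 12]], Commuting [:: ([:: 2; 1; 0], [:: 2; 3; 4; 5; 6; 7; 10])] [:: (0, Quad 1
     [:: AC 6] [:: BD 4]); (1, Quad 1 [:: AC 6] [:: BD 2]); (2, Quad 1 [:: AC 6] [:: BD 0]);
     (3, Quad 1 [:: AC 6] [:: BD 1]); (4, Quad 1 [:: AC 6] [:: BD 5]); (5, Quad 1 [:: AC 6]
     [:: BD 3])]);
   ([:: [:: 1; 2; 3; 4; 5; 6]; [:: 3; 4; 5; 6; 7]; [:: 4; 6; 8; 9; 10]; [:: 5; 6; 7; 11];
     [:: 6; 8; 10]; [:: 7; 11; 12]; [:: 8]; [:: 9; 11; 12]; [:: 9; 10; 12]; [:: 10; 11; 12];
     [:: 11; 12]; [:: 12]], Commuting [:: ([:: 0; 0; 1], [:: 0; 1; 2; 3; 4; 5; 6])] [::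
     (0, Quad 1 [:: AC 6] [:: BD 5]); (1, Quad 1 [:: AC 6] [:: BD 3]); (2, Quad 1 [:: AC 6]
     [:: BD 1]); (3, Quad 1 [:: AC 6] [:: BD 0]); (4, Quad 1 [:: AC 6] [:: BD 2]); (5, Quad 1
     [:: AC 6] [:: BD 4])]);
   ([:: [:: 1; 2; 3; 4; 5; 6]; [:: 4; 5; 7; 8; 9]; [:: 4; 6; 9; 10; 11]; [:: 5; 6; 7; 11; 12];
     [:: 8; 11; 12]; [:: 9; 10; 12]; [:: 7; 8; 10]; [:: 8; 9; 11]; [:: 10; 12]; [:: 10; 11];
     [:: 12]; [:: 12]], Commuting [::] [:: (1, Quad 2 [:: BD 1; Star 2 2; Star 1 1]
     [:: AC 0; AC 0; AC 2; BD 0]); (2, Quad 2 [:: BD 1; Star 2 1; Star 1 2]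
     [:: AC 0; AC 0; AC 0; AC 1; AC 2; AC 2; BD 0])])].

(** * Tables of edge orbits under automorphisms of prime order *)

Definition family2_2 :=
  Family 4 2 [:: 1; 0; 3; 2]  [:: (0, [:: (0, 1); (0, 2); (0, 3)], [:: [:: 1; 2]]);
    (2, [:: (2, 3)], [::])].

Definition family5 :=
  Family 5 5 [:: 1; 2; 3; 4; 0]  [:: (0, [:: (0, 1); (0, 2)], [::])].

Definition family3_3 :=
  Family 6 3 [:: 1; 2; 0; 4; 5; 3]  [:: (0, [:: (0, 1); (0, 3); (0, 4); (0, 5)], [::
    [:: 1; 2; 3]]); (3, [:: (3, 4)], [::])].

Definition family7 :=
  Family 7 7 [:: 1; 2; 3; 4; 5; 6; 0]  [:: (0, [:: (0, 1); (0, 2); (0, 3)], [::])].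

Definition family2_4 :=
  Family 8 2 [:: 1; 0; 3; 2; 5; 4; 7; 6]  [::
    (0, [:: (0, 1); (0, 2); (0, 3); (0, 4); (0, 5); (0, 6); (0, 7)], [:: [:: 1; 2]; [:: 3; 4];
    [:: 5; 6]]); (2, [:: (2, 3); (2, 4); (2, 5); (2, 6); (2, 7)], [::]);
    (4, [:: (4, 5); (4, 6); (4, 7)], [::]); (6, [:: (6, 7)], [::])].

Definition family3_3_3 :=
  Family 9 3 [:: 1; 2; 0; 4; 5; 3; 7; 8; 6]  [::
    (0, [:: (0, 1); (0, 3); (0, 4); (0, 5); (0, 6); (0, 7); (0, 8)], [:: [:: 1; 2; 3];
    [:: 4; 5; 6]]); (3, [:: (3, 4); (3, 6); (3, 7); (3, 8)], [::]); (6, [:: (6, 7)], [::])].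

Definition family5_5 :=
  Family 10 5 [:: 1; 2; 3; 4; 0; 6; 7; 8; 9; 5]  [::
    (0, [:: (0, 1); (0, 2); (0, 5); (0, 6); (0, 7); (0, 8); (0, 9)], [:: [:: 2; 3; 4; 5; 6]]);
    (5, [:: (5, 6); (5, 7)], [::])].

Definition family11 :=
  Family 11 11 [:: 1; 2; 3; 4; 5; 6; 7; 8; 9; 10; 0]  [::
    (0, [:: (0, 1); (0, 2); (0, 3); (0, 4); (0, 5)], [::])].

Definition family3_4 :=
  Family 12 3 [:: 1; 2; 0; 4; 5; 3; 7; 8; 6; 10; 11; 9]  [:: (0, [:: (0, 1); (0, 3); (0, 4);
    (0, 5); (0, 6); (0, 7); (0, 8); (0, 9); (0, 10); (0, 11)], [:: [:: 1; 2; 3]; [:: 4; 5; 6];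
    [:: 7; 8; 9]]); (3, [:: (3, 4); (3, 6); (3, 7); (3, 8); (3, 9); (3, 10); (3, 11)], [::]);
    (6, [:: (6, 7); (6, 9); (6, 10); (6, 11)], [::]); (9, [:: (9, 10)], [::])].

(** The vertices 9, 10 and 11 are fixed. Their rows come first: a pair of a fixed vertex and a cycle
    contributes a single bit, so the valency is settled by few choices. *)
Definition family3_3_1_3 :=
  Family 12 3 [:: 1; 2; 0; 4; 5; 3; 7; 8; 6; 9; 10; 11]  [::
    (9, [:: (9, 0); (9, 3); (9, 6); (9, 10); (9, 11)], [::]);
    (10, [:: (10, 0); (10, 3); (10, 6); (10, 11)], [::]); (11, [:: (11, 0); (11, 3); (11, 6)],
    [::]); (0, [:: (0, 1); (0, 3); (0, 4); (0, 5); (0, 6); (0, 7); (0, 8)], [:: [:: 13; 14; 15];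
    [:: 16; 17; 18]]); (3, [:: (3, 4); (3, 6); (3, 7); (3, 8)], [::]); (6, [:: (6, 7)], [::])].

Definition family13 :=
  Family 13 13 [:: 1; 2; 3; 4; 5; 6; 7; 8; 9; 10; 11; 12; 0]  [::
    (0, [:: (0, 1); (0, 2); (0, 3); (0, 4); (0, 5); (0, 6)], [::])].

Lemma disjoint_cd G k : k < 14 -> disjoint_automorphisms (nth G graphs_cd k).
Proof.
move=> k14; have h : all (fun k => let st := nth ([::], [::]) automorphisms_cd k in
  disjoint_ok (size_cd k) (matrix_cd k) st.1 st.2) (iota 0 14) by vm_compute.
have := allP h k; rewrite mem_iota => /(_ k14) hk.
exact: (disjoint_okP (presented_cd G k14) hk).
Qed.

Definition classified G := [\/ commutes G, listed G | listed (compl_graph G)].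

Definition data_ok n m p f F reps :=
  [&& prime p, eqn n (m * p + f) && (0 < m), family_wf F, block_family F m p f & rotations_ok p] &&
  [&& all (fun N => eqn (size N) n) (unzip1 reps), all (rep_ok n) reps & family_ok (unzip1 reps) F].

Lemma data2_2 : data_ok 4 2 2 0 family2_2 [::]. Proof. by vm_compute. Qed.
Lemma data5 : data_ok 5 1 5 0 family5 reps5. Proof. by vm_compute. Qed.
Lemma data3_3 : data_ok 6 2 3 0 family3_3 reps6. Proof. by vm_compute. Qed.
Lemma data7 : data_ok 7 1 7 0 family7 reps7. Proof. by vm_compute. Qed.
Lemma data2_4 : data_ok 8 4 2 0 family2_4 reps8. Proof. by vm_compute. Qed.
Lemma data3_3_3 : data_ok 9 3 3 0 family3_3_3 reps9. Proof. by vm_compute. Qed.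
Lemma data5_5 : data_ok 10 2 5 0 family5_5 reps10. Proof. by vm_compute. Qed.
Lemma data11 : data_ok 11 1 11 0 family11 reps11. Proof. by vm_compute. Qed.
Lemma data3_4 : data_ok 12 4 3 0 family3_4 reps12. Proof. by vm_compute. Qed.
Lemma data3_3_1_3 : data_ok 12 3 3 3 family3_3_1_3 reps12. Proof. by vm_compute. Qed.
Lemma data13 : data_ok 13 1 13 0 family13 reps13. Proof. by vm_compute. Qed.

Local Open Scope group_scope.
Local Open Scope nat_scope.

Lemma fixed_mod (G : sgraph) (s : {perm G}) p : prime p -> #[s] = p ->
  #|fixed s| = #|G| %[mod p].
Proof.
move=> p_pr os; have pS : p.-group <[s]> by rewrite /pgroup -orderE os pnat_id.
have aS : [acts <[s]>, on [set: G] | 'P]  by apply/actsP=> a _ x; rewrite !inE.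
have := pgroup_fix_mod pS aS; rewrite cardsT => ->; congr (_ %% _).
rewrite afix_cycle ?inE //; apply: eq_card => x.
by rewrite [LHS]inE in_setI in_setT; apply/eqP/afix1P.
Qed.

Lemma data_classified (G : sgraph) n m p f F reps (s : {perm G}) d :
  data_ok n m p f F reps -> #|G| = n ->
  (forall x y, adj (s x) (s y) = adj x y) -> #[s] = p -> #|fixed s| = f ->
  vertex_transitive G -> connected G -> (forall x : G, \sum_(y | adj x y) 1 = d) ->
  d <= n.-1./2 -> classified G.
Proof.
rewrite /data_ok eqnE.
case/andP=> /and5P[p_pr /andP[/eqP nE m0] wf bf rot] /and3P[sz ok fam].
move=> cG sA os fs vt conn reg dn.
have [|||N /(nthP [::])[k]] := block_family_okP sA p_pr os fs _ m0 wf bf rot vt conn reg _ _ fam.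
- by rewrite cG.
- by rewrite cG.
- by rewrite cG; apply: sub_all sz => N; rewrite ?eqnE.
rewrite size_map => rk <-; have x0 := ([::] : seq (seq bool), Listed 0 false [::]).
by rewrite (nth_map x0) // cG => /rep_okP; apply; apply: (all_nthP x0 ok).
Qed.

(** For prime powers [vt_semiregular] applies. For the orders 6, 10 and 12 the primes are 3, 5 and
    3, and [vt_few_fixed] allows at most 1, 1 and 3 fixed points. Their number is also divisible by
    the prime, so it is 0, or possibly 3 for order 12. *)
Lemma classified_balanced (G : sgraph) d : vertex_transitive G -> connected G ->
  (forall x : G, \sum_(y | adj x y) 1 = d) -> d <= #|G|.-1./2 -> #|G| <= 13 -> classified G.
Proof.
move=> vt conn reg dn n13.
have [n3|n4] := leqP #|G| 3; first by apply/Or31/small_commutes.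
have semi p a n m F reps : prime p -> 0 < a -> #|G| = n -> n = p ^ a ->
    data_ok n m p 0 F reps -> classified G.
  move=> p_pr a0 cG na ok; have [|s [sA os fs]] := vt_semiregular vt p_pr a0; first by rewrite cG.
  by apply: (data_classified ok cG sA os) reg _ => //; rewrite ?fs ?cards0 // -cG.
have few p : prime p -> p %| #|G| -> exists s : {perm G}, [/\ forall x y, adj (s x) (s y) = adj x y,
    #[s] = p, #|fixed s| = #|G| %[mod p]
    & #|fixed s| <= maxn (#|G| %/ #|G|`_p).-1 (#|G| - p ^ 2)].
  move=> p_pr pG; have [|s [sA os fs]] := vt_few_fixed vt p_pr pG; first by apply: leq_trans n4.
  by exists s; split=> //; apply: fixed_mod.
have : #|G| \in iota 4 10 by rewrite mem_iota n4.
rewrite !inE => /or4P[/eqP e|/eqP e|/eqP e|].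
- exact: (semi 2 2 _ _ _ _ isT isT e erefl data2_2).
- exact: (semi 5 1 _ _ _ _ isT isT e erefl data5).
- have [//||s [sA os]] := few 3; first by rewrite e.
  rewrite e => fm fl; apply: (data_classified data3_3 e sA os) reg _ => //; last by rewrite -e.
  by move: fm fl; rewrite p_part; case: #|fixed s| => [|[|k]].
case/or4P=> [/eqP e|/eqP e|/eqP e|].
- exact: (semi 7 1 _ _ _ _ isT isT e erefl data7).
- exact: (semi 2 3 _ _ _ _ isT isT e erefl data2_4).
- exact: (semi 3 2 _ _ _ _ isT isT e erefl data3_3_3).
case/or4P=> /eqP e.
- have [//||s [sA os]] := few 5; first by rewrite e.
  rewrite e => fm fl; apply: (data_classified data5_5 e sA os) reg _ => //; last by rewrite -e.
  by move: fm fl; rewrite p_part; case: #|fixed s| => [|[|k]].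
- exact: (semi 11 1 _ _ _ _ isT isT e erefl data11).
- have [//||s [sA os]] := few 3; first by rewrite e.
  rewrite e => fm fl.
  have : #|fixed s| \in [:: 0; 3].
    by move: fm fl; rewrite p_part; case: #|fixed s| => [|[|[|[|k]]]].
  rewrite !inE => /orP[] /eqP fs.
    by apply: (data_classified data3_4 e sA os fs) reg _ => //; rewrite -e.
  by apply: (data_classified data3_3_1_3 e sA os fs) reg _ => //; rewrite -e.
exact: (semi 13 1 _ _ _ _ isT isT e erefl data13).
Qed.

(** * The universal C*-algebra *)

From mathcomp Require Import generic_quotient sesquilinear spectral classical_sets.

Local Open Scope ring_scope.
Local Open Scope quotient_scope.

Section Limits.
Variables (R : realType) (B : cstarAlgType R).
Implicit Types (s t : nat -> B) (l m : B).

Definition converges s l := forall e : R, 0 < e ->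
  exists N : nat, forall n : nat, (N <= n)%N -> cnorm (s n - l) < e.

Lemma converges_unique s l m : converges s l -> converges s m -> l = m.
Proof.
move=> sl sm; apply/eqP; rewrite -subr_eq0; apply/eqP/cnorm_eq0/eqP.
rewrite eq_le cnorm_ge0 andbT; apply/ler_addgt0Pl => e e0; rewrite addr0.
have e2 : 0 < e / 2 by rewrite divr_gt0.
have [N1 h1] := sl _ e2; have [N2 h2] := sm _ e2.
have := h1 (maxn N1 N2) (leq_maxl _ _); have := h2 (maxn N1 N2) (leq_maxr _ _).
set x := s _ => hm hl; rewrite -(subrKA x) -(opprB x l) (le_trans (cnormD _ _)) //.
by rewrite cnormN; lra.
Qed.

Lemma converges_cst l : converges (fun=> l) l.
Proof. by move=> e e0; exists 0%N => n _; rewrite subrr cnorm0. Qed.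

Lemma convergesD s t l m : converges s l -> converges t m ->
  converges (fun n => s n + t n) (l + m).
Proof.
move=> sl tm e e0; have e2 : 0 < e / 2 by rewrite divr_gt0.
have [N1 h1] := sl _ e2; have [N2 h2] := tm _ e2.
exists (maxn N1 N2) => n; rewrite geq_max => /andP[/h1 {}h1 /h2 {}h2].
by rewrite opprD addrACA (le_lt_trans (cnormD _ _)) //; lra.
Qed.

Lemma cnorm_star (x : B) : cnorm (star x) = cnorm x.
Proof.
have le (y : B) : cnorm y <= cnorm (star y).
  have [->|y0] := eqVneq (cnorm y) 0; first exact: cnorm_ge0.
  have yp : 0 < cnorm y by rewrite lt_def y0 cnorm_ge0.
  by rewrite -(ler_pM2r yp) -expr2 -cstar_identity cnormM.
by apply/eqP; rewrite eq_le le -[leRHS](congr1 _ (starK x)) le.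
Qed.

Lemma converges_star s l : converges s l -> converges (fun n => star (s n)) (star l).
Proof.
by move=> sl e /sl[N h]; exists N => n /h; rewrite -starB cnorm_star.
Qed.

Lemma cnorm_mulB (x x' y y' : B) (K e : R) : 0 <= K -> cnorm x <= K -> cnorm y' <= K ->
  cnorm (x - x') < e -> cnorm (y - y') < e -> cnorm (x * y - x' * y') <= K * e *+ 2.
Proof.
move=> K0 xK yK dx dy.
have -> : x * y - x' * y' = x * (y - y') + (x - x') * y'.
  by rewrite mulrBr mulrBl addrA subrK.
rewrite mulr2n (le_trans (cnormD _ _)) // lerD //.
  by rewrite (le_trans (cnormM _ _)) // ler_pM ?cnorm_ge0 // ltW.
by rewrite (le_trans (cnormM _ _)) // mulrC ler_pM ?cnorm_ge0 // ltW.
Qed.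

Lemma converges_bounded s l : converges s l ->
  exists N : nat, forall n : nat, (N <= n)%N -> cnorm (s n) <= cnorm l + 1.
Proof.
move=> sl; have [N h] := sl 1 ltr01; exists N => n /h hn.
by rewrite -(subrK l (s n)) addrC (le_trans (cnormD _ _)) // lerD2l ltW.
Qed.

Lemma convergesM s t l m : converges s l -> converges t m ->
  converges (fun n => s n * t n) (l * m).
Proof.
move=> sl tm e e0; have [N0 b0] := converges_bounded sl.
set K := cnorm l + 1 + cnorm m.
have K0 : 0 < K by rewrite /K; have := cnorm_ge0 l; have := cnorm_ge0 m; lra.
have e4 : 0 < e / (4 * K) by rewrite divr_gt0 // mulr_gt0.
have [N1 h1] := sl _ e4; have [N2 h2] := tm _ e4.
exists (maxn N0 (maxn N1 N2)) => n; rewrite !geq_max => /and3P[/b0 hb /h1 {}h1 /h2 {}h2].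
apply: (@le_lt_trans _ _ (K * (e / (4 * K)) *+ 2)).
  apply: cnorm_mulB h1 h2; [exact: ltW | |].
    by rewrite (le_trans hb) // lerDl cnorm_ge0.
  by rewrite lerDr addr_ge0 ?cnorm_ge0.
have -> : K * (e / (4 * K)) *+ 2 = e / 2 by rewrite mulr2n; field; rewrite ?lt0r_neq0.
lra.
Qed.
End Limits.

Section Universal.
Variables (R : realType) (G : sgraph).

Inductive term :=
  | TGen of G & G
  | TScal of R[i]
  | TAdd of term & term
  | TMul of term & term
  | TStar of term.

Record rep := Rep {
  rep_alg : cstarAlgType R;
  rep_gen : G -> G -> rep_alg;
  rep_rel : qaut_relations rep_gen
}.

Fixpoint eval (r : rep) (t : term) : rep_alg r :=
  match t with
  | TGen i j => rep_gen r i j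
  | TScal a => a%:A
  | TAdd t1 t2 => eval r t1 + eval r t2
  | TMul t1 t2 => eval r t1 * eval r t2
  | TStar t1 => star (eval r t1)
  end.

(** A bound valid in all representations at once, because the generators are projections. It makes
    the supremum that defines the universal norm finite. *)
Fixpoint bound (t : term) : R :=
  match t with
  | TGen _ _ => 1
  | TScal a => Normc.normc a
  | TAdd t1 t2 => bound t1 + bound t2
  | TMul t1 t2 => bound t1 * bound t2
  | TStar t1 => bound t1
  end.

(** Uniformly in the representation: this is the Cauchy property for the universal seminorm, stated
    without it. *)
Definition cauchy (s : nat -> term) := forall e : R, 0 < e ->
  exists N : nat, forall m n : nat, (N <= m)%N -> (N <= n)%N ->
  forall r, cnorm (eval r (s m) - eval r (s n)) < e.

Record cauchy_seq := CauchySeq { cseq :> nat -> term; cseqP : cauchy cseq }.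
HB.instance Definition _ := gen_eqMixin cauchy_seq.
HB.instance Definition _ := gen_choiceMixin cauchy_seq.

Lemma lim_exists (r : rep) (s : cauchy_seq) :
  {l : rep_alg r | converges (fun n => eval r (s n)) l}.
Proof.
apply: cid; apply: cnorm_complete => e e0.
by have [N h] := cseqP s e0; exists N => m n hm hn; apply: h.
Qed.

Definition lim (r : rep) (s : cauchy_seq) : rep_alg r := projT1 (lim_exists r s).

Lemma limP r (s : cauchy_seq) : converges (fun n => eval r (s n)) (lim r s).
Proof. exact: (projT2 (lim_exists r s)). Qed.

Lemma lim_eq r (s : cauchy_seq) l : converges (fun n => eval r (s n)) l -> lim r s = l.
Proof. exact: converges_unique (limP r s). Qed.

Lemma lim_uniform (s : cauchy_seq) (e : R) : 0 < e ->
  exists N : nat, forall n : nat, (N <= n)%N -> forall r, cnorm (eval r (s n) - lim r s) < e.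
Proof.
move=> e0; have e2 : 0 < e / 2 by rewrite divr_gt0.
have [N h] := cseqP s e2; exists N => n hn r.
have [N' h'] := limP r s e2; set m := maxn N N'.
have := h n m hn (leq_maxl _ _) r; have := h' m (leq_maxr _ _).
set x := eval r (s m) => h1 h2.
by rewrite -(subrKA x) (le_lt_trans (cnormD _ _)) //; lra.
Qed.

Lemma eval_bound r t : cnorm (eval r t) <= bound t.
Proof.
elim: t => [i j|a|t1 h1 t2 h2|t1 h1 t2 h2|t1 h1] /=.
- by apply: projection_norm; case: (rep_rel r) => /(_ i j)[? h] _ _ _; split; rewrite -?expr2.
- rewrite cnormZ ler_piMr ?projection_norm //; last exact: projection1.
  by case: a => x y; rewrite /= sqrtr_ge0.
- by rewrite (le_trans (cnormD _ _)) // lerD.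
- by rewrite (le_trans (cnormM _ _)) // ler_pM ?cnorm_ge0.
- by rewrite cnorm_star.
Qed.

Lemma cauchy_cst t : cauchy (fun=> t).
Proof. by move=> e e0; exists 0%N => m n _ _ r; rewrite subrr cnorm0. Qed.

Lemma cauchyD (s t : cauchy_seq) : cauchy (fun n => TAdd (s n) (t n)).
Proof.
move=> e e0; have e2 : 0 < e / 2 by rewrite divr_gt0.
have [N1 h1] := cseqP s e2; have [N2 h2] := cseqP t e2.
exists (maxn N1 N2) => m n; rewrite !geq_max => /andP[m1 m2] /andP[n1 n2] r /=.
rewrite opprD addrACA (le_lt_trans (cnormD _ _)) //.
have := h1 m n m1 n1 r; have := h2 m n m2 n2 r; lra.
Qed.

Lemma cauchy_bounded (s : cauchy_seq) : exists2 K : R, 0 < K &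
  exists N : nat, forall n : nat, (N <= n)%N -> forall r, cnorm (eval r (s n)) <= K.
Proof.
have [N h] := cseqP s ltr01; exists (`|bound (s N)| + 1); first by rewrite ltr_wpDl.
exists N => n hn r; have := h n N hn (leqnn _) r; have := eval_bound r (s N).
have := ler_norm (bound (s N)); set b := `|_|.
move=> h1 h2 h3; rewrite -[eval r (s n)](subrK (eval r (s N))).
by rewrite (le_trans (cnormD _ _)) //; lra.
Qed.

Lemma cauchyM (s t : cauchy_seq) : cauchy (fun n => TMul (s n) (t n)).
Proof.
move=> e e0; have [K1 K10 [N1 b1]] := cauchy_bounded s.
have [K2 K20 [N2 b2]] := cauchy_bounded t; set K := K1 + K2.
have K0 : 0 < K by rewrite addr_gt0.
have e4 : 0 < e / (4 * K) by rewrite divr_gt0 // mulr_gt0.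
have [N3 h3] := cseqP s e4; have [N4 h4] := cseqP t e4.
exists (maxn (maxn N1 N2) (maxn N3 N4)) => m n.
rewrite !geq_max => /andP[/andP[m1 m2] /andP[m3 m4]] /andP[/andP[n1 n2] /andP[n3 n4]] r /=.
apply: (@le_lt_trans _ _ (K * (e / (4 * K)) *+ 2)).
  apply: cnorm_mulB (h3 m n m3 n3 r) (h4 m n m4 n4 r); first exact: ltW.
    by rewrite (le_trans (b1 _ m1 r)) // lerDl ltW.
  by rewrite (le_trans (b2 _ n2 r)) // lerDr ltW.
have -> : K * (e / (4 * K)) *+ 2 = e / 2 by rewrite mulr2n; field; rewrite ?lt0r_neq0.
lra.
Qed.

Lemma cauchy_star (s : cauchy_seq) : cauchy (fun n => TStar (s n)).
Proof.
move=> e /(cseqP s)[N h]; exists N => m n hm hn r /=.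
by rewrite -starB cnorm_star h.
Qed.

(** Agreement in every representation, so that the quotient is the separated completion of the
    *-polynomials. *)
Definition cauchy_eqv (s t : cauchy_seq) : bool := `[< forall r, lim r s = lim r t >].

Lemma cauchy_eqv_equiv : equiv_class_of cauchy_eqv.
Proof.
split=> [s|s t|t s u]; first exact/asboolP.
  by apply/asboolP/asboolP => h r.
by move=> /asboolP h /asboolP h'; apply/asboolP => r; rewrite h.
Qed.
Canonical cauchy_eqv_rel := EquivRelPack cauchy_eqv_equiv.

Variable r0 : rep.

(* [r0] makes the algebra nontrivial. *)
Definition qaut_completion := let _ := r0 in {eq_quot cauchy_eqv_rel}.
HB.instance Definition _ := Choice.on qaut_completion.
HB.instance Definition _ := Quotient.on qaut_completion.
Local Notation A := qaut_completion.

Definition evalA (r : rep) (x : A) : rep_alg r := lim r (repr x).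

Lemma evalA_pi r (s : cauchy_seq) : evalA r (\pi_A s) = lim r s.
Proof.
have : repr (\pi_A s) = s %[mod {eq_quot cauchy_eqv_rel}] by rewrite reprK.
by move/eqmodP => /= /asboolP h; rewrite /evalA h.
Qed.

(** Representations separate points. Every algebraic law of the quotient is therefore checked after
    evaluation, where it holds already. *)
Lemma evalA_inj (x y : A) : (forall r, evalA r x = evalA r y) -> x = y.
Proof.
move=> h; rewrite -(reprK x) -(reprK y); apply/eqmodP/asboolP => r.
exact: h.
Qed.

Definition cstA (t : term) : A := \pi_A (CauchySeq (cauchy_cst t)).

Lemma evalA_cst r t : evalA r (cstA t) = eval r t.
Proof. by rewrite evalA_pi; apply/lim_eq/converges_cst. Qed.

Definition addA (x y : A) : A := \pi_A (CauchySeq (cauchyD (repr x) (repr y))).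
Definition mulA (x y : A) : A := \pi_A (CauchySeq (cauchyM (repr x) (repr y))).
Definition starA (x : A) : A := \pi_A (CauchySeq (cauchy_star (repr x))).
Definition scaleA (a : R[i]) (x : A) : A := mulA (cstA (TScal a)) x.
Definition oppA (x : A) : A := scaleA (-1) x.

Lemma evalA_add r x y : evalA r (addA x y) = evalA r x + evalA r y.
Proof. by rewrite evalA_pi; apply/lim_eq/convergesD; apply: limP. Qed.

Lemma evalA_mul r x y : evalA r (mulA x y) = evalA r x * evalA r y.
Proof. by rewrite evalA_pi; apply/lim_eq/convergesM; apply: limP. Qed.

Lemma evalA_starA r x : evalA r (starA x) = star (evalA r x).
Proof. by rewrite evalA_pi; apply/lim_eq/converges_star; apply: limP. Qed.

Lemma evalA_scale r a x : evalA r (scaleA a x) = a *: evalA r x.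
Proof. by rewrite evalA_mul evalA_cst /= -scalerAl mul1r. Qed.

Lemma evalA_opp r x : evalA r (oppA x) = - evalA r x.
Proof. by rewrite evalA_scale scaleN1r. Qed.

Lemma evalA_zero r : evalA r (cstA (TScal 0)) = 0.
Proof. by rewrite evalA_cst /= scale0r. Qed.

Lemma evalA_one r : evalA r (cstA (TScal 1)) = 1.
Proof. by rewrite evalA_cst /= scale1r. Qed.

Let evalE := (evalA_add, evalA_mul, evalA_scale, evalA_opp, evalA_zero, evalA_one).

Fact addA_A : associative addA.
Proof. by move=> x y z; apply: evalA_inj => r; rewrite !evalE addrA. Qed.
Fact addA_C : commutative addA.
Proof. by move=> x y; apply: evalA_inj => r; rewrite !evalE addrC. Qed.
Fact addA_0 : left_id (cstA (TScal 0)) addA.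
Proof. by move=> x; apply: evalA_inj => r; rewrite !evalE add0r. Qed.
Fact addA_N : left_inverse (cstA (TScal 0)) oppA addA.
Proof. by move=> x; apply: evalA_inj => r; rewrite !evalE addNr. Qed.
HB.instance Definition _ := GRing.isZmodule.Build A addA_A addA_C addA_0 addA_N.

Fact mulA_A : associative mulA.
Proof. by move=> x y z; apply: evalA_inj => r; rewrite !evalE mulrA. Qed.
Fact mulA_1l : left_id (cstA (TScal 1)) mulA.
Proof. by move=> x; apply: evalA_inj => r; rewrite !evalE mul1r. Qed.
Fact mulA_1r : right_id (cstA (TScal 1)) mulA.
Proof. by move=> x; apply: evalA_inj => r; rewrite !evalE mulr1. Qed.
Fact mulA_Dl : left_distributive mulA +%R.
Proof. by move=> x y z; apply: evalA_inj => r; rewrite !evalE mulrDl. Qed.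
Fact mulA_Dr : right_distributive mulA +%R.
Proof. by move=> x y z; apply: evalA_inj => r; rewrite !evalE mulrDr. Qed.
Fact oneA_neq0 : cstA (TScal 1) != 0.
Proof.
apply/eqP => /(congr1 (evalA r0)); rewrite !evalE => /eqP.
by rewrite oner_eq0.
Qed.
HB.instance Definition _ := GRing.Zmodule_isNzRing.Build A
  mulA_A mulA_1l mulA_1r mulA_Dl mulA_Dr oneA_neq0.

Fact scaleA_A a b (x : A) : scaleA a (scaleA b x) = scaleA (a * b) x.
Proof. by apply: evalA_inj => r; rewrite !evalE scalerA. Qed.
Fact scaleA_1 : left_id 1 scaleA.
Proof. by move=> x; apply: evalA_inj => r; rewrite !evalE scale1r. Qed.
Fact scaleA_Dr : right_distributive scaleA +%R.
Proof. by move=> a x y; apply: evalA_inj => r; rewrite !evalE scalerDr. Qed.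
Fact scaleA_Dl (x : A) : {morph scaleA^~ x : a b / a + b}.
Proof. by move=> a b; apply: evalA_inj => r; rewrite !evalE scalerDl. Qed.
HB.instance Definition _ := GRing.Zmodule_isLmodule.Build R[i] A
  scaleA_A scaleA_1 scaleA_Dr scaleA_Dl.

Lemma evalAD r (x y : A) : evalA r (x + y) = evalA r x + evalA r y.
Proof. exact: evalA_add. Qed.
Lemma evalAM r (x y : A) : evalA r (x * y) = evalA r x * evalA r y.
Proof. exact: evalA_mul. Qed.
Lemma evalAZ r a (x : A) : evalA r (a *: x) = a *: evalA r x.
Proof. exact: evalA_scale. Qed.
Let evalRE := (evalAD, evalAM, evalAZ).

Fact scaleA_Al a (x y : A) : a *: (x * y) = (a *: x) * y.
Proof. by apply: evalA_inj => r; rewrite !evalRE scalerAl. Qed.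
HB.instance Definition _ := GRing.Lmodule_isLalgebra.Build R[i] A scaleA_Al.
Fact scaleA_Ar a (x y : A) : a *: (x * y) = x * (a *: y).
Proof. by apply: evalA_inj => r; rewrite !evalRE scalerAr. Qed.
HB.instance Definition _ := GRing.Lalgebra_isAlgebra.Build R[i] A scaleA_Ar.

Fact evalA_linear r : linear (evalA r).
Proof. by move=> a x y; rewrite !evalRE. Qed.
HB.instance Definition _ r := GRing.isLinear.Build R[i] A (rep_alg r) *:%R (evalA r) (evalA_linear r).
Fact evalA_monoid r : monoid_morphism (evalA r).
Proof. by split=> [|x y]; [apply: evalA_one | apply: evalAM]. Qed.
HB.instance Definition _ r := GRing.isMonoidMorphism.Build A (rep_alg r) (evalA r) (evalA_monoid r).

(** Although the representations form a large type, the norms of [x] in them form a set of reals,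
    which has a supremum. *)
Definition norms (x : A) : set R := [set c | exists r, c = cnorm (evalA r x)].
Definition normA (x : A) : R := sup (norms x).

Lemma normA_le x c : (forall r, cnorm (evalA r x) <= c) -> normA x <= c.
Proof.
move=> h; apply: ge_sup; first by exists (cnorm (evalA r0 x)); exists r0.
by move=> _ [r ->].
Qed.

Lemma le_normA r x : cnorm (evalA r x) <= normA x.
Proof.
apply: ub_le_sup; last by exists r.
have [K _ [N h]] := cauchy_bounded (repr x); have [N' h'] := lim_uniform (repr x) ltr01.
exists (K + 1) => _ [r' ->]; set n := maxn N N'.
have := h n (leq_maxl _ _) r'; have := h' n (leq_maxr _ _) r'.
rewrite -/(evalA r' x); set y := eval _ _ => h1 h2.
by rewrite -[evalA r' x](subKr y) (le_trans (cnormB _ _)) //; lra.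
Qed.

Lemma normA_ge0 x : 0 <= normA x.
Proof. exact: le_trans (cnorm_ge0 _) (le_normA r0 x). Qed.

Fact starA_K : involutive starA.
Proof. by move=> x; apply: evalA_inj => r; rewrite !evalA_starA starK. Qed.
Fact starA_D (x y : A) : starA (x + y) = starA x + starA y.
Proof. by apply: evalA_inj => r; rewrite evalA_starA !evalAD !evalA_starA starD. Qed.
Fact starA_Z (a : R[i]) (x : A) : starA (a *: x) = Num.conj a *: starA x.
Proof. by apply: evalA_inj => r; rewrite evalA_starA !evalAZ !evalA_starA starZ. Qed.
Fact starA_M (x y : A) : starA (x * y) = starA y * starA x.
Proof. by apply: evalA_inj => r; rewrite evalA_starA !evalAM !evalA_starA starM. Qed.

Fact normA_eq0 (x : A) : normA x = 0 -> x = 0.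
Proof.
move=> x0; apply: evalA_inj => r; rewrite raddf0; apply/cnorm_eq0/eqP.
by rewrite eq_le cnorm_ge0 -x0 le_normA.
Qed.

Fact normA_D (x y : A) : normA (x + y) <= normA x + normA y.
Proof.
by apply: normA_le => r; rewrite evalAD (le_trans (cnormD _ _)) // lerD ?le_normA.
Qed.

Fact normA_Z (a : R[i]) (x : A) : normA (a *: x) = Normc.normc a * normA x.
Proof.
have na0 (b : R[i]) : 0 <= Normc.normc b by case: b => u v /=; apply: sqrtr_ge0.
have le b y : normA (b *: y) <= Normc.normc b * normA y.
  by apply: normA_le => r; rewrite evalAZ cnormZ ler_wpM2l ?le_normA.
apply/eqP; rewrite eq_le le /=; have [->|a0] := eqVneq a 0.
  by rewrite Normc.normc0 mul0r normA_ge0.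
have nap : 0 < Normc.normc a.
  by rewrite lt_def na0 andbT; apply: contraNneq a0 => /Normc.eq0_normc ->.
have := le a^-1 (a *: x); rewrite scalerA mulVf // scale1r Normc.normcV.
by rewrite ler_pdivlMl.
Qed.

Fact normA_M (x y : A) : normA (x * y) <= normA x * normA y.
Proof.
apply: normA_le => r; rewrite evalAM (le_trans (cnormM _ _)) //.
by rewrite ler_pM ?cnorm_ge0 ?le_normA.
Qed.

Fact normA_star (x : A) : normA (starA x * x) = normA x ^+ 2.
Proof.
apply/eqP; rewrite eq_le; apply/andP; split.
  apply: normA_le => r; rewrite evalAM evalA_starA cstar_identity.
  by rewrite ler_pXn2r ?nnegrE ?cnorm_ge0 ?normA_ge0 ?le_normA.
rewrite -[leRHS]sqr_sqrtr ?normA_ge0 // ler_pXn2r ?nnegrE ?normA_ge0 ?sqrtr_ge0 //.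
apply: normA_le => r; rewrite -[leLHS]ger0_norm ?cnorm_ge0 // -sqrtr_sqr ler_sqrt ?normA_ge0 //.
by rewrite -cstar_identity -evalA_starA -evalAM le_normA.
Qed.

Lemma evalA_approx (x : A) (e : R) : 0 < e ->
  exists t, forall r, cnorm (evalA r x - eval r t) < e.
Proof.
move=> e0; have [N h] := lim_uniform (repr x) e0; exists (repr x N) => r.
by rewrite -cnormN opprB h.
Qed.

(** Approximate [s n] by a single term [t n] within [1 / (n + 1)], uniformly in all representations.
    The sequence [t] is itself Cauchy, and its class is the limit. *)
Fact normA_complete (s : nat -> A) :
  (forall e : R, 0 < e -> exists N : nat, forall m n : nat,
     (N <= m)%N -> (N <= n)%N -> normA (s m - s n) < e) ->
  exists l : A, forall e : R, 0 < e -> exists N : nat, forall n : nat,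
     (N <= n)%N -> normA (s n - l) < e.
Proof.
move=> cs; have inv0 (n : nat) : 0 < n.+1%:R^-1 :> R by rewrite invr_gt0.
have [t tP] := choice (fun n => evalA_approx (s n) (inv0 n)).
have small (e : R) : 0 < e -> exists N : nat, forall n : nat, (N <= n)%N -> n.+1%:R^-1 < e.
  move=> e0; exists (Num.bound e^-1) => n hn.
  rewrite invf_plt ?posrE ?ltr0n //; apply: lt_le_trans (archi_boundP _) _.
    by rewrite invr_ge0 ltW.
  by rewrite ler_nat (leq_trans hn).
have ct : cauchy t.
  move=> e e0; have e3 : 0 < e / 3 by rewrite divr_gt0.
  have [N1 h1] := small _ e3; have [N2 h2] := cs _ e3.
  exists (maxn N1 N2) => m n; rewrite !geq_max => /andP[/h1 m1 m2] /andP[/h1 n1 n2] r.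
  have hm := lt_trans (tP m r) m1; have hn := lt_trans (tP n r) n1.
  have hmn := le_lt_trans (le_normA r _) (h2 m n m2 n2).
  have -> : eval r (t m) - eval r (t n) =
      - (evalA r (s m) - eval r (t m)) + evalA r (s m - s n) + (evalA r (s n) - eval r (t n)).
    by rewrite (raddfB (evalA r)) /= opprB !subrKA.
  rewrite (le_lt_trans (cnormD _ _)) // (le_lt_trans (lerD (cnormD _ _) (lexx _))) //.
  by rewrite cnormN; lra.
exists (\pi_A (CauchySeq ct)) => e e0; have e4 : 0 < e / 4 by rewrite divr_gt0.
have [N1 h1] := small _ e4; have [N2 h2] := lim_uniform (CauchySeq ct) e4.
exists (maxn N1 N2) => n; rewrite geq_max => /andP[/h1 n1 n2].
apply: (@le_lt_trans _ _ (e / 2)); last by lra.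
apply: normA_le => r; rewrite (raddfB (evalA r)) /= evalA_pi.
rewrite -(subrKA (eval r (t n))) (le_trans (cnormD _ _)) //.
have := lt_trans (tP n r) n1; have := h2 n n2 r; rewrite /=; lra.
Qed.

HB.instance Definition _ := isCStarAlgebra.Build R A starA_K starA_D starA_Z starA_M
  normA_eq0 normA_D normA_Z normA_M normA_star normA_complete.

Definition genA (i j : G) : A := cstA (TGen i j).

Lemma genA_relations : qaut_relations genA.
Proof.
split=> [i j|i|i|i j].
- split; apply: evalA_inj => r; last first.
    by rewrite expr2 evalAM evalA_cst -expr2; case: (rep_rel r) => /(_ i j)[].
  by rewrite evalA_starA evalA_cst; case: (rep_rel r) => /(_ i j)[].
- apply: evalA_inj => r; rewrite raddf_sum rmorph1 /=.
  under eq_bigr do rewrite evalA_cst.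
  by case: (rep_rel r) => _ ->.
- apply: evalA_inj => r; rewrite raddf_sum rmorph1 /=.
  under eq_bigr do rewrite evalA_cst.
  by case: (rep_rel r) => _ _ ->.
apply: evalA_inj => r; rewrite !raddf_sum /=.
under eq_bigr do rewrite evalAM evalA_cst rmorph_nat.
under [RHS]eq_bigr do rewrite evalAM evalA_cst rmorph_nat.
by case: (rep_rel r) => _ _ _ ->.
Qed.

Lemma genA_generated : generated_by genA.
Proof.
move=> S [clS S1 SL SM Sst] Sg.
have S0 : S 0 by rewrite -[X in S X](addNr 1) -scaleN1r; apply: SL.
have Sc t : S (cstA t).
  elim: t => [i j|a|t1 h1 t2 h2|t1 h1 t2 h2|t1 h1]; first exact: Sg.
  - have -> : cstA (TScal a) = a *: 1 + 0; last exact: SL.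
    by apply: evalA_inj => r; rewrite addr0 evalA_cst evalAZ rmorph1.
  - have -> : cstA (TAdd t1 t2) = 1 *: cstA t1 + cstA t2; last exact: SL.
    by apply: evalA_inj => r; rewrite scale1r evalAD !evalA_cst.
  - have -> : cstA (TMul t1 t2) = cstA t1 * cstA t2; last exact: SM.
    by apply: evalA_inj => r; rewrite evalAM !evalA_cst.
  have -> : cstA (TStar t1) = star (cstA t1); last exact: Sst.
  by apply: evalA_inj => r; rewrite evalA_starA !evalA_cst.
move=> x; apply: clS => e e0; have e2 : 0 < e / 2 by rewrite divr_gt0.
have [t h] := evalA_approx x e2; exists (cstA t) => //.
apply: (@le_lt_trans _ _ (e / 2)); last by lra.
by apply: normA_le => r; rewrite (raddfB (evalA r)) /= evalA_cst ltW.
Qed.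

Lemma genA_universal : is_qaut_algebra genA.
Proof.
split; [exact: genA_relations | exact: genA_generated |].
move=> B v vr; pose f : {lrmorphism A -> rep_alg (Rep vr)} := evalA (Rep vr).
exists f; split => [x|i j]; first exact: (evalA_starA (Rep vr) x).
exact: (evalA_cst (Rep vr) (TGen i j)).
Qed.
End Universal.

Lemma has_quantum_symmetries_of_rep (R : realType) (G : sgraph) (B : cstarAlgType R)
    (v : G -> G -> B) : qaut_relations v ->
  (exists i j k l, v i j * v k l <> v k l * v i j) -> has_quantum_symmetries R G.
Proof.
move=> vr [i [j [k [l nc]]]]; pose r0 := Rep vr.
exists (qaut_completion r0), (@genA R G r0); split; first exact: genA_universal.
exists (genA r0 i j), (genA r0 k l) => e; apply: nc.
by have := congr1 (evalA (r0 := r0) r0) e; rewrite !evalAM !evalA_cst.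
Qed.

Local Open Scope ring_scope.

(** * Matrices as a C*-algebra *)

Lemma cauchy_real (R : realType) (s : nat -> R) :
  (forall e, 0 < e -> exists N, forall m n, (N <= m)%N -> (N <= n)%N -> `|s m - s n| < e) ->
  exists l, forall e, 0 < e -> exists N, forall n, (N <= n)%N -> `|s n - l| < e.
Proof.
move=> sC; pose E := [set x : R | exists N, forall n, (N <= n)%N -> x <= s n]%classic.
(* [E] consists of the eventual lower bounds of [s]; its supremum is the limit inferior, here the
   limit. *)
have near e : 0 < e -> exists N, forall n, (N <= n)%N -> E (s n - e) /\ ubound E (s n + e).
  move=> e0; have [N hN] := sC e e0; exists N => n Nn; split.
    exists N => m Nm; have := hN n m Nn Nm; rewrite ltr_norml => /andP[_ h].
    by rewrite lerBlDr -lerBlDl ltW.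
  move=> x [M hM]; have := hM _ (leq_maxl M N); have := hN n _ Nn (leq_maxr M N).
  rewrite ltr_norml => /andP[h _] /le_trans; apply.
  lra.
have [N hN] := near 1 ltr01; have [EN ubN] := hN N (leqnn N).
have supE : has_sup E by split; [exists (s N - 1)|exists (s N + 1)].
exists (sup E) => e e0; have e2 : 0 < e / 2 by rewrite divr_gt0.
have [M hM] := near _ e2; exists M => n Mn; have [h1 h2] := hM n Mn.
have := sup_upper_bound supE h1; have := ge_sup supE.1 h2.
rewrite ltr_norml; lra.
Qed.

HB.lock Definition adjoint (C : numClosedFieldType) n (x : 'M[C]_n) : 'M[C]_n := (x ^t*)%sesqui.

Section DotMx.
Variables (C : numClosedFieldType) (n : nat).
Implicit Types (v w : 'rV[C]_n) (a : C).

Definition dnorm v : C := sqrtC (dotmx v v).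

Lemma dnormmx_ge0 v : 0 <= dnorm v.
Proof. by rewrite sqrtC_ge0 dnorm_ge0. Qed.

Lemma dnormmx_sqr v : dnorm v ^+ 2 = dotmx v v.
Proof. exact: sqrtCK. Qed.

Lemma dnormmx_eq0 v : (dnorm v == 0) = (v == 0).
Proof. by rewrite sqrtC_eq0 dnorm_eq0. Qed.

Lemma dnormmxZ a v : dnorm (a *: v) = `|a| * dnorm v.
Proof. by rewrite /dnorm dnormZ sqrtCM ?nnegrE ?exprn_ge0 ?dnorm_ge0 // sqrCK. Qed.

Lemma dnormmxD v w : dnorm (v + w) <= dnorm v + dnorm w.
Proof. by case: (triangle_lerif (@dotmx C n) v w). Qed.

Lemma dotmx_le v w : `|dotmx v w| <= dnorm v * dnorm w.
Proof. by case: (CauchySchwarz_sqrt (@dotmx C n) v w). Qed.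

Lemma dotmx_adjoint v w (x : 'M[C]_n) : dotmx (v *m x) w = dotmx v (w *m adjoint x).
Proof. by rewrite !dotmxE adjoint.unlock trmx_mul map_mxM /= trmxCK mulmxA. Qed.

Lemma dotmx_delta v i : dotmx v (delta_mx 0 i) = v 0 i.
Proof. by rewrite dotmxE trmx_delta map_delta_mx -colE mxE. Qed.

Lemma dnormmx_delta i : dnorm (delta_mx 0 i) = 1.
Proof. by rewrite /dnorm dotmx_delta mxE !eqxx sqrtC1. Qed.
End DotMx.

Section MatrixAlgebra.
Variables (R : realType) (n : nat).
Local Notation C := (R[i]).
Local Notation V := 'rV[C]_n.+1.
Local Notation M := 'M[C]_n.+1.
Implicit Types (v w : V) (x y : M) (a : C).

Lemma normcE a : `|a| = (Normc.normc a)%:C%C. Proof. by []. Qed.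

Lemma real_complexD (r s : R) : (r + s)%:C%C = r%:C%C + s%:C%C :> C.
Proof. exact: rmorphD. Qed.

Lemma real_complexM (r s : R) : (r * s)%:C%C = r%:C%C * s%:C%C :> C.
Proof. exact: rmorphM. Qed.

Lemma normc_ge0 a : 0 <= Normc.normc a.
Proof. by case: a => *; rewrite sqrtr_ge0. Qed.

Lemma vnorm_subproof : {f : V -> R | forall v, (f v)%:C%C = dnorm v}.
Proof.
exists (fun v => complex.Re (dnorm v)) => v; case: (dnorm v) (dnormmx_ge0 v) => x y.
by rewrite lecE /= => /andP[/eqP -> _].
Qed.

Definition vnorm : V -> R := sval vnorm_subproof.

Lemma vnormE v : (vnorm v)%:C%C = dnorm v.
Proof. exact: svalP vnorm_subproof v. Qed.

Lemma vnorm_ge0 v : 0 <= vnorm v.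
Proof. rewrite -lecR vnormE; exact: dnormmx_ge0. Qed.

Lemma vnorm_sqr v : (vnorm v ^+ 2)%:C%C = dotmx v v.
Proof. by rewrite rmorphXn /= vnormE dnormmx_sqr. Qed.

Lemma vnormZ a v : vnorm (a *: v) = Normc.normc a * vnorm v.
Proof.
by apply: complexI; rewrite real_complexM (vnormE v) (vnormE (a *: v)) dnormmxZ normcE. Qed.

Lemma vnormD v w : vnorm (v + w) <= vnorm v + vnorm w.
Proof.
by have := dnormmxD v w; rewrite -!vnormE -real_complexD lecR.
Qed.

Lemma vnorm_eq0 v : vnorm v = 0 -> v = 0.
Proof. by move=> h; apply/eqP; rewrite -dnormmx_eq0 -vnormE h. Qed.

Lemma normc_dotmx v w : Normc.normc (dotmx v w) <= vnorm v * vnorm w.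
Proof. by have := dotmx_le v w; rewrite -!vnormE normcE -real_complexM lecR. Qed.

Lemma vnorm_delta (i : 'I_n.+1) : vnorm (delta_mx 0 i) = 1.
Proof. by apply: complexI; rewrite vnormE dnormmx_delta. Qed.

Lemma vnorm0 : vnorm 0 = 0.
Proof. by rewrite -(scale0r 0) vnormZ Normc.normc0 mul0r. Qed.

Lemma adjointK : involutive (@adjoint C n.+1).
Proof. by move=> x; rewrite adjoint.unlock trmxCK. Qed.

Lemma normc_le_vnorm v i : Normc.normc (v 0 i) <= vnorm v.
Proof.
by rewrite -dotmx_delta (le_trans (normc_dotmx _ _)) // vnorm_delta mulr1.
Qed.

Lemma vnorm_le_sum v : vnorm v <= \sum_i Normc.normc (v 0 i).
Proof.
rewrite {1}[v]row_sum_delta.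
elim/big_ind2: _ => [|v1 r1 v2 r2 h1 h2|i _]; first by rewrite vnorm0.
  by rewrite (le_trans (vnormD _ _)) // lerD.
by rewrite vnormZ vnorm_delta mulr1.
Qed.

Lemma vnorm_mulmx_sum v x : vnorm v <= 1 ->
  vnorm (v *m x) <= \sum_i \sum_j Normc.normc (x i j).
Proof.
move=> v1; have -> : v *m x = \sum_i v 0 i *: row i x.
  by rewrite {1}[v]row_sum_delta mulmx_suml; apply: eq_bigr => i _; rewrite -scalemxAl -rowE.
elim/big_ind2: _ => [|v1' r1 v2' r2 h1 h2|i _]; first by rewrite vnorm0.
  by rewrite (le_trans (vnormD _ _)) // lerD.
rewrite vnormZ -[leRHS]mul1r ler_pM ?normc_ge0 ?vnorm_ge0 //.
  exact: le_trans (normc_le_vnorm _ _) v1.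
by rewrite (le_trans (vnorm_le_sum _)) //; under eq_bigr do rewrite mxE.
Qed.

(** The operator norm of right multiplication on row vectors. The supremum stays hidden behind its
    two characteristic properties: it is a Lipschitz constant, and the least one. *)
Lemma opnorm_subproof : {f : M -> R | forall x,
  (forall v, vnorm (v *m x) <= f x * vnorm v) /\
  forall d, (forall v, vnorm v <= 1 -> vnorm (v *m x) <= d) -> f x <= d}.
Proof.
pose E x := [set vnorm (v *m x) | v in [set v | vnorm v <= 1]]%classic.
exists (fun x => sup (E x)) => x.
have supE : has_sup (E x).
  split; first by exists 0, 0; rewrite /= ?mul0mx vnorm0.
  by exists (\sum_i \sum_j Normc.normc (x i j)) => _ [v v1 <-]; exact: vnorm_mulmx_sum.
split=> [v|d h]; last by apply: ge_sup supE.1 _ => _ [v v1 <-]; exact: h.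
have [v0|v0] := eqVneq (vnorm v) 0; first by rewrite (vnorm_eq0 v0) mul0mx vnorm0 mulr0.
have vp : 0 < vnorm v by rewrite lt_neqAle eq_sym v0 vnorm_ge0.
have hn r w : 0 <= r -> vnorm (r%:C%C *: w) = r * vnorm w.
  by move=> r0; rewrite vnormZ normc_real.
rewrite -ler_pdivrMr // mulrC -hn ?invr_ge0 ?vnorm_ge0 // scalemxAl.
apply: (sup_upper_bound supE); exists ((vnorm v)^-1%:C%C *: v) => //=.
by rewrite hn ?invr_ge0 ?vnorm_ge0 // mulVf.
Qed.

Definition opnorm : M -> R := sval opnorm_subproof.

Lemma le_opnorm v x : vnorm (v *m x) <= opnorm x * vnorm v.
Proof. exact: (svalP opnorm_subproof x).1. Qed.

Lemma opnorm_le x c : (forall v, vnorm v <= 1 -> vnorm (v *m x) <= c) -> opnorm x <= c.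
Proof. exact: (svalP opnorm_subproof x).2. Qed.

Lemma opnorm_ge0 x : 0 <= opnorm x.
Proof.
have := le_opnorm (delta_mx 0 0) x; rewrite vnorm_delta mulr1; apply: le_trans.
exact: vnorm_ge0.
Qed.

Lemma normc_le_opnorm x i j : Normc.normc (x i j) <= opnorm x.
Proof.
have := le_opnorm (delta_mx 0 i) x; rewrite vnorm_delta mulr1 -rowE; apply: le_trans.
by have := normc_le_vnorm (row i x) j; rewrite mxE.
Qed.

Lemma opnorm_le_sum x : opnorm x <= \sum_i \sum_j Normc.normc (x i j).
Proof. by apply: opnorm_le => v; exact: vnorm_mulmx_sum. Qed.

Lemma opnorm_eq0 x : opnorm x = 0 -> x = 0.
Proof.
move=> x0; apply/matrixP => i j; rewrite mxE; apply: Normc.eq0_normc.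
by apply/eqP; rewrite eq_le normc_ge0 andbT -x0 normc_le_opnorm.
Qed.

Lemma opnormD x y : opnorm (x + y) <= opnorm x + opnorm y.
Proof.
apply: opnorm_le => v v1; rewrite mulmxDr (le_trans (vnormD _ _)) // lerD //;
  by rewrite (le_trans (le_opnorm _ _)) // ler_piMr ?opnorm_ge0.
Qed.

Lemma opnormM x y : opnorm (x * y) <= opnorm x * opnorm y.
Proof.
apply: opnorm_le => v v1; have -> : v *m (x * y) = (v *m x) *m y by rewrite mulmxA.
apply: (le_trans (le_opnorm (v *m x) y)).
rewrite [leRHS]mulrC.
apply: ler_wpM2l; first exact: opnorm_ge0.
by rewrite (le_trans (le_opnorm _ _)) // ler_piMr ?opnorm_ge0.
Qed.

Lemma opnormZ_le a x : opnorm (a *: x) <= Normc.normc a * opnorm x.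
Proof.
apply: opnorm_le => v v1.
have -> : v *m (a *: x) = a *: (v *m x) by rewrite scalemxAr.
rewrite vnormZ.
apply: ler_wpM2l; first exact: normc_ge0.
by rewrite (le_trans (le_opnorm _ _)) // ler_piMr ?opnorm_ge0.
Qed.

Lemma opnormZ a x : opnorm (a *: x) = Normc.normc a * opnorm x.
Proof.
apply/eqP; rewrite eq_le opnormZ_le /=.
have [->|a0] := eqVneq a 0; first by rewrite Normc.normc0 mul0r opnorm_ge0.
have na : 0 < Normc.normc a.
  rewrite lt_neqAle normc_ge0 andbT eq_sym; apply: contraNneq a0 => h.
  by apply/eqP/Normc.eq0_normc.
rewrite mulrC -ler_pdivlMr // mulrC -Normc.normcV -[x in leLHS](scalerK a0).
exact: opnormZ_le.
Qed.

(** By Cauchy-Schwarz, since the square of the norm of [v *m x] is the inner product of [v] and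
    [v *m (x * adjoint x)]. As matrices act from the right, the estimate concerns [x * adjoint x];
    the C*-identity follows by applying it to [adjoint x]. *)
Lemma opnorm_adjoint_sqr x : opnorm x ^+ 2 <= opnorm (x * adjoint x).
Proof.
have h v : vnorm v <= 1 -> vnorm (v *m x) <= Num.sqrt (opnorm (x * adjoint x)).
  move=> v1; rewrite -[leLHS]ger0_norm ?vnorm_ge0 // -sqrtr_sqr ler_wsqrtr //.
  have -> : vnorm (v *m x) ^+ 2 = Normc.normc (dotmx v (v *m (x * adjoint x))).
    by rewrite mulmxA -dotmx_adjoint -vnorm_sqr normc_real ?sqr_ge0.
  rewrite (le_trans (normc_dotmx _ _)) // -[leRHS]mul1r ler_pM ?vnorm_ge0 //.
  by rewrite (le_trans (le_opnorm _ _)) // ler_piMr ?opnorm_ge0.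
have := opnorm_le h; rewrite -(ler_pXn2r (n := 2)) ?nnegrE ?sqrtr_ge0 ?opnorm_ge0 //.
by rewrite sqr_sqrtr ?opnorm_ge0.
Qed.

Lemma opnorm_le_adjoint x : opnorm x <= opnorm (adjoint x).
Proof.
have [->|x0] := eqVneq (opnorm x) 0; first exact: opnorm_ge0.
have xp : 0 < opnorm x by rewrite lt_neqAle eq_sym x0 opnorm_ge0.
rewrite -(ler_pM2l xp) -expr2; apply: le_trans (opnorm_adjoint_sqr x) _.
exact: opnormM.
Qed.

Lemma opnorm_adjoint x : opnorm (adjoint x) = opnorm x.
Proof.
have := opnorm_le_adjoint (adjoint x); rewrite adjointK => h.
by apply: le_anti; rewrite h; exact: opnorm_le_adjoint.
Qed.

Lemma opnorm_cstar x : opnorm (adjoint x * x) = opnorm x ^+ 2.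
Proof.
have := opnorm_adjoint_sqr (adjoint x); rewrite adjointK opnorm_adjoint => h.
apply: le_anti; by rewrite h andbT expr2 (le_trans (opnormM _ _)) ?opnorm_adjoint.
Qed.

Lemma adjointD x y : adjoint (x + y) = adjoint x + adjoint y.
Proof. by rewrite adjoint.unlock linearD /= map_mxD. Qed.

Lemma adjointZ a x : adjoint (a *: x) = Num.conj a *: adjoint x.
Proof. by rewrite adjoint.unlock linearZ /= map_mxZ. Qed.

Lemma adjointM x y : adjoint (x * y) = adjoint y * adjoint x.
Proof. by rewrite adjoint.unlock trmx_mul map_mxM. Qed.

Lemma cauchy_complex (s : nat -> C) :
  (forall e, 0 < e -> exists N, forall k m, (N <= k)%N -> (N <= m)%N ->
     Normc.normc (s k - s m) < e) ->
  exists l, forall e, 0 < e -> exists N, forall k, (N <= k)%N -> Normc.normc (s k - l) < e.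
Proof.
move=> sC.
have part (f : C -> R) : (forall a b, `|f a - f b| <= Normc.normc (a - b)) ->
    exists l, forall e, 0 < e -> exists N, forall k, (N <= k)%N -> `|f (s k) - l| < e.
  move=> fL; apply: cauchy_real => e e0; have [N hN] := sC e e0; exists N => k m Nk Nm.
  exact: le_lt_trans (fL _ _) (hN _ _ Nk Nm).
have [|lr hr] := part (@complex.Re R).
  move=> [a b] [c d] /=; rewrite -sqrtr_sqr ler_wsqrtr //; have := sqr_ge0 (b - d); lra.
have [|li hi] := part (@complex.Im R).
  move=> [a b] [c d] /=; rewrite -sqrtr_sqr ler_wsqrtr //; have := sqr_ge0 (a - c); lra.
exists (lr +i* li)%C => e e0; have e2 : 0 < e / 2 by rewrite divr_gt0.
have [N1 h1] := hr _ e2; have [N2 h2] := hi _ e2; exists (maxn N1 N2) => k.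
rewrite geq_max => /andP[/h1 k1 /h2 k2].
have hn (x y : R) : Normc.normc (x +i* y)%C <= `|x| + `|y|.
  rewrite -[leRHS]ger0_norm ?addr_ge0 // -sqrtr_sqr ler_wsqrtr // sqrrD !real_normK ?num_real //.
  by rewrite lerD2r lerDl mulrn_wge0 ?mulr_ge0.
case: (s k) k1 k2 => a b k1 k2; apply: le_lt_trans (hn (a - lr) (b - li)) _.
by rewrite /= in k1 k2; lra.
Qed.

Lemma opnorm_complete (s : nat -> M) :
  (forall e, 0 < e -> exists N, forall k m, (N <= k)%N -> (N <= m)%N ->
     opnorm (s k - s m) < e) ->
  exists l, forall e, 0 < e -> exists N, forall k, (N <= k)%N -> opnorm (s k - l) < e.
Proof.
move=> sC.
have /choice[l hl] (p : 'I_n.+1 * 'I_n.+1) : exists l, forall e, 0 < e ->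
    exists N, forall k, (N <= k)%N -> Normc.normc (s k p.1 p.2 - l) < e.
  apply: cauchy_complex => e e0; have [N hN] := sC e e0; exists N => k m Nk Nm.
  apply: le_lt_trans (hN k m Nk Nm).
  by have := normc_le_opnorm (s k - s m) p.1 p.2; rewrite !mxE.
exists (\matrix_(i, j) l (i, j)) => e e0.
pose d : R := e / (n.+1 * n.+1)%:R / 2.
have d0 : 0 < d by rewrite !divr_gt0 // ltr0n.
have /choice[N hN] (p : 'I_n.+1 * 'I_n.+1) : exists N, forall k, (N <= k)%N ->
    Normc.normc (s k p.1 p.2 - l p) < d by exact: hl.
exists (\max_p N p) => k Nk; apply: le_lt_trans (opnorm_le_sum _) _.
rewrite pair_big /=; apply: (@le_lt_trans _ _ (\sum_(p : 'I_n.+1 * 'I_n.+1) d)).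
  apply: ler_sum => p _; rewrite !mxE -surjective_pairing ltW // hN //.
  exact: leq_trans (leq_bigmax p) Nk.
rewrite sumr_const card_prod card_ord -mulr_natr /d.
have h : (n.+1 * n.+1)%:R != 0 :> R by rewrite pnatr_eq0.
rewrite mulrAC divfK //; lra.
Qed.

Definition matrix_algebra : Type := M.
HB.instance Definition _ := GRing.Algebra.on matrix_algebra.
HB.instance Definition _ := isCStarAlgebra.Build R matrix_algebra adjointK adjointD
  adjointZ adjointM opnorm_eq0 opnormD opnormZ opnormM opnorm_cstar opnorm_complete.

End MatrixAlgebra.

(** The projections of the plane onto the first axis and onto the diagonal. The algebra
    [matrix_algebra R 1] consists of matrices of size 2. *)
Lemma noncommuting_projections (R : realType) : exists (A : cstarAlgType R) (p q : A),
  [/\ projection p, projection q & p * q <> q * p].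
Proof.
pose p : 'M[R[i]]_2 := diag_mx (\row_i (i == 0)%:R).
pose q : 'M[R[i]]_2 := const_mx (2^-1).
have pS : adjoint p = p.
  rewrite adjoint.unlock; apply/matrixP => i j; rewrite !mxE rmorphMn /= conjC_nat [j == i]eq_sym.
  by case: (i =P j) => [->|].
have qS : adjoint q = q.
  by rewrite adjoint.unlock; apply/matrixP => i j; rewrite !mxE fmorphV /= conjC_nat.
have pI : p *m p = p.
  apply/matrixP => i j; rewrite {1}/p mul_diag_mx !mxE.
  by case: (i == 0); rewrite ?mul1r ?mul0r ?mul0rn.
have qI : q *m q = q.
  by apply/matrixP => i j; rewrite !mxE big_ord_recl big_ord1 !mxE; field.
exists (matrix_algebra R 1), p, q; split=> //.
move=> /matrixP/(_ 0 1); rewrite -!mulmxE mul_diag_mx mul_mx_diag !mxE /= mul1r mulr0.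
by move/eqP; rewrite invr_eq0 pnatr_eq0.
Qed.

(** * Graphs with disjoint automorphisms *)

Section PermEntry.
Variables (G : sgraph) (R : realType) (A : cstarAlgType R).
Implicit Type f : {perm G}.

Definition perm_entry f i j : A := (f i == j)%:R.

Lemma perm_entry_row f i : \sum_j perm_entry f i j = 1.
Proof.
rewrite (bigD1 (f i)) //= /perm_entry eqxx big1 ?addr0 // => j.
by rewrite eq_sym => /negbTE ->.
Qed.

Lemma perm_entry_col f j : \sum_i perm_entry f i j = 1.
Proof.
rewrite (bigD1 (f^-1 j)%g) //= /perm_entry permKV eqxx big1 ?addr0 // => i.
by rewrite -(inj_eq (@perm_inj _ f)) permKV => /negbTE ->.
Qed.

Lemma adj_perm_entry f i j : (forall x y, adj (f x) (f y) = adj x y) ->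
  \sum_k (adj i k)%:R * perm_entry f k j = \sum_k perm_entry f i k * (adj k j)%:R.
Proof.
move=> fA; rewrite (bigD1 (f^-1 j)%g) //= /perm_entry permKV eqxx mulr1 big1 ?addr0; last first.
  by move=> k; rewrite -(inj_eq (@perm_inj _ f)) permKV => /negbTE ->; rewrite mulr0.
rewrite [RHS](bigD1 (f i)) //= eqxx mul1r big1 ?addr0; last first.
  by move=> k; rewrite eq_sym => /negbTE ->; rewrite mul0r.
by rewrite -fA permKV.
Qed.
End PermEntry.

Lemma disjoint_automorphisms_qs (R : realType) (G : sgraph) :
  disjoint_automorphisms G -> has_quantum_symmetries R G.
Proof.
case=> s [t [sA tA s1 t1 st]].
have [A [p [q [[pS pI] [qS qI] pq]]]] := noncommuting_projections R.
pose e (f : {perm G}) (i j : G) : A := perm_entry A f i j.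
(* An opaque name for [1 - p - q] keeps [v] a sum of three products when [mulrDr] and [big_split]
   are applied. *)
have [c cE] : exists c : A, c = 1 - p - q by eexists.
(* [(1 - p - q) I + p P_s + q P_t]; on the support of [s] this reads
   [(1 - p) I + p P_s], and off it [(1 - q) I + q P_t] *)
pose v (i j : G) : A := e 1%g i j * c + e s i j * p + e t i j * q.
have vs i j : s i != i -> v i j = e 1%g i j * (1 - p) + e s i j * p.
  have [//|ti si] := st i; first by move=> ->; rewrite eqxx.
  rewrite /v cE; have -> : e t i j = e 1%g i j by rewrite /e /perm_entry ti perm1.
  by rewrite addrAC -mulrDr subrK.
have vt i j : s i = i -> v i j = e 1%g i j * (1 - q) + e t i j * q.
  move=> si; rewrite /v cE; have -> : e s i j = e 1%g i j by rewrite /e /perm_entry si perm1.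
  by rewrite -mulrDr (addrAC _ (- q)) subrK.
have proj (z : A) (a b : bool) : star z = z -> z ^+ 2 = z ->
    star (a%:R * (1 - z) + b%:R * z) = a%:R * (1 - z) + b%:R * z /\
    (a%:R * (1 - z) + b%:R * z) ^+ 2 = a%:R * (1 - z) + b%:R * z.
  have [s0 s1'] : star (0 : A) = 0 /\ star (1 : A) = 1 by rewrite star0 star1.
  move=> zS zI; case: a; case: b; rewrite ?mul1r ?mul0r ?addr0 ?add0r.
  - by rewrite subrK s1' expr1n.
  - by rewrite starB s1' zS expr2 mulrBr mulr1 mulrBl mul1r -expr2 zI subrr subr0.
  - by rewrite zS zI.
  - by rewrite s0 expr0n.
apply: (has_quantum_symmetries_of_rep (B := A) (v := v)).
  split.
  - by move=> i j; have [si|si] := eqVneq (s i) i; rewrite ?(vt i j si) ?(vs i j si); exact: proj.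
  - move=> i; rewrite !big_split /= -!mulr_suml !perm_entry_row !mul1r.
    by rewrite cE (addrAC _ (- q)) !subrK.
  - move=> i; rewrite !big_split /= -!mulr_suml !perm_entry_col !mul1r.
    by rewrite cE (addrAC _ (- q)) !subrK.
  - have adj_e (f : {perm G}) (z : A) (i j : G) : (forall x y, adj (f x) (f y) = adj x y) ->
        \sum_k (adj i k)%:R * (e f k j * z) = \sum_k e f i k * z * (adj k j)%:R.
      move=> fA; under eq_bigr do rewrite mulrA; rewrite -mulr_suml adj_perm_entry // mulr_suml.
      by apply: eq_bigr => k _; rewrite -!mulrA; congr (_ * _); exact/commr_sym/commr_nat.
    move=> i j; under eq_bigr do rewrite !mulrDr; rewrite !big_split /= !adj_e //.
      by rewrite -!big_split /=; apply: eq_bigr => k _; rewrite !mulrDl.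
    by move=> x y; rewrite !perm1.
have /existsP[i si] : [exists i, s i != i].
  apply: contraNT s1 => /existsPn h; apply/eqP/permP => x; rewrite perm1.
  by apply/eqP; have := h x; rewrite negbK.
have /existsP[k tk] : [exists i, t i != i].
  apply: contraNT t1 => /existsPn h; apply/eqP/permP => x; rewrite perm1.
  by apply/eqP; have := h x; rewrite negbK.
(* At these two positions the entries of [v] are [p] and [q]. *)
exists i, (s i), k, (t k).
have sk : s k = k by case: (st k) tk => // ->; rewrite eqxx.
rewrite (vs _ _ si) (vt _ _ sk) /e /perm_entry !perm1 !eqxx !(eq_sym _ (s i)) !(eq_sym _ (t k)).
by rewrite (negbTE si) (negbTE tk) !mul0r !add0r !mul1r.
Qed.

(** * The classification *)

Section Classification.
Local Open Scope nat_scope.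

Lemma classified_compl G : classified (compl_graph G) -> classified G.
Proof.
case=> h; [exact/Or31/commutes_compl | exact: Or33 | apply: Or32].
exact: listed_iso (iso_complK G) h.
Qed.

(** The copies in case (b) have at least two vertices, so an edgeless graph is not covered by it: it
    has at most 3 vertices, or its complement is complete as in case (a). *)
Lemma classified_disconnected G : vertex_transitive G -> ~ connected G -> classified G.
Proof.
move=> vt nconn; have [|h] := pselect (exists x y : G, adj x y).
  by move=> h; apply/Or32/listed_disconnected.
have [n3|n4] := leqP #|G| 3; first exact/Or31/small_commutes.
by apply/Or33/Or41; exists #|G| => //; apply: compl_edgeless.
Qed.

Lemma vt_classified G : vertex_transitive G -> #|G| <= 13 -> classified G.
Proof.
move=> vt n13; have [conn|] := pselect (connected G); last exact: classified_disconnected.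
have vtC := compl_vt vt; have [connC|nconnC] := pselect (connected (compl_graph G)); last first.
  exact/classified_compl/classified_disconnected.
have [d reg] := vt_degree vt; have [dn|dn] := leqP d #|G|.-1./2.
  exact: classified_balanced reg dn n13.
apply: classified_compl; apply: (classified_balanced (d := #|G|.-1 - d)) => // [x|].
  by rewrite compl_degree reg.
rewrite leq_subLR -[X in X <= _]odd_double_half -addnn addnA leq_add2r.
by apply: leq_trans dn; rewrite -add1n leq_add2r leq_b1.
Qed.

Lemma listed_disjoint_automorphisms G : listed G -> disjoint_automorphisms G.
Proof.
case=> [[n n4 h]|[m [H [m2 _ vt H2 h]]]|h|[k k11 h]].
- exact: disjoint_automorphisms_iso h (disjoint_complete n4).
- exact: disjoint_automorphisms_iso h (disjoint_disjoint_copies m2 vt H2).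
- case: h => h; apply: disjoint_automorphisms_iso h _.
  + exact: (disjoint_cd G (isT : 0 < 14)).
  + exact: (disjoint_cd G (isT : 1 < 14)).
  + exact: (disjoint_cd G (isT : 2 < 14)).
- exact: disjoint_automorphisms_iso h (disjoint_cd G (k11 : k.+3 < 14)).
Qed.
End Classification.

(** * From commuting generators to a commutative algebra *)

Section Commutants.

Lemma commutant_closed (R : realType) (A : cstarAlgType R) (T : set A) :
  (forall x, T x -> T (star x)) ->
  closed_star_subalgebra [set x | forall c, T c -> x * c = c * x]%classic.
Proof.
move=> Tstar; split.
- move=> x near c Tc; apply/eqP; rewrite -subr_eq0; apply/eqP/cnorm_eq0/eqP.
  rewrite eq_le cnorm_ge0 andbT; apply/ler_addgt0Pl => e e0; rewrite addr0.
  pose K := 2 * cnorm c + 1; have K0 : 0 < K by rewrite ltr_wpDl ?mulr_ge0 ?cnorm_ge0.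
  have [|y /(_ c Tc) yc xy] := near (e / K); first exact: divr_gt0.
  have -> : x * c - c * x = (x - y) * c - c * (x - y) by rewrite mulrBl mulrBr yc opprB subrKA.
  apply: le_trans (cnormD _ _) _; rewrite cnormN.
  apply: le_trans (lerD (cnormM _ _) (cnormM _ _)) _.
  rewrite (mulrC (cnorm c)) -mulr2n -mulr_natr -mulrA -[leRHS](divfK (lt0r_neq0 K0)).
  by apply: ler_pM; rewrite ?cnorm_ge0 ?mulr_ge0 ?cnorm_ge0 ?(ltW xy) // /K mulrC lerDl ler01.
- by move=> c _; rewrite mul1r mulr1.
- by move=> a x y Sx Sy c Tc; rewrite mulrDl mulrDr -scalerAl -scalerAr Sx ?Sy.
- by move=> x y Sx Sy c Tc; rewrite -mulrA Sy // mulrA Sx // mulrA.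
- move=> x Sx c Tc; apply: (can_inj (@starK R A)); rewrite !starM starK.
  by rewrite Sx //; apply: Tstar.
Qed.

(** The commutant is used twice. That of the generators contains the generators, hence everything,
    so the generators are central; the centre then contains the generators, hence everything. *)
Lemma commutes_no_qs (R : realType) (G : sgraph) : commutes G -> ~ has_quantum_symmetries R G.
Proof.
move=> comm [A [u [[rel gen _] [x [y]]]]]; apply.
have u_star i j : star (u i j) = u i j by case: rel => /(_ i j)[].
have ux i j z : u i j * z = z * u i j.
  apply/esym; have := @gen _ (commutant_closed (T := [set c | exists i j, c = u i j]%classic) _).
  move=> /(_ _ _ z) h; apply: h; last by exists i, j.
    by move=> _ [k [l ->]]; exists k, l.
  by move=> k l _ [k' [l' ->]]; apply: comm.
have := @gen _ (commutant_closed (T := setT) (fun _ _ => I)); apply=> //.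
by move=> i j z _; apply: ux.
Qed.

End Commutants.

Local Open Scope nat_scope.

Theorem theorem1 (R : realType) (G : sgraph)
    (G_vt : vertex_transitive G) (G_le13 : #|G| <= 13) :
  has_quantum_symmetries R G <-> listed G \/ listed (compl_graph G).
Proof.
split=> [qs|GL].
  case: (vt_classified G_vt G_le13) => [/commutes_no_qs|h|h]; [|by left|by right].
  by move=> /(_ R qs).
apply: disjoint_automorphisms_qs; case: GL => [|h]; first exact: listed_disjoint_automorphisms.
exact/disjoint_automorphisms_compl/listed_disjoint_automorphisms.
Qed.
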